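(* Let $N\ge3$, $0<s<2$, $\lambda,\mu,\kappa>0$, $\alpha>1$, $\beta>1$, $\alpha+\beta=2^*(s)$. For every $\tau\ge\underline{S}_{\alpha,\beta,\lambda,\mu}$ there exists a cone $\Omega$ in $\mathbb{R}^N$ such that $S_{\alpha,\beta,\lambda,\mu}(\Omega)=\tau$. Moreover, when $N\ge4$, $\underline{S}_{\alpha,\beta,\lambda,\mu}=S_{\alpha,\beta,\lambda,\mu}(\mathbb{R}^N)$.
   Context: $2^*(s):=\frac{2(N-s)}{N-2}$. A cone in $\mathbb{R}^N$ is an open domain $\Omega$ with Lipschitz boundary such that $tx\in\Omega$ for every $t>0$, $x\in\Omega$. $D_0^{1,2}(\Omega)$ is the completion of $C_c^\infty(\Omega)$ in the norm $(\int_\Omega|\nabla u|^2dx)^{1/2}$; $\mathcal{D}:=D_0^{1,2}(\Omega)\times D_0^{1,2}(\Omega)$. $$S_{\alpha,\beta,\lambda,\mu}(\Omega):=\inf_{(u,v)\in\mathcal{D}\setminus\{(0,0)\}}\frac{\int_\Omega(|\nabla u|^2+|\nabla v|^2)dx}{\Big(\int_\Omega\big(\lambda\frac{|u|^{2^*(s)}}{|x|^s}+\mu\frac{|v|^{2^*(s)}}{|x|^s}+2^*(s)\kappa\frac{|u|^\alpha|v|^\beta}{|x|^s}\big)dx\Big)^{2/2^*(s)}},$$ $$\underline{S}_{\alpha,\beta,\lambda,\mu}:=\inf\{S_{\alpha,\beta,\lambda,\mu}(\Omega):\Omega\text{ is a cone properly contained in }\mathbb{R}^N\setminus\{0\}\}.$$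 *)

(* Defs.v *)
From HB Require Import structures.
From mathcomp Require Import all_boot all_order all_algebra.
From mathcomp Require Import all_classical all_reals all_analysis.

Set Implicit Arguments.
Unset Strict Implicit.
Unset Printing Implicit Defensive.

Import Order.TTheory GRing.Theory Num.Theory.
Import numFieldNormedType.Exports.

Local Open Scope classical_set_scope.
Local Open Scope ring_scope.

(** The measurable space R^n: row vectors with the sigma-algebra generated by
    the coordinate functions, i.e. the Borel sigma-algebra. *)

Section measurable_rV.
Context (R : realType) (n : nat).

Let coor (i : 'I_n) (x : 'rV[R]_n) : measurableTypeR R := x ord0 i.

Let rV_set0 : g_sigma_preimage coor set0.
Proof. exact: sigma_algebra0. Qed.

Let rV_setC A : g_sigma_preimage coor A -> g_sigma_preimage coor (~` A).
Proof. exact: sigma_algebraC. Qed.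

Let rV_bigcup (F : (set 'rV[R]_n)^nat) :
  (forall i, g_sigma_preimage coor (F i)) ->
  g_sigma_preimage coor (\bigcup_i (F i)).
Proof. exact: sigma_algebra_bigcup. Qed.

HB.instance Definition _ := @isMeasurable.Build default_measure_display
  'rV[R]_n (g_sigma_preimage coor) rV_set0 rV_setC rV_bigcup.

Lemma measurable_coor (i : 'I_n) :
  measurable_fun [set: 'rV[R]_n] (fun x : 'rV[R]_n => x ord0 i : R).
Proof.
move=> _ Y mY; rewrite setTI; apply: sub_sigma_algebra => /=.
rewrite -bigcup_seq/=; exists i => /=; first by rewrite mem_index_enum.
by exists Y => //; rewrite setTI.
Qed.

Lemma measurable_fun_coorP d (T : measurableType d) (f : T -> 'rV[R]_n) :
  (forall i, measurable_fun [set: T] (fun x => f x ord0 i : R)) ->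
  measurable_fun [set: T] f.
Proof.
move=> mf _ A mA; rewrite setTI.
suff: (g_sigma_preimage (fun i => coor i \o f)) `<=` measurable.
  by apply; rewrite g_sigma_preimage_comp; exists A => //; rewrite setTI.
apply: smallest_sub; first exact: sigma_algebra_measurable.
rewrite -bigcup_seq; apply: bigcup_sub => i _ B [C mC <-].
exact: mf.
Qed.

End measurable_rV.

Section lebesgue_rV.
Context (R : realType).

Definition cons_rV (n : nat) (p : R * 'rV[R]_n) : 'rV[R]_n.+1 :=
  row_mx (p.1%:M : 'rV[R]_1) p.2.

(** Lebesgue measure on R^n, by iterated products. *)
Fixpoint lebesgue_rV (n : nat) : set 'rV[R]_n -> \bar R :=
  match n with
  | 0 => dirac (0 : 'rV[R]_0)
  | n'.+1 => pushforward
      ((@lebesgue_measure R : set (measurableTypeR R) -> \bar R)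
         \x^ @lebesgue_rV n')%E (@cons_rV n')
  end.

Lemma measurable_cons_rV n :
  measurable_fun [set: measurableTypeR R * 'rV[R]_n] (@cons_rV n).
Proof.
apply: measurable_fun_coorP => i.
rewrite -[n.+1]/(1 + n)%N in i *; case: (splitP i) => j ij.
  have -> : i = lshift n j by apply/val_inj.
  rewrite (_ : (fun x => _) = fst) //; apply/funext => x /=.
  by rewrite /cons_rV row_mxEl (ord1 j) mxE eqxx mulr1n.
have -> : i = rshift 1 j by apply/val_inj.
rewrite (_ : (fun x => _) = (fun v : 'rV[R]_n => v ord0 j : R) \o snd).
  by apply: measurableT_comp => //; exact: measurable_coor.
by apply/funext => x /=; rewrite /cons_rV row_mxEr.
Qed.

Let lebesgue_rV_measure n :
  [/\ @lebesgue_rV n set0 = 0%E, forall A, (0 <= @lebesgue_rV n A)%E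
    & semi_sigma_additive (@lebesgue_rV n)].
Proof.
elim: n => [|n [m0 m_ge0 m_add]] /=.
  by split=> [|A|]; [exact: measure0|exact: measure_ge0|
    exact: measure_semi_sigma_additive].
pose mB := isMeasure.Build _ _ _ (@lebesgue_rV n) m0 m_ge0 m_add.
pose m : {measure set 'rV[R]_n -> \bar R} := HB.pack (@lebesgue_rV n) mB.
pose p : {measure set _ -> \bar R} :=
  [the {measure set _ -> \bar R} of (@lebesgue_measure R \x^ m)%E].
split=> [|A|].
- exact: (measure0 p).
- exact: (measure_ge0 p).
- move=> F mF tF mUF.
  rewrite /pushforward preimage_bigcup.
  have mc A : measurable A -> measurable (@cons_rV n @^-1` A).
    by move=> mA; rewrite -[X in measurable X]setTI; exact: measurable_cons_rV.
  apply: (measure_semi_sigma_additive (fun k => @cons_rV n @^-1` F k)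
           (s := p)).
  + by move=> k; exact: mc.
  + apply/trivIsetP => i j _ _ ij; rewrite -preimage_setI.
    by move/trivIsetP : tF => /(_ _ _ _ _ ij) ->//; rewrite preimage_set0.
  + by rewrite -preimage_bigcup; exact: mc.
Qed.

HB.instance Definition _ n := isMeasure.Build _ _ _ (@lebesgue_rV n)
  (let: And3 h _ _ := lebesgue_rV_measure n in h)
  (let: And3 _ h _ := lebesgue_rV_measure n in h)
  (let: And3 _ _ h := lebesgue_rV_measure n in h).

Lemma lebesgue_rV_box n (A : 'I_n -> set R) :
  (forall i, measurable (A i : set (measurableTypeR R))) ->
  lebesgue_rV [set x : 'rV[R]_n | forall i, A i (x ord0 i)] =
  (\prod_(i < n) lebesgue_measure (A i))%E.
Proof.
elim: n => [|n IH] in A * => mA.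
  rewrite big_ord0 /= diracE mem_set//= => -[].
  by case.
rewrite big_ord_recl -IH; last by move=> i; exact: mA.
rewrite /= /pushforward -[X in (X * _)%E]/(lebesgue_measure (A ord0)).
rewrite -product_measure2E; last 2 first.
- exact: mA.
- rewrite (_ : mkset _ = \bigcap_(i in [set: 'I_n])
     ((fun x : 'rV[R]_n => x ord0 i : measurableTypeR R) @^-1`
        A (lift ord0 i))).
    apply: fin_bigcap_measurable; first exact: finite_finset.
    move=> i _; rewrite -[X in measurable X]setTI.
    by apply: measurable_coor => //; exact: mA.
  by apply/seteqP; split=> x h i; [move=> _|]; exact: h.
congr product_measure2; apply/seteqP.
have cons0 (x : R) (y : 'rV[R]_n) : cons_rV (x, y) ord0 ord0 = x.
  have e : ord0 = lshift n ord0 :> 'I_(1 + n) by exact/val_inj.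
  transitivity (row_mx (x%:M : 'rV_1) y ord0 (lshift n ord0)).
    by rewrite -[in RHS]e.
  by rewrite row_mxEl mxE eqxx.
have consS (x : R) (y : 'rV[R]_n) i :
    cons_rV (x, y) ord0 (lift ord0 i) = y ord0 i.
  have e : lift ord0 i = rshift 1 i :> 'I_(1 + n) by exact/val_inj.
  transitivity (row_mx (x%:M : 'rV_1) y ord0 (rshift 1 i)).
    by rewrite -[in RHS]e.
  by rewrite row_mxEr.
split => -[x y] /=.
  by move=> h; split=> [|i] /=; [have := h ord0; rewrite cons0|
    have := h (lift ord0 i); rewrite consS].
move=> [/= hx hy] i; case: (unliftP ord0 i) => [j ->|->].
  by rewrite consS; exact: hy.
by rewrite cons0.
Qed.

Let sigma_finite_lebesgue_rV n : sigma_finite setT (@lebesgue_rV n).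
Proof.
exists (fun k => [set x : 'rV[R]_n | forall i,
    [set` `[- k%:R, k%:R]] (x ord0 i)]).
  apply/seteqP; split=> // x _.
  exists (\max_(i < n) (Num.truncn `|x ord0 i|).+1)%N => // i /=.
  rewrite in_itv/= -ler_norml.
  apply/ltW/(lt_le_trans (truncnS_gt _)).
  by rewrite ler_nat (leq_bigmax i).
move=> k; split.
  rewrite (_ : mkset _ = \bigcap_(i in [set: 'I_n])
     ((fun x : 'rV[R]_n => x ord0 i : measurableTypeR R) @^-1`
        [set` `[- k%:R, k%:R]])).
    apply: fin_bigcap_measurable; first exact: finite_finset.
    move=> i _; rewrite -[X in measurable X]setTI.
    by apply: measurable_coor => //; exact: measurable_itv.
  by apply/seteqP; split=> x h i; [move=> _|]; exact: h.
rewrite (lebesgue_rV_box (fun=> measurable_itv _)).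
rewrite ltey_eq; apply/orP; left.
 apply: (big_ind (fun x : \bar R => x \is a fin_num)) => //.
  by move=> x y; exact: fin_numM.
by move=> i _; rewrite lebesgue_measure_itv/=; case: ifP.
Qed.

HB.instance Definition _ n :=
  Measure_isSigmaFinite.Build _ _ _ (@lebesgue_rV n) (@sigma_finite_lebesgue_rV n).

End lebesgue_rV.

Section euclidean.
Context (R : realType) (N : nat).
Implicit Types (x y : 'rV[R]_N) (Omega : set 'rV[R]_N).

Definition dotr x y : R := \sum_(i < N) x ord0 i * y ord0 i.

(** The Euclidean norm; [`|x|] on ['rV[R]_N] is the sup norm. *)
Definition enorm x : R := Num.sqrt (dotr x x).

(** [Omega] is locally, near every boundary point [p], the strict epigraph of
    a Lipschitz function [gamma] in some unit direction [e]. The variable of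
    the graph is the component of [x] orthogonal to [e], i.e. the hyperplane
    orthogonal to [e] plays the role of R^(N-1), so that only the values of
    [gamma] on that hyperplane matter. The sup-norm balls and the sup-norm
    Lipschitz condition are equivalent to the Euclidean ones. *)
Definition lipschitz_boundary Omega : Prop :=
  forall p, (closure Omega `\` interior Omega) p ->
  exists (e : 'rV[R]_N) (gamma : 'rV[R]_N -> R) (r : R),
    [/\ enorm e = 1, lipschitz gamma, 0 < r &
        forall x, ball p r x ->
          (Omega x <-> gamma (x - dotr x e *: e) < dotr x e)].

Definition is_cone Omega : Prop :=
  [/\ open Omega, Omega !=set0, connected Omega, lipschitz_boundary Omega &
      forall (t : R) x, 0 < t -> Omega x -> Omega (t *: x)].

Definition partial (i : 'I_N) (f : 'rV[R]_N -> R) : 'rV[R]_N -> R :=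
  fun x => 'D_(delta_mx ord0 i) f x.

Definition grad (f : 'rV[R]_N -> R) (x : 'rV[R]_N) : 'rV[R]_N :=
  \row_i partial i f x.

(** C^oo: the iterated partial derivatives of all orders exist and are
    continuous. *)
Definition smooth (f : 'rV[R]_N -> R) : Prop :=
  forall l : seq 'I_N, continuous (foldr partial f l) /\
    forall i x, derivable (foldr partial f l) x (delta_mx ord0 i).

Definition test_function Omega (phi : 'rV[R]_N -> R) : Prop :=
  let supp := closure [set x | phi x != 0] in
  [/\ smooth phi, compact supp & supp `<=` Omega].

(** 2^*(s); at s = 0 it is the Sobolev exponent 2N/(N-2). *)
Definition crit_exp (s : R) : R := 2 * (N%:R - s) / (N%:R - 2).

Local Notation leb := (@lebesgue_rV R N).

(** [D012 Omega u G]: [u] is (a representative of) an element of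
    D_0^{1,2}(Omega) and [G] is (a representative of) its gradient. For
    N >= 3 the Sobolev inequality embeds the completion of C_c^oo(Omega) in
    L^(2N/(N-2))(Omega): the class of a Cauchy sequence [phi] is identified
    with its limit [u] there, and the continuous extension of the gradient
    maps it to the L^2 limit [G] of the gradients, which is the weak gradient
    of [u]. *)
Definition D012 Omega (u : 'rV[R]_N -> R) (G : 'rV[R]_N -> 'rV[R]_N) : Prop :=
  [/\ measurable_fun Omega u,
      (forall i, measurable_fun Omega (fun x => G x ord0 i)) &
      exists phi : nat -> 'rV[R]_N -> R,
        [/\ forall k, test_function Omega (phi k),
            (fun k => \int[leb]_(x in Omega)
               (enorm (grad (phi k) x - G x) ^+ 2)%R%:E)%E @ \oo --> 0%E &
            (fun k => \int[leb]_(x in Omega)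
               (`|phi k x - u x| `^ crit_exp 0)%R%:E)%E @ \oo --> 0%E]].

Definition S_num Omega (G H : 'rV[R]_N -> 'rV[R]_N) : \bar R :=
  (\int[leb]_(x in Omega) (enorm (G x) ^+ 2 + enorm (H x) ^+ 2)%R%:E)%E.

Definition S_den Omega (s kappa alpha beta lambda mu : R)
    (u v : 'rV[R]_N -> R) : \bar R :=
  (\int[leb]_(x in Omega)
    (lambda * (`|u x| `^ crit_exp s / enorm x `^ s)
     + mu * (`|v x| `^ crit_exp s / enorm x `^ s)
     + crit_exp s * kappa *
         (`|u x| `^ alpha * `|v x| `^ beta / enorm x `^ s))%R%:E)%E.

Definition S_cone (s kappa alpha beta lambda mu : R) Omega : \bar R :=
  ereal_inf [set q | exists (u v : 'rV[R]_N -> R) (G H : 'rV[R]_N -> 'rV[R]_N),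
    [/\ D012 Omega u G, D012 Omega v H,
        ~ {ae leb, forall x, Omega x -> u x = 0 /\ v x = 0} &
        q = (S_num Omega G H /
             S_den Omega s kappa alpha beta lambda mu u v
               `^ (2 / crit_exp s))%E]].

Definition S_low (s kappa alpha beta lambda mu : R) : \bar R :=
  ereal_inf [set S_cone s kappa alpha beta lambda mu Omega | Omega in
    [set Omega | is_cone Omega /\ Omega `<` [set x | x != 0]]].

End euclidean.

Arguments S_cone {R} N s kappa alpha beta lambda mu Omega.
Arguments S_low {R} N s kappa alpha beta lambda mu.

(* Main.v *)
Require Import Defs.
From mathcomp Require Import all_boot all_order all_algebra.
From mathcomp Require Import all_classical all_reals all_analysis.
From mathcomp Require Import measurable_realfun.
From mathcomp Require Import ring lra.

Set Implicit Arguments.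
Unset Strict Implicit.
Unset Printing Implicit Defensive.

Import Order.TTheory GRing.Theory Num.Theory.
Import numFieldNormedType.Exports.

Local Open Scope classical_set_scope.
Local Open Scope ring_scope.


(** Write S(Omega) for the infimum attached to a cone Omega. It decreases when
    Omega grows, so S(R^N) is a lower bound of all its values. The whole
    theorem is read off the one-parameter family of circular cones
    C_c = {x | c rad(x) < x_a}, where rad is the distance to the a-th axis and c
    ranges over R; they shrink as c grows, and they exhaust the complement of a
    half-line as c tends to -oo. Three facts are proved about c |-> S(C_c).

    - S(C_c) tends to +oo with c ([thin_cone]). On the lines transversal to the
      axis, Hardy's inequality bounds the integral of phi^2 / x_a^2 by 4 / c^2
      times the energy. Interpolating with the Sobolev inequality, which follows
      from the Loomis-Whitney inequality, gives a Hardy-Sobolev inequality on C_c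
      whose constant tends to 0, because s > 0 leaves a positive weight to the
      Hardy term ([hardy_sobolev_cone]).

    - S(C_c) is continuous in c ([rayleigh_shear]). The shear
      x |-> x - eps h(x) e_a, where h is a smooth approximation of rad, carries
      test functions of C_c to test functions of C_(c+eps). It preserves volumes
      and changes gradients and the weight |x|^-s by factors that tend to 1.

    - The infimum of S(C_c) over c is S(R^N) ([rayleigh_of_cones]). The axis is
      contained in a subspace of codimension two, which has capacity zero:
      multiplying a test function by a logarithmic cutoff costs little energy and
      puts its support in some C_c.

    The third fact gives S_low = S(R^N). By monotonicity and continuity,
    S(C_c) takes every value larger than S(R^N) ([S_cone_onto]), and the value
    S(R^N) itself is attained by the cone R^N.

    These facts are proved for smooth functions with compact support, in the
    division-free form [rayleigh_ge]. The passage to the completion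
    ([S_coneP]) needs only Fatou's lemma for the denominator, along a subsequence
    that converges almost everywhere, and the convergence of the energies. *)

(** * Coordinates and measurability in R^n *)

Section coordinates.
Context {R : realType} {n : nat}.
Implicit Types (x y : 'rV[R]_n) (i j : 'I_n) (t : R).

Definition upd i t x : 'rV[R]_n := \row_j (if j == i then t else x ord0 j).

Lemma updE i t x j : upd i t x ord0 j = if j == i then t else x ord0 j.
Proof. by rewrite mxE. Qed.

Lemma upd_id i x : upd i (x ord0 i) x = x.
Proof. by apply/rowP => j; rewrite !mxE; case: eqP => // ->. Qed.

Lemma updD i t r x : upd i t x + r *: delta_mx ord0 i = upd i (t + r) x.
Proof.
apply/rowP => j; rewrite !mxE eqxx/=; case: eqP => _.
  by rewrite mulr1.
by rewrite mulr0 addr0.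
Qed.

Lemma coord_norm_le x i : `|x ord0 i| <= `|x|.
Proof.
rewrite [leRHS]/Num.Def.normr/= mx_normrE.
exact: (le_bigmax _ (fun ij => `|x ij.1 ij.2|) (ord0, i)).
Qed.

Lemma norm_lt_coord x (r : R) : 0 < r -> (forall i, `|x ord0 i| < r) -> `|x| < r.
Proof.
move=> r0 h; rewrite [ltLHS]/Num.Def.normr/= mx_normrE.
apply/bigmax_ltP; split => //= -[i j] _ /=; by rewrite (ord1 i).
Qed.

Lemma norm_le_coord x (r : R) : 0 <= r -> (forall i, `|x ord0 i| <= r) -> `|x| <= r.
Proof.
move=> r0 h; rewrite [leLHS]/Num.Def.normr/= mx_normrE.
apply/bigmax_leP; split => //= -[i j] _ /=; by rewrite (ord1 i).
Qed.

Lemma measurable_box (A : 'I_n -> set R) :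
  (forall i, measurable (A i : set (measurableTypeR R))) ->
  measurable [set x : 'rV[R]_n | forall i, A i (x ord0 i)].
Proof.
move=> mA.
rewrite (_ : mkset _ = \bigcap_(i in [set: 'I_n])
     ((fun x : 'rV[R]_n => x ord0 i : measurableTypeR R) @^-1` A i)).
  apply: fin_bigcap_measurable; first exact: finite_finset.
  by move=> i _; rewrite -[X in measurable X]setTI; apply: measurable_coor => //; exact: mA.
by apply/seteqP; split=> x h i; [move=> _; exact: h|exact: (h i I)].
Qed.

(** An open set is the union of the boxes with rational centre and radius
    1/(k+1) that it contains, and there are countably many of them. This makes
    the sigma-algebra generated by the coordinates see the topology. *)
Lemma open_measurable_rV (U : set 'rV[R]_n) : open U -> measurable U.
Proof.
move=> oU.
pose F (qk : 'rV[rat]_n * nat) : set 'rV[R]_n :=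
  let B := [set x : 'rV[R]_n | forall i,
     [set t | `|t - ratr (qk.1 ord0 i)| < (qk.2.+1%:R)^-1] (x ord0 i)] in
  if `[< B `<=` U >] then B else set0.
have -> : U = \bigcup_qk F qk.
  apply/seteqP; split => [x Ux|x [qk _]]; last first.
    by rewrite /F; case: ifPn => [/asboolP BU Bx|_ []]; exact: BU.
  have /nbhs_ballP[e e0 eU] : nbhs x U by exact: open_nbhs_nbhs.
  have [k] := ltr_add_invr (divr_gt0 e0 (ltr0n R 2)).
  have k0 : (0 < k.+1%:R^-1 :> R) by rewrite invr_gt0.
  rewrite add0r; set d := (k.+1%:R^-1 : R) in k0 * => ke.
  have /choice[q qP] : forall i, exists q : rat, `|x ord0 i - ratr q| < d.
    move=> i.
    have /rat_in_itvoo[q] : (x ord0 i - d < x ord0 i + d) by lra.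
    rewrite in_itv/= => /andP[h1 h2]; exists q; rewrite ltr_norml.
    by apply/andP; split; lra.
  exists (\row_i q i, k) => //; rewrite /F; case: ifPn => [_ i /=|/asboolPn]; rewrite ?mxE//.
  case=> y /= By; rewrite -/d in By; apply: eU; rewrite -ball_normE/= distrC.
  apply: norm_lt_coord => // i; rewrite !mxE.
  have := By i; rewrite mxE => h1; have h2 := qP i.
  rewrite (_ : y ord0 i - x ord0 i = (y ord0 i - ratr (q i)) - (x ord0 i - ratr (q i))); last by ring.
  apply: (le_lt_trans (ler_normB _ _)).
  by rewrite -/d in h1 *; move: h1 h2 ke; lra.
apply: countable_bigcupT_measurable; first exact: countableP.
move=> -[q k]; rewrite /F; case: ifPn => // _.
apply: (@measurable_box (fun i => [set t : R | `|t - ratr (q ord0 i)| < k.+1%:R^-1])) => i /=.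
rewrite (_ : mkset _ = `](ratr (q ord0 i) - k.+1%:R^-1), (ratr (q ord0 i) + k.+1%:R^-1)[%classic).
  exact: measurable_itv.
by apply/seteqP; split => t /=; rewrite in_itv/= ltr_distl.
Qed.

Lemma closed_measurable_rV (U : set 'rV[R]_n) : closed U -> measurable U.
Proof.
by move=> cU; rewrite -(setCK U); apply: measurableC; apply: open_measurable_rV; exact: closed_openC.
Qed.

Lemma continuous_measurable_rV (f : 'rV[R]_n -> R) :
  continuous f -> measurable_fun [set: 'rV[R]_n] f.
Proof.
move=> cf; apply: (measurability _ (RGenOpens.measurableE R)).
move=> /= _ [_ [a [b ->] <-]]; rewrite setTI; apply: open_measurable_rV.
by move/continuousP : cf; apply; exact: interval_open.
Qed.

Lemma measurable_upd i : measurable_fun [set: measurableTypeR R * 'rV[R]_n]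
  (fun z => upd i z.1 z.2).
Proof.
apply: measurable_fun_coorP => j.
under eq_fun do rewrite updE.
case: eqP => _; first exact: measurable_fst.
exact: (measurableT_comp (@measurable_coor R n j) measurable_snd).
Qed.

Lemma measurable_upd1 i x :
  measurable_fun [set: measurableTypeR R] (fun t => upd i t x).
Proof.
exact: (measurableT_comp (measurable_upd i) (pair2_measurable x)).
Qed.

End coordinates.

(** * Integration along coordinate lines *)

Section cons_coordinates.
Context {R : realType} {n : nat}.

Lemma cons_rV0 (p : R * 'rV[R]_n) : cons_rV p ord0 ord0 = p.1.
Proof.
have e : ord0 = lshift n ord0 :> 'I_(1 + n) by exact/val_inj.
transitivity (row_mx (p.1%:M : 'rV_1) p.2 ord0 (lshift n ord0)).
  by rewrite -[in RHS]e.
by rewrite row_mxEl mxE eqxx.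
Qed.

Lemma cons_rVS (p : R * 'rV[R]_n) i : cons_rV p ord0 (lift ord0 i) = p.2 ord0 i.
Proof.
have e : lift ord0 i = rshift 1 i :> 'I_(1 + n) by exact/val_inj.
transitivity (row_mx (p.1%:M : 'rV_1) p.2 ord0 (rshift 1 i)).
  by rewrite -[in RHS]e.
by rewrite row_mxEr.
Qed.

Lemma upd0_cons (t r : R) (y : 'rV[R]_n) :
  upd ord0 t (cons_rV (r, y)) = cons_rV (t, y).
Proof.
apply/rowP => j; rewrite updE; case: (unliftP ord0 j) => [k ->|->].
  by rewrite !cons_rVS.
by rewrite eqxx cons_rV0.
Qed.

Lemma updS_cons i (t r : R) (y : 'rV[R]_n) :
  upd (lift ord0 i) t (cons_rV (r, y)) = cons_rV (r, upd i t y).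
Proof.
apply/rowP => j; rewrite updE; case: (unliftP ord0 j) => [k ->|->].
  by rewrite !cons_rVS/= updE (inj_eq (@lift_inj _ ord0)).
by rewrite !cons_rV0.
Qed.

End cons_coordinates.

Section fubini_rV.
Context {R : realType}.
Local Open Scope ereal_scope.
Local Notation leb n := (@lebesgue_rV R n).
Local Notation leb1 := (@lebesgue_measure R).

(** The translated measure agrees with Lebesgue measure on half-open
    intervals, which determine it. *)
Lemma translation_integral (c : R) (f : R -> \bar R) :
  measurable_fun [set: measurableTypeR R] f -> (forall t, 0 <= f t) ->
  \int[leb1]_t f (t + c)%R = \int[leb1]_t f t.
Proof.
move=> mf f0.
pose h (t : measurableTypeR R) : measurableTypeR R := (t + c)%R.
have mh : measurable_fun [set: measurableTypeR R] h.
  by apply: measurable_funD => //; exact: measurable_id.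
pose mu0 := [the measure _ _ of pushforward leb1 h]; pose mu := mu0 mh.
have muE A : measurable A -> leb1 A = mu A.
  apply: lebesgue_measure_unique => _ [[a b] _ <-].
  rewrite /mu/= /pushforward /=.
  rewrite (_ : _ @^-1` _ = `](a - c)%R, (b - c)%R]%classic); last first.
    by apply/seteqP; split => t; rewrite /= !in_itv/= ltrBlDr lerBrDr.
  rewrite !lebesgue_measure_itv/= !lte_fin ltrD2r; case: ifP => // _.
  by rewrite !EFinB; congr EFin; ring.
transitivity (\int[mu]_t f t).
  by rewrite /mu ge0_integral_pushforward.
apply: eq_measure_integral => A mA _; exact/esym/muE.
Qed.

(** The measure on R^(n+1) is the image of a product measure under cons_rV, so
    Tonelli's theorem applies to the first coordinate; the two lemmas
    integrate in the two possible orders. *)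
Lemma integral_cons_rV n (f : 'rV[R]_n.+1 -> \bar R) :
  measurable_fun [set: 'rV[R]_n.+1] f -> (forall x, 0 <= f x) ->
  \int[leb n.+1]_x f x = \int[leb n]_y \int[leb1]_t f (cons_rV (t, y)).
Proof.
move=> mf f0.
transitivity (\int[leb1 \x^ leb n]_z f (cons_rV z)).
  rewrite -[LHS]/(\int[pushforward (leb1 \x^ leb n) (@cons_rV R n)]_x f x).
  by rewrite ge0_integral_pushforward//; exact: measurable_cons_rV.
rewrite -(fubini_tonelli2 (m1 := leb1) (m2 := leb n) (f \o @cons_rV R n))//.
  apply: eq_measure_integral => /= A mA _; apply/esym.
  by apply: product_measure_unique => //= *; rewrite product_measure2E.
  exact: (measurableT_comp mf (@measurable_cons_rV R n)).
by move=> z; exact: f0.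
Qed.

Lemma integral_cons_rV_swap n (f : 'rV[R]_n.+1 -> \bar R) :
  measurable_fun [set: 'rV[R]_n.+1] f -> (forall x, 0 <= f x) ->
  \int[leb n.+1]_x f x = \int[leb1]_t \int[leb n]_y f (cons_rV (t, y)).
Proof.
move=> mf f0; rewrite integral_cons_rV//.
rewrite -(fubini_tonelli (m1 := leb1) (m2 := leb n) (f \o @cons_rV R n))//; last first.
  by move=> z; exact: f0.
exact: (measurableT_comp mf (@measurable_cons_rV R n)).
Qed.

Lemma measurable_cons1 n (y : 'rV[R]_n) :
  measurable_fun [set: measurableTypeR R] (fun t => cons_rV (t, y)).
Proof. exact: (measurableT_comp (@measurable_cons_rV R n) (pair2_measurable y)). Qed.

Lemma measurable_cons2 n (t : R) :
  measurable_fun [set: 'rV[R]_n] (fun y => cons_rV (t, y)).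
Proof.
exact: (measurableT_comp (@measurable_cons_rV R n)
  (pair1_measurable (t : measurableTypeR R))).
Qed.

Definition lineint n (i : 'I_n) (f : 'rV[R]_n -> \bar R) (x : 'rV[R]_n) :=
  \int[leb1]_t f (upd i t x).

Lemma lineint_ge0 n (i : 'I_n) f x : (forall x, 0 <= f x) -> 0 <= lineint i f x.
Proof. by move=> f0; apply: integral_ge0. Qed.

Lemma measurable_lineint n (i : 'I_n) (f : 'rV[R]_n -> \bar R) :
  measurable_fun [set: 'rV[R]_n] f -> (forall x, 0 <= f x) ->
  measurable_fun [set: 'rV[R]_n] (lineint i f).
Proof.
move=> mf f0.
apply: (@measurable_fun_fubini_tonelli_G _ _ _ _ R leb1
  (fun z => f (upd i z.1 z.2))) => //.
exact: (measurableT_comp mf (measurable_upd i)).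
Qed.

(** Tonelli's theorem for an arbitrary coordinate: an inequality between
    integrals over R^n may be checked on the lines parallel to one axis. All
    one-dimensional estimates are transferred to R^n in this way. *)
Lemma le_integral_lineint n (i : 'I_n) (f g : 'rV[R]_n -> \bar R) :
  measurable_fun [set: 'rV[R]_n] f -> (forall x, 0 <= f x) ->
  measurable_fun [set: 'rV[R]_n] g -> (forall x, 0 <= g x) ->
  (forall x, lineint i f x <= lineint i g x) ->
  \int[leb n]_x f x <= \int[leb n]_x g x.
Proof.
elim: n i f g => [[]//|n IH] i f g mf f0 mg g0 fg.
have mF (h : 'rV[R]_n.+1 -> \bar R) : measurable_fun setT h ->
    measurable_fun setT (fun z : measurableTypeR R * 'rV[R]_n => h (cons_rV z)).
  by move=> mh; exact: (measurableT_comp mh (@measurable_cons_rV R n)).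
case: (unliftP ord0 i) fg => [k|] -> fg.
  rewrite !integral_cons_rV_swap//; apply: ge0_le_integral => //.
  - by move=> t _; exact: integral_ge0.
  - by apply: (@measurable_fun_fubini_tonelli_F _ _ _ _ R (leb n) _ (mF f mf)).
  - by apply: (@measurable_fun_fubini_tonelli_F _ _ _ _ R (leb n) _ (mF g mg)).
  move=> t _; apply: (IH k) => //.
  - exact: (measurableT_comp mf (measurable_cons2 t)).
  - exact: (measurableT_comp mg (measurable_cons2 t)).
  move=> y; have := fg (cons_rV (t, y)); rewrite /lineint.
  by under eq_integral do rewrite updS_cons; under [leRHS]eq_integral do rewrite updS_cons.
rewrite !integral_cons_rV//; apply: ge0_le_integral => //.
- by move=> t _; exact: integral_ge0.
- by apply: (@measurable_fun_fubini_tonelli_G _ _ _ _ R leb1 _ (mF f mf)).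
- by apply: (@measurable_fun_fubini_tonelli_G _ _ _ _ R leb1 _ (mF g mg)).
move=> y _; have := fg (cons_rV (0%R, y)); rewrite /lineint.
by under eq_integral do rewrite upd0_cons; under [leRHS]eq_integral do rewrite upd0_cons.
Qed.

Lemma eq_integral_lineint n (i : 'I_n) (f g : 'rV[R]_n -> \bar R) :
  measurable_fun [set: 'rV[R]_n] f -> (forall x, 0 <= f x) ->
  measurable_fun [set: 'rV[R]_n] g -> (forall x, 0 <= g x) ->
  (forall x, lineint i f x = lineint i g x) ->
  \int[leb n]_x f x = \int[leb n]_x g x.
Proof.
move=> mf f0 mg g0 fg; apply/eqP; rewrite eq_le.
by apply/andP; split; apply: (le_integral_lineint (i := i)) => // x; rewrite fg.
Qed.

(** On each line parallel to the i-th axis the shear is a translation, because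
    b does not depend on the i-th coordinate. So shears preserve integrals,
    and no change of variables formula is needed. *)
Lemma integral_shear n (i : 'I_n) (b : 'rV[R]_n -> R) (f : 'rV[R]_n -> \bar R) :
  measurable_fun [set: 'rV[R]_n] b -> (forall t x, b (upd i t x) = b x) ->
  measurable_fun [set: 'rV[R]_n] f -> (forall x, 0 <= f x) ->
  \int[leb n]_x f (x + b x *: delta_mx ord0 i)%R = \int[leb n]_x f x.
Proof.
move=> mb bi mf f0; apply: (eq_integral_lineint (i := i)) => //.
  apply: (measurableT_comp mf); apply: measurable_fun_coorP => j.
  under eq_fun do rewrite !mxE.
  apply: measurable_funD; first exact: measurable_coor.
  exact: measurable_funM.
move=> x; rewrite /lineint.
under eq_integral do rewrite bi updD.
apply: (@translation_integral (b x) (fun t => f (upd i t x))) => //.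
exact: (measurableT_comp mf (measurable_upd1 i x)).
Qed.

End fubini_rV.

(** * Hoelder's inequality for extended-real integrands *)

Section holder_ereal.
Context {R : realType} d (T : measurableType d).
Variable mu : {measure set T -> \bar R}.
Local Open Scope ereal_scope.

Lemma integral_ge0_eq0_ae (f : T -> \bar R) :
  measurable_fun setT f -> (forall x, 0 <= f x) ->
  \int[mu]_x f x = 0 -> {ae mu, forall x, f x = 0}.
Proof.
move=> mf f0 If.
have /(ae_eq_integral_abs mu measurableT mf) : \int[mu]_x `|f x| = 0.
  by rewrite -If; apply: eq_integral => x _; rewrite gee0_abs.
by apply: filterS => x /(_ I).
Qed.

Lemma integral_ae0 (f : T -> \bar R) :
  measurable_fun setT f -> (forall x, 0 <= f x) ->
  {ae mu, forall x, f x = 0} -> \int[mu]_x f x = 0.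
Proof.
move=> mf f0 fae; rewrite -[RHS](integral0 mu setT).
apply: ge0_ae_eq_integral => //.
by apply: filterS fae => x -> _.
Qed.

(** Hoelder's inequality with weights a + b = 1, for integrands with values in
    [0, +oo]: the inner integrals met in iterated estimates may be infinite at
    some points. *)
Lemma holder_poweR (f g : T -> \bar R) (a b : R) :
  measurable_fun setT f -> (forall x, 0 <= f x) ->
  measurable_fun setT g -> (forall x, 0 <= g x) ->
  (0 < a)%R -> (0 < b)%R -> (a + b = 1)%R ->
  \int[mu]_x (f x `^ a * g x `^ b) <=
    (\int[mu]_x f x) `^ a * (\int[mu]_x g x) `^ b.
Proof.
move=> mf f0 mg g0 a0 b0 ab.
have mfg : measurable_fun setT (fun x => f x `^ a * g x `^ b).
  by apply: emeasurable_funM; apply: (measurableT_comp (measurable_poweR _)) => //.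
have fg0 x : 0 <= f x `^ a * g x `^ b by rewrite mule_ge0 ?poweR_ge0.
have [If0|If0] := eqVneq (\int[mu]_x f x) 0.
  rewrite (@integral_ae0 _ mfg fg0) ?mule_ge0 ?poweR_ge0//.
  apply: filterS (integral_ge0_eq0_ae mf f0 If0) => x ->.
  by rewrite poweR0r ?mul0e// gt_eqF.
have [Ig0|Ig0] := eqVneq (\int[mu]_x g x) 0.
  rewrite (@integral_ae0 _ mfg fg0) ?mule_ge0 ?poweR_ge0//.
  apply: filterS (integral_ge0_eq0_ae mg g0 Ig0) => x ->.
  by rewrite poweR0r ?mule0// gt_eqF.
have pf : 0 < \int[mu]_x f x by rewrite lt0e If0 integral_ge0.
have pg : 0 < \int[mu]_x g x by rewrite lt0e Ig0 integral_ge0.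
have [Ify|Ify] := eqVneq (\int[mu]_x f x) +oo.
  by rewrite Ify poweRyr ?gt_eqF// gt0_mulye ?leey// poweR_gt0.
have [Igy|Igy] := eqVneq (\int[mu]_x g x) +oo.
  by rewrite Igy poweRyr ?gt_eqF// gt0_muley ?leey// poweR_gt0.
have intf : mu.-integrable setT f.
  apply/integrableP; split => //; under eq_integral do rewrite gee0_abs//.
  by rewrite ltey.
have intg : mu.-integrable setT g.
  apply/integrableP; split => //; under eq_integral do rewrite gee0_abs//.
  by rewrite ltey.
pose F x := fine (f x); pose G x := fine (g x).
have mF : measurable_fun setT F by exact: measurableT_comp.
have mG : measurable_fun setT G by exact: measurableT_comp.
have F0 x : (0 <= F x)%R by rewrite fine_ge0.
have G0 x : (0 <= G x)%R by rewrite fine_ge0.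
have fF : {ae mu, forall x, f x = (F x)%:E}.
  by apply: filterS (integrable_ae measurableT intf) => x /(_ I) fx; rewrite fineK.
have gG : {ae mu, forall x, g x = (G x)%:E}.
  by apply: filterS (integrable_ae measurableT intg) => x /(_ I) fx; rewrite fineK.
have IfE : \int[mu]_x f x = \int[mu]_x (F x)%:E.
  apply: ge0_ae_eq_integral => //; first exact/measurable_EFinP.
  - by move=> x _; rewrite lee_fin.
  - by apply: filterS fF => x.
have IgE : \int[mu]_x g x = \int[mu]_x (G x)%:E.
  apply: ge0_ae_eq_integral => //; first exact/measurable_EFinP.
  - by move=> x _; rewrite lee_fin.
  - by apply: filterS gG => x.
have mFa : measurable_fun setT (fun x => F x `^ a)%R.
  apply: (measurableT_comp (measurable_powR _)) => //.
have mGb : measurable_fun setT (fun x => G x `^ b)%R.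
  apply: (measurableT_comp (measurable_powR _)) => //.
have ifgE : \int[mu]_x (f x `^ a * g x `^ b) =
            \int[mu]_x (F x `^ a * G x `^ b)%:E.
  apply: ge0_ae_eq_integral => //.
  - apply/measurable_EFinP; exact: measurable_funM.
  - by move=> x _; rewrite lee_fin mulr_ge0 ?powR_ge0.
  - by apply: filterS2 fF gG => x -> -> _; rewrite !poweR_EFin EFinM.
have ab1 : (a^-1^-1 + b^-1^-1 = 1)%R by rewrite !invrK.
have a'0 : (0 < a^-1)%R by rewrite invr_gt0.
have b'0 : (0 < b^-1)%R by rewrite invr_gt0.
have := hoelder mu mFa mGb a'0 b'0 ab1.
rewrite Lnorm1 !unlock !invrK ifgE IfE IgE.
under eq_integral => x _ do rewrite /= ger0_norm ?mulr_ge0 ?powR_ge0//.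
move/le_trans; apply; rewrite le_eqVlt; apply/orP; left; apply/eqP.
congr (_ `^ _ * _ `^ _); apply: eq_integral => x _.
  by rewrite /= ger0_norm ?powR_ge0// -powRrM mulfV ?gt_eqF// powRr1.
by rewrite /= ger0_norm ?powR_ge0// -powRrM mulfV ?gt_eqF// powRr1.
Qed.

End holder_ereal.

(** * The Loomis-Whitney inequality *)

Section products.
Context {R : realType}.
Local Open Scope ereal_scope.

Lemma le_poweR (x y : \bar R) (r : R) :
  (0 <= r)%R -> 0 <= x -> x <= y -> x `^ r <= y `^ r.
Proof.
move=> r0 x0 xy; apply: gt0_ler_poweR => //; rewrite in_itv/= leey andbT//.
exact: le_trans xy.
Qed.

Lemma prode_ge0_ord n (f : 'I_n -> \bar R) :
  (forall i, 0 <= f i) -> 0 <= \prod_(i < n) f i.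
Proof. by move=> f0; elim/big_ind : _ => //; exact: mule_ge0. Qed.

Lemma le_prode_ord n (f g : 'I_n -> \bar R) :
  (forall i, 0 <= f i) -> (forall i, f i <= g i) ->
  \prod_(i < n) f i <= \prod_(i < n) g i.
Proof.
move=> f0 fg.
suff : 0 <= \prod_(i < n) f i <= \prod_(i < n) g i by case/andP.
elim/big_ind2 : _ => //.
- by rewrite lee01 lexx.
- move=> x1 x2 y1 y2 /andP[x10 x12] /andP[y10 y12].
  by rewrite mule_ge0//= lee_pmul.
- by move=> i _; rewrite f0 fg.
Qed.

Lemma prode_poweR n (f : 'I_n -> \bar R) (r : R) : (forall i, 0 <= f i) ->
  (\prod_(i < n) f i) `^ r = \prod_(i < n) (f i `^ r).
Proof.
elim: n f => [|n IH] f f0; first by rewrite !big_ord0 poweR1r.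
by rewrite !big_ord_recl/= poweRM ?IH//; exact: prode_ge0_ord.
Qed.

Lemma measurable_prode d (T : measurableType d) n (f : 'I_n -> T -> \bar R) :
  (forall i, measurable_fun setT (f i)) ->
  measurable_fun setT (fun x => \prod_(i < n) f i x).
Proof.
elim: n f => [|n IH] f mf.
  by under eq_fun do rewrite big_ord0; exact: measurable_cst.
under eq_fun do rewrite big_ord_recl.
by apply: emeasurable_funM => //; exact: IH.
Qed.

(** Induction on the number of factors: the first one is split off with weight
    1/(n+2), and the others are grouped with weight (n+1)/(n+2). *)
Lemma holder_prod d (T : measurableType d) (mu : {measure set T -> \bar R})
    n (f : 'I_n.+1 -> T -> \bar R) :
  (forall i, measurable_fun setT (f i)) -> (forall i x, 0 <= f i x) ->
  \int[mu]_x \prod_(i < n.+1) (f i x `^ n.+1%:R^-1) <=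
  \prod_(i < n.+1) (\int[mu]_x f i x) `^ n.+1%:R^-1.
Proof.
elim: n f => [|n IH] f mf f0.
  rewrite big_ord_recl big_ord0 mule1 invr1 poweRe1; last exact: integral_ge0.
  by under eq_integral do rewrite big_ord_recl big_ord0 mule1 poweRe1//.
have mp i r : measurable_fun setT (fun x => f i x `^ r).
  exact: (measurableT_comp (measurable_poweR _)).
pose b : R := (n.+1%:R / n.+2%:R)%R.
have b0 : (0 < b)%R by rewrite divr_gt0.
have ab : (n.+2%:R^-1 + b = 1)%R.
  by rewrite /b -{1}(mul1r (_^-1)%R) -mulrDl -[1%R]/(1%:R)%R -natrD add1n divff.
have bE : (n.+1%:R^-1 * b = n.+2%:R^-1)%R by rewrite /b mulrA mulVf// mul1r.
have pE (g : 'I_n.+1 -> \bar R) : (forall i, 0 <= g i) ->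
    \prod_(i < n.+1) g i `^ n.+2%:R^-1 =
    (\prod_(i < n.+1) g i `^ n.+1%:R^-1) `^ b.
  move=> g0; rewrite prode_poweR; last by move=> i; exact: poweR_ge0.
  by apply: eq_bigr => i _; rewrite -poweRrM bE.
rewrite big_ord_recl/=.
under eq_integral do rewrite big_ord_recl/= pE//.
rewrite pE; last by move=> i; exact: integral_ge0.
apply: (le_trans (holder_poweR _ _ _ _ _ _ b0 ab)) => //.
- by apply: measurable_prode => i; exact: mp.
- by move=> x; apply: prode_ge0_ord => i; exact: poweR_ge0.
apply: lee_pmul; rewrite ?poweR_ge0//.
apply: le_poweR (ltW b0) _ (IH _ _ _) => //.
apply: integral_ge0 => x _.
by apply: prode_ge0_ord => i; exact: poweR_ge0.
Qed.

End products.

Section loomis_whitney.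
Context {R : realType}.
Local Open Scope ereal_scope.
Local Notation leb n := (@lebesgue_rV R n).
Local Notation leb1 := (@lebesgue_measure R).

Lemma lineint_rV1 (f : 'rV[R]_1 -> \bar R) x :
  measurable_fun setT f -> (forall x, 0 <= f x) ->
  lineint ord0 f x = \int[leb 1]_y f y.
Proof.
move=> mf f0; rewrite integral_cons_rV//=.
rewrite integral_dirac//; last first.
  apply: (@measurable_fun_fubini_tonelli_G _ _ _ _ R leb1
    (fun z => f (cons_rV z))) => //.
  exact: (measurableT_comp mf (@measurable_cons_rV R 0)).
rewrite diracT mul1e /lineint; apply: eq_integral => t _; congr f.
by apply/rowP => j; rewrite updE !(ord1 j) cons_rV0 eqxx.
Qed.

Definition headint n (f : 'rV[R]_n.+1 -> \bar R) (y : 'rV[R]_n) :=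
  \int[leb1]_t f (cons_rV (t, y)).

Lemma headint_ge0 n (f : 'rV[R]_n.+1 -> \bar R) y :
  (forall x, 0 <= f x) -> 0 <= headint f y.
Proof. by move=> f0; exact: integral_ge0. Qed.

Lemma measurable_headint n (f : 'rV[R]_n.+1 -> \bar R) :
  measurable_fun setT f -> (forall x, 0 <= f x) -> measurable_fun setT (headint f).
Proof.
move=> mf f0; apply: (@measurable_fun_fubini_tonelli_G _ _ _ _ R leb1
  (fun z => f (cons_rV z))) => //.
exact: (measurableT_comp mf (@measurable_cons_rV R _)).
Qed.

Lemma integral_headint n (f : 'rV[R]_n.+1 -> \bar R) :
  measurable_fun setT f -> (forall x, 0 <= f x) ->
  \int[leb n]_y headint f y = \int[leb n.+1]_x f x.
Proof. by move=> mf f0; rewrite integral_cons_rV. Qed.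

(** One step of the induction on the dimension. On a line parallel to the
    first axis the factor i = 0 is constant; the n + 1 other factors are
    separated by Hoelder's inequality with equal weights. *)
Lemma lw_fiber n (g : 'I_n.+2 -> 'rV[R]_n.+2 -> \bar R) :
  (forall i, measurable_fun setT (g i)) -> (forall i x, 0 <= g i x) ->
  \int[leb n.+2]_x \prod_(i < n.+2) (lineint i (g i) x `^ n.+1%:R^-1) <=
  \int[leb n.+1]_y (headint (g ord0) y `^ n.+1%:R^-1 *
    \prod_(i < n.+1) (lineint i (headint (g (lift ord0 i))) y `^ n.+1%:R^-1)).
Proof.
move=> mg g0; pose h i := headint (g i).
have mgc i : measurable_fun setT
    (fun z : measurableTypeR R * 'rV[R]_n.+1 => g i (cons_rV z)).
  exact: (measurableT_comp (mg i) (@measurable_cons_rV R n.+1)).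
have mh i : measurable_fun setT (h i).
  exact: measurable_headint.
have h0 i y : 0 <= h i y by exact: headint_ge0.
have mL i : measurable_fun setT (lineint i (g i)) by exact: measurable_lineint.
have mprod : measurable_fun setT
    (fun x => \prod_(i < n.+2) lineint i (g i) x `^ n.+1%:R^-1).
  apply: measurable_prode => i.
  exact: (measurableT_comp (measurable_poweR _) (mL _)).
have prod0 x : 0 <= \prod_(i < n.+2) lineint i (g i) x `^ n.+1%:R^-1.
  by apply: prode_ge0_ord => i; exact: poweR_ge0.
rewrite integral_cons_rV//; apply: ge0_le_integral => //.
- by move=> y _; exact: integral_ge0.
- apply: (@measurable_fun_fubini_tonelli_G _ _ _ _ R leb1 (fun z =>
    \prod_(i < n.+2) (lineint i (g i) (cons_rV z) `^ n.+1%:R^-1))) => //.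
  exact: (measurableT_comp mprod (@measurable_cons_rV R n.+1)).
- apply: emeasurable_funM.
    exact: (measurableT_comp (measurable_poweR _) (mh _)).
  apply: measurable_prode => i.
  exact: (measurableT_comp (measurable_poweR _) (measurable_lineint _ (mh _) (h0 _))).
move=> y _.
pose G (i : 'I_n.+1) t := lineint (lift ord0 i) (g (lift ord0 i)) (cons_rV (t, y)).
have mG i : measurable_fun (setT : set (measurableTypeR R)) (G i).
  exact: (measurableT_comp (mL _) (measurable_cons1 y)).
have G0 i t : 0 <= G i t by exact: lineint_ge0.
under eq_integral => t _.
  rewrite big_ord_recl /lineint.
  under eq_integral do rewrite upd0_cons.
  rewrite -/(headint (g ord0) y); over.
rewrite ge0_integralZl//; last 3 first.
- apply: measurable_prode => i.
  exact: (measurableT_comp (measurable_poweR _) (mG i)).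
- by move=> t _; apply: prode_ge0_ord => i; exact: poweR_ge0.
- exact: poweR_ge0.
apply: lee_pmul; rewrite ?poweR_ge0 ?integral_ge0//.
  by move=> t _; apply: prode_ge0_ord => i; exact: poweR_ge0.
apply: (le_trans (holder_prod _ mG G0)).
apply: le_prode_ord => i; first exact: poweR_ge0.
rewrite le_eqVlt; apply/orP; left; apply/eqP; congr (_ `^ _).
rewrite /G /lineint; under eq_integral do under eq_integral do rewrite updS_cons.
rewrite (fubini_tonelli (m1 := leb1) (m2 := leb1)
  (fun z => g (lift ord0 i) (cons_rV (z.1, upd i z.2 y))))//.
apply: (measurableT_comp (mgc _)); apply: measurable_fun_pair => //=.
exact: (measurableT_comp (measurable_upd1 i y) measurable_snd).
Qed.

(** The Loomis-Whitney inequality, in the form used by Gagliardo: each factor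
    has been integrated over one coordinate. After lw_fiber, Hoelder's
    inequality with weights 1/(n+2) and (n+1)/(n+2) isolates the factor i = 0,
    and the induction hypothesis in one dimension less bounds the product of
    the others. *)
Lemma loomis_whitney n (g : 'I_n.+2 -> 'rV[R]_n.+2 -> \bar R) :
  (forall i, measurable_fun setT (g i)) -> (forall i x, 0 <= g i x) ->
  \int[leb n.+2]_x \prod_(i < n.+2) (lineint i (g i) x `^ n.+1%:R^-1) <=
  \prod_(i < n.+2) (\int[leb n.+2]_x g i x) `^ n.+1%:R^-1.
Proof.
elim: n g => [|n IH] g mg g0; apply: (le_trans (lw_fiber mg g0)).
  rewrite [leRHS]big_ord_recl big_ord_recl big_ord0 mule1 invr1 !poweRe1 ?integral_ge0//.
  set h := headint (g (lift ord0 ord0)).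
  have mh : measurable_fun setT h by exact: measurable_headint.
  have h0 y : 0 <= h y by exact: headint_ge0.
  have mh' : measurable_fun setT (headint (g ord0)) by exact: measurable_headint.
  have h0' y : 0 <= headint (g ord0) y by exact: headint_ge0.
  under eq_integral => y _.
    rewrite big_ord_recl big_ord0 mule1 !poweRe1 ?lineint_ge0//.
    rewrite (@lineint_rV1 h)//; over.
  rewrite ge0_integralZr ?integral_ge0//.
  by rewrite -(integral_headint (mg ord0))// -(integral_headint (mg (lift ord0 ord0))).
pose h i := headint (g i).
have mh i : measurable_fun setT (h i) by exact: measurable_headint.
have h0 i y : 0 <= h i y by exact: headint_ge0.
have hE i : \int[leb n.+2]_y h i y = \int[leb n.+3]_x g i x.
  exact: integral_headint.
pose b : R := (n.+1%:R / n.+2%:R)%R.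
have b0 : (0 < b)%R by rewrite divr_gt0.
have ab : (n.+2%:R^-1 + b = 1)%R.
  by rewrite /b -{1}(mul1r (_^-1)%R) -mulrDl -[1%R]/(1%:R)%R -natrD add1n divff.
have bE : (n.+1%:R^-1 * b = n.+2%:R^-1)%R by rewrite /b mulrA mulVf// mul1r.
have pE (u : 'I_n.+2 -> \bar R) : (forall i, 0 <= u i) ->
    \prod_(i < n.+2) u i `^ n.+2%:R^-1 =
    (\prod_(i < n.+2) u i `^ n.+1%:R^-1) `^ b.
  move=> u0; rewrite prode_poweR; last by move=> i; exact: poweR_ge0.
  by apply: eq_bigr => i _; rewrite -poweRrM bE.
rewrite [leRHS]big_ord_recl pE; last by move=> i; exact: integral_ge0.
under eq_integral => y _.
  rewrite pE; last by move=> i; apply: lineint_ge0 => z; exact: h0.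
  over.
have ml i : measurable_fun setT (lineint i (h (lift ord0 i))).
  exact: measurable_lineint.
apply: (le_trans (holder_poweR _ (mh ord0) _ _ _ _ b0 ab)) => //.
- apply: measurable_prode => i.
  exact: (measurableT_comp (measurable_poweR _) (ml _)).
- by move=> x; apply: prode_ge0_ord => i; exact: poweR_ge0.
rewrite hE; apply: lee_pmul; rewrite ?poweR_ge0//.
apply: le_poweR (ltW b0) _ _.
  apply: integral_ge0 => x _.
  by apply: prode_ge0_ord => i; exact: poweR_ge0.
apply: (le_trans (IH (fun i => h (lift ord0 i)) _ _)) => //.
by apply: le_prode_ord => i; rewrite ?poweR_ge0// hE.
Qed.

End loomis_whitney.

(** * Directional derivatives and chain rules *)

Section directional_derivatives.
Context {R : realType} {V : normedModType R}.
Implicit Types (f g : V -> R) (x v e : V).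

Lemma is_derive_cvg f x v (d : R) :
  h^-1 * (f (x + h *: v) - f x) @[h --> 0^'] --> d -> is_derive x v f d.
Proof.
move=> H.
have E : (fun h => h^-1 *: ((f \o shift x) (h *: v) - f x)) =
         (fun h => h^-1 * (f (x + h *: v) - f x)).
  by apply/funext => h; rewrite /= [h *: v + x]addrC.
split; first by rewrite /derivable E; apply/cvg_ex; exists d.
by rewrite /derive E; exact/(cvg_lim (@Rhausdorff R)).
Qed.

Lemma cvg_is_derive f x v (d : R) :
  is_derive x v f d -> h^-1 * (f (x + h *: v) - f x) @[h --> 0^'] --> d.
Proof.
move=> [df <-].
have E : (fun h => h^-1 *: ((f \o shift x) (h *: v) - f x)) =
         (fun h => h^-1 * (f (x + h *: v) - f x)).
  by apply/funext => h; rewrite /= [h *: v + x]addrC.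
move: df; rewrite /derivable /derive E => /cvg_ex[l Hl];
by rewrite (cvg_lim (@Rhausdorff R) Hl).
Qed.

End directional_derivatives.

Section chain_rules.
Context {R : realType} {V : normedModType R}.
Implicit Types (f g : V -> R) (x v e : V).

Lemma is_derive_line f x v (t d : R) :
  is_derive (x + t *: v) v f d -> is_derive t 1 (fun r : R => f (x + r *: v)) d.
Proof.
move=> /cvg_is_derive H; apply: is_derive_cvg.
apply: cvg_trans H; apply: near_eq_cvg; apply: nearW => h /=.
by rewrite (_ : h *: 1 = h :> R) ?[_ *: _]mulr1// scalerDl addrA.
Qed.

Lemma is_derive_line0 f x v (d : R) :
  is_derive (0 : R) 1 (fun r : R => f (x + r *: v)) d -> is_derive x v f d.
Proof.
move=> /cvg_is_derive H; apply: is_derive_cvg.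
apply: cvg_trans H; apply: near_eq_cvg; apply: nearW => h /=.
by rewrite (_ : h *: 1 = h :> R) ?[_ *: _]mulr1// scale0r addr0 add0r.
Qed.

Lemma is_derive_comp1 f (g : R -> R) x v (df dg : R) :
  is_derive x v f df -> is_derive (f x) 1 g dg ->
  is_derive x v (g \o f) (dg * df).
Proof.
move=> Hf Hg; apply: is_derive_line0.
apply: (@is_derive1_comp _ g (fun r => f (x + r *: v))).
  by rewrite scale0r addr0.
by apply: is_derive_line; rewrite scale0r addr0.
Qed.

Lemma line_MVT f z v (b : R) : (forall y, derivable f y v) ->
  exists2 c, `|c| <= `|b| & f (z + b *: v) - f z = 'D_v f (z + c *: v) * b.
Proof.
move=> df; pose w (r : R) := f (z + r *: v).
have dw (t : R) : is_derive t 1 w ('D_v f (z + t *: v)).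
  by apply: is_derive_line; exact: derivableP.
have cw : continuous w.
  by move=> t; apply/differentiable_continuous/derivable1_diffP; case: (dw t).
have [b0|b0] := leP 0 b.
  have [c cb] := MVT_segment b0 (fun t _ => dw t) (continuous_subspaceT cw).
  rewrite /w scale0r addr0 subr0 => E; exists c => //.
  by move: cb; rewrite in_itv/= => /andP[c0 cb]; rewrite !ger0_norm.
have [c cb] := MVT_segment (ltW b0) (fun t _ => dw t) (continuous_subspaceT cw).
rewrite /w scale0r addr0 sub0r => E; exists c.
  by move: cb; rewrite in_itv/= => /andP[c0 cb]; rewrite !ler0_norm ?lerN2// ltW.
by rewrite -opprB E mulrN opprK.
Qed.

(** Differentiability of f in the directions v and e separately does not
    suffice for a chain rule; continuity of the derivative in the direction e
    does, because the mean value theorem may then be applied to the increment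
    of f along e. *)
Lemma is_derive_shear f (b : V -> R) x v e :
  (forall y, derivable f y e) -> continuous ('D_e f) ->
  derivable f (x + b x *: e) v -> derivable b x v ->
  is_derive x v (fun y => f (y + b y *: e))
    ('D_v f (x + b x *: e) + 'D_v b x * 'D_e f (x + b x *: e)).
Proof.
move=> dfe cfe dfv dbv; apply: is_derive_cvg.
set x0 := x + b x *: e.
pose z (h : R) := x0 + h *: v; pose be (h : R) := b (x + h *: v) - b x.
have /choice[c cP] : forall h, exists c, `|c| <= `|be h| /\
    f (z h + be h *: e) - f (z h) = 'D_e f (z h + c *: e) * be h.
  by move=> h; have [c c1 c2] := line_MVT (z h) (be h) dfe; exists c.
have H1 := cvg_is_derive (derivableP dfv).
have H2 := cvg_is_derive (derivableP dbv).
have E : (fun h : R => h^-1 * (f (x + h *: v + b (x + h *: v) *: e) - f x0)) =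
  (fun h => h^-1 * (f (z h) - f x0) +
            (h^-1 * be h) * 'D_e f (z h + c h *: e)).
  apply/funext => h; have [_ ch] := cP h.
  rewrite -mulrA [be h * _]mulrC -ch -mulrDr; congr (_ * _).
  rewrite (_ : z h + be h *: e = x + h *: v + b (x + h *: v) *: e).
    by ring.
  by rewrite /z /x0 /be scalerBl addrAC -(addrA x) [b x *: e + _]addrC subrK addrAC.
rewrite E; apply: cvgD; first exact: H1.
apply: cvgM; first exact: H2.
have be0 : be h @[h --> 0^'] --> (0 : R).
  have : h * (h^-1 * be h) @[h --> 0^'] --> 0 * 'D_v b x.
    by apply: cvgM; [exact: nbhs_dnbhs|exact: H2].
  rewrite mul0r => H3; apply: (cvg_trans _ H3); apply: near_eq_cvg; near=> h.
  rewrite mulVKf//; near: h; exact: nbhs_dnbhs_neq.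
have c0 : c h @[h --> 0^'] --> (0 : R).
  apply/cvgr0Pnorm_lt => eps eps0.
  move/cvgr0Pnorm_lt : be0 => /(_ _ eps0); apply: filterS => h.
  by apply: le_lt_trans; have [] := cP h.
have zc : z h + c h *: e @[h --> 0^'] --> x0.
  rewrite -[X in _ --> X]addr0 -[X in _ --> _ + X](scale0r e).
  apply: cvgD; last exact: cvgZr_tmp.
  rewrite -[X in _ --> X]addr0 -[X in _ --> _ + X](scale0r v).
  apply: cvgD; first exact: cvg_cst.
  by apply: cvgZr_tmp; exact: nbhs_dnbhs.
exact: (cvg_comp _ _ zc (cfe x0)).
Unshelve. all: by end_near. Qed.

End chain_rules.

(** * Smooth functions *)

Section smooth_calculus.
Context {R : realType} {N : nat}.
Local Notation V := 'rV[R]_N.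
Implicit Types (f g : V -> R) (G : set (V -> R)) (x : V) (i : 'I_N).
Local Notation e_ i := (delta_mx ord0 i : V).

Lemma smooth_continuous f : smooth f -> continuous f.
Proof. by move=> /(_ [::])[]. Qed.

Lemma smooth_derivable f : smooth f -> forall i x, derivable f x (e_ i).
Proof. by move=> /(_ [::])[]. Qed.

Lemma smooth_is_derive f : smooth f -> forall i x, is_derive x (e_ i) f (partial i f x).
Proof. by move=> sf i x; apply: derivableP; exact: smooth_derivable. Qed.

Lemma smooth_partial f i : smooth f -> smooth (partial i f).
Proof. by move=> sf l; rewrite -foldr_rcons. Qed.

(** Smoothness by coinduction: a class of continuous functions that is stable
    under partial derivatives consists of smooth functions. *)
Lemma smooth_of_class G : (forall f, G f -> continuous f /\
    forall i, (forall x, derivable f x (e_ i)) /\ G (partial i f)) ->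
  forall f, G f -> smooth f.
Proof.
move=> H f Gf l.
have : G (foldr (@partial R N) f l) by elim: l => //= i l /H[_ /(_ i)[]].
by move=> /H[cf df]; split => // i x; have [] := df i.
Qed.

(** The algebra of functions generated by G. By the sum and product rules it
    is stable under partial derivatives as soon as the derivatives of the
    generators belong to it; this turns the chain rule into a proof of
    smoothness. *)
Inductive alg G : (V -> R) -> Prop :=
| alg_gen f : G f -> alg G f
| alg_cst c : alg G (fun=> c)
| alg_add f g : alg G f -> alg G g -> alg G (fun x => f x + g x)
| alg_mul f g : alg G f -> alg G g -> alg G (fun x => f x * g x).

Lemma smooth_alg G : (forall f, G f -> continuous f /\
    forall i, exists2 f', (forall x, is_derive x (e_ i) f (f' x)) & alg G f') ->
  forall f, alg G f -> smooth f.
Proof.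
move=> H; apply: smooth_of_class => f.
elim => {f} [f|c|f g algf [cf df] algg [cg dg]|f g algf [cf df] algg [cg dg]].
- move=> /H[cf df]; split => // i; have [f' f'E algf'] := df i.
  split=> [x|]; first by have [] := f'E x.
  rewrite (_ : partial i f = f')//; apply/funext => x.
  exact: (@derive_val _ _ _ _ _ _ _ (f'E x)).
- split=> [x|i]; first exact: cst_continuous.
  split=> [x|]; first exact: derivable_cst.
  rewrite (_ : partial i _ = (fun=> 0)); first exact: alg_cst.
  by apply/funext => x; rewrite /partial derive_cst.
- split=> [x|i]; first by apply: continuousD; [exact: cf|exact: cg].
  have [df1 df2] := df i; have [dg1 dg2] := dg i.
  split=> [x|]; first exact: derivableD.
  rewrite (_ : partial i _ = fun x => partial i f x + partial i g x).
    exact: alg_add.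
  by apply/funext => x; rewrite /partial deriveD.
- split=> [x|i]; first by apply: continuousM; [exact: cf|exact: cg].
  have [df1 df2] := df i; have [dg1 dg2] := dg i.
  split=> [x|]; first exact: derivableM.
  rewrite (_ : partial i _ = fun x => f x * partial i g x + g x * partial i f x).
    by apply: alg_add; apply: alg_mul.
  by apply/funext => x; rewrite /partial deriveM.
Qed.

Lemma smooth_closed f : alg (@smooth R N) f -> smooth f.
Proof.
apply: smooth_alg => {}f sf; split; first exact: smooth_continuous.
move=> i; exists (partial i f); first exact: smooth_is_derive.
by apply: alg_gen; exact: smooth_partial.
Qed.

Lemma smooth_cst (c : R) : smooth (fun _ : V => c).
Proof. by apply: smooth_closed; exact: alg_cst. Qed.

Lemma smoothD f g : smooth f -> smooth g -> smooth (fun x => f x + g x).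
Proof. by move=> sf sg; apply: smooth_closed; apply: alg_add; exact: alg_gen. Qed.

Lemma smoothM f g : smooth f -> smooth g -> smooth (fun x => f x * g x).
Proof. by move=> sf sg; apply: smooth_closed; apply: alg_mul; exact: alg_gen. Qed.

Lemma smooth_sum (I : Type) (s : seq I) (P : pred I) (F : I -> V -> R) :
  (forall j, smooth (F j)) -> smooth (fun x => \sum_(j <- s | P j) F j x).
Proof.
move=> sF; elim: s => [|j s IH].
  by under eq_fun do rewrite big_nil; exact: smooth_cst.
under eq_fun do rewrite big_cons.
by case: (P j) => //; exact: smoothD.
Qed.

Lemma partialD f g i x : smooth f -> smooth g ->
  partial i (fun x => f x + g x) x = partial i f x + partial i g x.
Proof. by move=> sf sg; rewrite /partial deriveD//; exact: smooth_derivable. Qed.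

Lemma partialM f g i x : smooth f -> smooth g ->
  partial i (fun x => f x * g x) x = f x * partial i g x + g x * partial i f x.
Proof. by move=> sf sg; rewrite /partial deriveM//; exact: smooth_derivable. Qed.

Lemma is_derive_coord i j x :
  is_derive x (e_ i) (fun y : V => y ord0 j) (i == j)%:R.
Proof.
apply: is_derive_line0.
rewrite (_ : (fun r : R => _) = cst (x ord0 j) + (i == j)%:R *: (id : R -> R)).
  by apply: is_derive_eq; rewrite add0r scaler1.
apply/funext => r; rewrite !fctE !mxE eqxx/= [r * _]mulrC eq_sym.
by [].
Qed.

Lemma smooth_coord i : smooth (fun x : V => x ord0 i).
Proof.
apply: (@smooth_alg [set fun x : V => x ord0 i]); last exact: alg_gen.
move=> _ ->; split; first exact: coord_continuous.
move=> j; exists (fun=> (j == i)%:R); last exact: alg_cst.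
by move=> x; exact: is_derive_coord.
Qed.

(** The outer functions range over a family F that is stable under
    differentiation up to linear combinations, at the values taken by q only:
    so F may consist of powers when q is positive. *)
Lemma smooth_comp (q : V -> R) (F : set (R -> R)) : smooth q ->
  (forall w, F w -> exists w1 w2 c1 c2, [/\ F w1, F w2 &
     forall x, is_derive (q x) 1 w (c1 * w1 (q x) + c2 * w2 (q x))]) ->
  forall w, F w -> smooth (fun x => w (q x)).
Proof.
move=> sq HF w Fw.
pose G : set (V -> R) :=
  [set f | smooth f \/ exists2 w, F w & f = fun x => w (q x)].
apply: (@smooth_alg G); last by apply: alg_gen; right; exists w.
move=> f [sf|[{Fw}w Fw ->]].
  split; first exact: smooth_continuous.
  move=> i; exists (partial i f); first exact: smooth_is_derive.
  by apply: alg_gen; left; exact: smooth_partial.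
have [w1 [w2 [c1 [c2 [F1 F2 dw]]]]] := HF _ Fw.
split=> [x|i].
  apply: (@continuous_comp _ _ _ q w); first exact: smooth_continuous.
  by apply/differentiable_continuous/derivable1_diffP; case: (dw x).
exists (fun x => (c1 * w1 (q x) + c2 * w2 (q x)) * partial i q x).
  by move=> x; apply: (is_derive_comp1 (smooth_is_derive sq i x) (dw x)).
have algq : alg G (partial i q).
  by apply: alg_gen; left; exact: smooth_partial.
have algw v : F v -> alg G (fun x => v (q x)).
  by move=> Fv; apply: alg_gen; right; exists v.
exact: (alg_mul (alg_add (alg_mul (alg_cst G c1) (algw _ F1))
                         (alg_mul (alg_cst G c2) (algw _ F2))) algq).
Qed.

Lemma continuous_shear (b : V -> R) i : continuous b ->
  continuous (fun x : V => x + b x *: e_ i).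
Proof.
move=> cb x.
have H : {for x, continuous (fun x => b x *: e_ i)}.
  by apply: continuousZr_tmp; exact: cb.
have Hid : {for x, continuous (fun x : V => x)} by exact: cvg_id.
have := continuousD Hid H.
exact.
Qed.

Lemma is_derive_shear_coord u (b : V -> R) (a i : 'I_N) x : smooth u -> smooth b ->
  is_derive x (e_ i) (fun y => u (y + b y *: e_ a))
    (partial i u (x + b x *: e_ a) +
     partial i b x * partial a u (x + b x *: e_ a)).
Proof.
move=> su sb; apply: is_derive_shear.
- exact: smooth_derivable.
- exact: (smooth_continuous (smooth_partial a su)).
- exact: smooth_derivable.
- exact: smooth_derivable.
Qed.

Lemma smooth_shear u (b : V -> R) (a : 'I_N) : smooth u -> smooth b ->
  smooth (fun x => u (x + b x *: e_ a)).
Proof.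
move=> su sb.
pose G : set (V -> R) := [set f | smooth f \/
  exists2 u, smooth u & f = fun x => u (x + b x *: e_ a)].
apply: (@smooth_alg G); last by apply: alg_gen; right; exists u.
move=> f [sf|[{su}u su ->]].
  split; first exact: smooth_continuous.
  move=> i; exists (partial i f); first exact: smooth_is_derive.
  by apply: alg_gen; left; exact: smooth_partial.
split=> [x|i].
  apply: (@continuous_comp _ _ _ (fun x => x + b x *: e_ a) u).
    by apply: continuous_shear; exact: smooth_continuous.
  exact: smooth_continuous.
exists (fun x => partial i u (x + b x *: e_ a) +
                 partial i b x * partial a u (x + b x *: e_ a)).
  by move=> x; exact: is_derive_shear_coord.
apply: (alg_add (f := fun x => partial i u (x + b x *: e_ a))).
  by apply: alg_gen; right; exists (partial i u) => //; exact: smooth_partial.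
apply: (alg_mul (f := partial i b)).
  by apply: alg_gen; left; exact: smooth_partial.
by apply: alg_gen; right; exists (partial a u) => //; exact: smooth_partial.
Qed.

Lemma smooth_powR (q : V -> R) (a : R) : smooth q -> (forall x, 0 < q x) ->
  smooth (fun x => q x `^ a).
Proof.
move=> sq q0.
pose F : set (R -> R) := range (fun b => (fun y : R => y `^ b)).
apply: (@smooth_comp q F sq _ (fun y => y `^ a)); last by exists a.
move=> _ [b _ <-]; exists (fun y => y `^ (b - 1)), (fun y => y `^ (b - 1)), b, 0.
split; [by exists (b - 1)|by exists (b - 1)|move=> x].
by rewrite mul0r addr0; exact: is_derive1_powR.
Qed.

End smooth_calculus.

(** * A smooth transition function *)

Section flat_functions.
Context {R : realType}.
Implicit Types (k : nat) (x y : R).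

(** The functions exp(-1/x) / x^k, extended by 0 to x <= 0. This family is
    stable under differentiation up to linear combinations, and it is flat at
    0. *)
Definition flat k x : R :=
  if 0 < x then x^-1 ^+ k * expR (- x^-1) else 0.

Lemma flat_ge0 k x : 0 <= flat k x.
Proof.
rewrite /flat; case: ifPn => // x0.
by rewrite mulr_ge0 ?expR_ge0// exprn_ge0// invr_ge0 ltW.
Qed.

Lemma flat_gt0 k x : 0 < x -> 0 < flat k x.
Proof. by move=> x0; rewrite /flat x0 mulr_gt0 ?expR_gt0// exprn_gt0// invr_gt0. Qed.

Lemma flat_le0 k x : x <= 0 -> flat k x = 0.
Proof. by move=> x0; rewrite /flat ltNge x0. Qed.

(** The exponential dominates all powers; a quadratic bound is what gives the
    derivative 0 at the origin. *)
Lemma flat_le_sqr k x : flat k x <= k.+2`!%:R * x ^+ 2.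
Proof.
rewrite /flat; case: ifPn => x0; last by rewrite mulr_ge0 ?sqr_ge0.
have y0 : 0 < x^-1 by rewrite invr_gt0.
rewrite expRN ler_pdivrMr ?expR_gt0//.
have := expR_ge1Dxn k.+1 (ltW y0) => H.
have {}H : x^-1 ^+ k.+2 / k.+2`!%:R <= expR x^-1.
  by apply: le_trans H; rewrite lerDr.
rewrite ler_pdivrMr ?ltr0n ?fact_gt0// in H.
have -> : x^-1 ^+ k = x ^+ 2 * x^-1 ^+ k.+2.
  by rewrite -[k.+2]addn2 exprD mulrCA -exprMn mulfV ?gt_eqF// expr1n mulr1.
rewrite [leRHS]mulrAC [leRHS]mulrC ler_pM2l ?exprn_gt0//.
by rewrite mulrC.
Qed.

Lemma is_derive_flat k x :
  is_derive x 1 (flat k) (- k%:R * flat k.+1 x + 1 * flat k.+2 x).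
Proof.
have [x0|x0|->] := ltgtP x 0.
- rewrite !flat_le0 ?(ltW x0)// !mulr0 addr0.
  apply: (@near_eq_is_derive _ _ _ (cst 0)).
  by near=> y; rewrite flat_le0// ltW//; near: y; exact: lt_nbhsl.
- rewrite /flat x0 mul1r.
  apply: (@near_eq_is_derive _ _ _ ((GRing.inv : R -> R) ^+ k *
     (expR \o (- (GRing.inv : R -> R)))) (flat k)).
    near=> y; rewrite /flat !fctE (_ : 0 < y); last by near: y; exact: lt_nbhsr.
    by [].
  have dinv : is_derive x 1 (GRing.inv : R -> R) (- x ^- 2 *: 1).
    by apply: (@is_deriveV _ id) => //; rewrite gt_eqF.
  have dexp : is_derive x 1 (expR \o (- (GRing.inv : R -> R)))
      (expR (- x^-1) * (- (- x ^- 2 *: 1))).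
    by apply: is_derive1_comp.
  have := is_deriveM (is_deriveX k dinv) dexp.
  set D := (X in is_derive _ _ _ X); set D' := (X in _ -> is_derive _ _ _ X).
  suff -> : D = D' by [].
  rewrite /D /D' !fctE -!exprVn.
  case: k @D @D' => [|k] D D'.
    by rewrite /GRing.scale/= !expr0 mul0r oppr0 !mul0r; ring.
  by rewrite /GRing.scale/= !exprS; ring.
rewrite !flat_le0// !mulr0 addr0; apply: is_derive_cvg.
rewrite /= flat_le0//; apply/cvgr0Pnorm_le => e e0.
near=> h.
have h0 : h != 0 by near: h; exact: nbhs_dnbhs_neq.
rewrite subr0 add0r (_ : h *: 1 = h :> R) ?[_ *: _]mulr1// normrM normfV.
rewrite (ger0_norm (flat_ge0 _ _)) mulrC ler_pdivrMr ?normr_gt0//.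
apply: (le_trans (flat_le_sqr _ _)).
rewrite -real_normK ?num_real// expr2 mulrA ler_wpM2r//.
rewrite -ler_pdivlMl ?ltr0n ?fact_gt0// mulrC.
near: h; apply: (@dnbhs0_le _ R).
by rewrite divr_gt0// ltr0n fact_gt0.
Unshelve. all: by end_near. Qed.

Lemma smooth_flat N (q : 'rV[R]_N -> R) k : smooth q -> smooth (fun z => flat k (q z)).
Proof.
move=> sq; apply: (@smooth_comp _ _ q (range flat) sq _ (flat k)); last by exists k.
move=> _ [j _ <-]; exists (flat j.+1), (flat j.+2), (- j%:R), 1.
by split; [exists j.+1|exists j.+2|move=> x; exact: is_derive_flat].
Qed.

(** A smooth transition from 0 on ]-oo, 1] to 1 on [4, +oo[. The ratio 4
    between the two ends matters: the functions y |-> step (4^m y), for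
    varying m, have derivatives with disjoint supports. *)
Definition step y : R := flat 0 (y - 1) * (flat 0 (y - 1) + flat 0 (4 - y)) `^ (-1).

Let den_gt0 y : 0 < flat 0 (y - 1) + flat 0 (4 - y).
Proof.
have [y2|y2] := ltP y 2.
  by apply: ltr_wpDl; [exact: flat_ge0|apply: flat_gt0; lra].
by apply: ltr_pwDl; [apply: flat_gt0; lra|exact: flat_ge0].
Qed.

Lemma stepE y : step y = flat 0 (y - 1) / (flat 0 (y - 1) + flat 0 (4 - y)).
Proof. by rewrite /step powR_inv1// ltW. Qed.

Lemma step_ge0 y : 0 <= step y.
Proof. by rewrite mulr_ge0 ?flat_ge0 ?powR_ge0. Qed.

Lemma step_le1 y : step y <= 1.
Proof. by rewrite stepE ler_pdivrMr// mul1r lerDl flat_ge0. Qed.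

Lemma step_le y : y <= 1 -> step y = 0.
Proof. by move=> y1; rewrite /step flat_le0 ?mul0r// subr_le0. Qed.

Lemma step_ge y : 4 <= y -> step y = 1.
Proof.
move=> y4; rewrite stepE [flat 0 (4 - y)]flat_le0 ?subr_le0// addr0 divff//.
by rewrite gt_eqF//; apply: flat_gt0; lra.
Qed.

Lemma smooth_step N (q : 'rV[R]_N -> R) : smooth q -> smooth (fun z => step (q z)).
Proof.
move=> sq.
have s1 : smooth (fun z => flat 0 (q z - 1)).
  exact: (smooth_flat 0 (smoothD sq (smooth_cst (-1)))).
have s2 : smooth (fun z => flat 0 (4 - q z)).
  apply: smooth_flat; under eq_fun do rewrite -mulN1r.
  exact: (smoothD (smooth_cst 4) (smoothM (smooth_cst (-1)) sq)).
exact: (smoothM s1 (smooth_powR (-1) (smoothD s1 s2) (fun z => den_gt0 (q z)))).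
Qed.

(** The derivative is bounded because it is continuous and vanishes outside
    [1, 4]. *)
Lemma step_derive : exists2 g' : R -> R,
  (forall y, is_derive y 1 step (g' y) /\ (y <= 1 \/ 4 <= y -> g' y = 0)) &
  exists2 M, 0 <= M & forall y, `|g' y| <= M.
Proof.
(* smoothness is available for functions on R^n, hence the detour by R^1 *)
pose f := fun x : 'rV[R]_1 => step (x ord0 ord0).
have sf : smooth f by apply: smooth_step; exact: smooth_coord.
pose g' y := partial ord0 f (\row_(j < 1) y).
have dg y : is_derive y 1 step (g' y).
  have := smooth_is_derive sf ord0 (\row_(j < 1) y) => /cvg_is_derive H.
  apply: is_derive_cvg; apply: cvg_trans H; apply: near_eq_cvg.
  by apply: nearW => h; rewrite /f !mxE eqxx.
have cg : continuous g'.
  have cy : continuous (fun y : R => \row_(j < 1) y : 'rV[R]_1).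
    move=> y; apply/cvgrPdist_le => e e0; near=> z.
    apply: norm_le_coord; first exact: ltW.
    by move=> i; rewrite !mxE; near: z; apply: cvgr_dist_le => //; exact: cvg_id.
  move=> y; apply: (@continuous_comp _ _ _ _ (partial ord0 f)); first exact: cy.
  exact: (smooth_continuous (smooth_partial ord0 sf)).
have g0 y : y <= 1 \/ 4 <= y -> g' y = 0.
  have gl z : z < 1 -> g' z = 0.
    move=> z1; have <- : 'D_1 (cst 0 : R -> R) z = 0 by rewrite derive_cst.
    rewrite -(@derive_val _ _ _ _ _ _ _ (dg z)); apply: near_eq_derive.
    by near=> w; rewrite step_le//; apply: ltW; near: w; exact: lt_nbhsl.
  have gr z : 4 < z -> g' z = 0.
    move=> z1; have <- : 'D_1 (cst 1 : R -> R) z = 0 by rewrite derive_cst.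
    rewrite -(@derive_val _ _ _ _ _ _ _ (dg z)); apply: near_eq_derive.
    by near=> w; rewrite step_ge//; apply: ltW; near: w; exact: lt_nbhsr.
  have cl : closed (g' @^-1` [set 0]).
    by apply: closed_comp; [move=> z _; exact: cg|exact: closed_eq].
  case; rewrite le_eqVlt => /predU1P[|]; [|exact: gl| |exact: gr].
  - move=> ->; apply: cl => B [e /= e0 eB].
    exists (1 - e / 2); split; first by apply: gl; rewrite gtrBl divr_gt0.
    apply: eB; rewrite /ball_/= opprB addrC subrK gtr0_norm ?divr_gt0//.
    by rewrite gtr_pMr// invf_lt1// ltr1n.
  - move=> <-; apply: cl => B [e /= e0 eB].
    exists (4 + e / 2); split; first by apply: gr; rewrite ltrDl divr_gt0.
    apply: eB; rewrite /ball_/= opprD addrA subrr sub0r normrN gtr0_norm ?divr_gt0//.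
    by rewrite gtr_pMr// invf_lt1// ltr1n.
exists g' => [y|]; first by split => //; exact: g0.
have cn : {within `[1, 4], continuous (fun y => `|g' y|)}.
  apply: continuous_subspaceT => y.
  by apply: (@continuous_comp _ _ _ g' Num.norm); [exact: cg|exact: norm_continuous].
have le14 : (1 : R) <= 4 by rewrite ler1n.
have [c _ cM] := EVT_max le14 cn.
exists `|g' c|; first exact: normr_ge0.
move=> y; have [y1|y1] := leP y 1.
  by rewrite g0 ?normr0//; left.
have [y4|y4] := leP 4 y; first by rewrite g0 ?normr0//; right.
by apply: cM; rewrite in_itv/= !ltW.
Unshelve. all: by end_near. Qed.

End flat_functions.

(** * One-dimensional inequalities *)

Section power_of_absolute_value.
Context {R : realType}.
Implicit Types (y a g : R).

Lemma cvg_normr_powR a : 0 < a -> `|y| `^ a @[y --> (0 : R)] --> (0 : R).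
Proof.
move=> a0; apply/cvgr0Pnorm_le => e e0; near=> y.
rewrite ger0_norm ?powR_ge0//.
have -> : e = (e `^ a^-1) `^ a by rewrite -powRrM mulVf ?gt_eqF// powRr1// ltW.
apply: ge0_ler_powR; rewrite ?nnegrE ?powR_ge0// ?ltW//.
near: y; apply: (@nbhs0_lt _ R); exact: powR_gt0.
Unshelve. all: by end_near. Qed.

Definition dpowabs g y : R := g * `|y| `^ (g - 1) * Num.sg y.

Lemma normr_dpowabs g y : 1 < g -> `|dpowabs g y| = g * `|y| `^ (g - 1).
Proof.
move=> g1; rewrite /dpowabs !normrM normr_sg (ger0_norm (powR_ge0 _ _)).
rewrite ger0_norm; last by lra.
have [->|y0] := eqVneq y 0; last by rewrite mulr1.
by rewrite normr0 powR0 ?mulr0// subr_eq0 gt_eqF.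
Qed.

Lemma is_derive_powabs g y : 1 < g ->
  is_derive y 1 (fun y => `|y| `^ g) (dpowabs g y).
Proof.
move=> g1; rewrite /dpowabs; have [y0|y0|->] := ltgtP y 0.
- rewrite ltr0_norm// ltr0_sg// mulrN1.
  apply: (@near_eq_is_derive _ _ _ ((fun x => x `^ g) \o (- id))).
    near=> z; rewrite /= !fctE ltr0_norm//; near: z; exact: lt_nbhsl.
  rewrite -mulrN1; apply: is_derive1_comp.
  by apply: is_derive1_powR; rewrite oppr_gt0.
- rewrite gtr0_norm// gtr0_sg// mulr1.
  apply: (@near_eq_is_derive _ _ _ (fun x => x `^ g)).
    near=> z; rewrite gtr0_norm//; near: z; exact: lt_nbhsr.
  exact: is_derive1_powR.
rewrite sgr0 mulr0; apply: is_derive_cvg; apply/norm_cvg0P.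
have g10 : 0 < g - 1 by rewrite subr_gt0.
have H : `|h| `^ (g - 1) @[h --> (0 : R)^'] --> (0 : R).
  by apply: (cvg_trans _ (cvg_normr_powR g10)); apply: cvg_app; exact: nbhs_dnbhs.
apply: (cvg_trans _ H); apply: near_eq_cvg; near=> h.
have h0 : h != 0 by near: h; exact: nbhs_dnbhs_neq.
rewrite normr0 powR0 ?gt_eqF ?(lt_trans _ g1)// subr0 add0r.
rewrite (_ : h *: 1 = h :> R) ?[_ *: _]mulr1// normrM normfV (ger0_norm (powR_ge0 _ _)).
rewrite powRB; last by rewrite normr_eq0 h0 implybT.
by rewrite powRr1// mulrC.
Unshelve. all: by end_near. Qed.

Lemma continuous_powR_pos a y : 0 < y -> {for y, continuous (fun x : R => x `^ a)}.
Proof.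
by move=> y0; apply/differentiable_continuous/derivable1_diffP;
  case: (is_derive1_powR a y0).
Qed.

Lemma continuous_normr_powR a : 0 < a -> continuous (fun y => `|y| `^ a).
Proof.
move=> a0 y; have [->|y0] := eqVneq y 0.
  have := cvg_normr_powR a0.
  by rewrite /continuous_at normr0 powR0// gt_eqF.
have H1 : {for y, continuous (fun x : R => `|x|)} by exact: norm_continuous.
have H2 : {for `|y|, continuous (fun x : R => x `^ a)}.
  by apply: continuous_powR_pos; rewrite normr_gt0.
exact: (continuous_comp H1 H2).
Qed.

Lemma continuous_dpowabs g : 1 < g -> continuous (dpowabs g).
Proof.
move=> g1 y; have g10 : 0 < g - 1 by rewrite subr_gt0.
have cM (c : R) : {for y, continuous (fun x => g * `|x| `^ (g - 1) * c)}.
  apply: (@continuousM _ _ (fun x => g * `|x| `^ (g - 1)) (cst c)); last exact: cst_continuous.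
  apply: (@continuousM _ _ (cst g) (fun x => `|x| `^ (g - 1))); first exact: cst_continuous.
  exact: continuous_normr_powR.
have [y0|y0|y0] := ltgtP y 0.
- have := cM (-1); rewrite /continuous_at => H.
  rewrite {2}/dpowabs ltr0_sg//; apply: (cvg_trans _ H); apply: near_eq_cvg; near=> z.
  by rewrite /dpowabs ltr0_sg//; near: z; exact: lt_nbhsl.
- have := cM 1; rewrite /continuous_at => H.
  rewrite {2}/dpowabs gtr0_sg//; apply: (cvg_trans _ H); apply: near_eq_cvg; near=> z.
  by rewrite /dpowabs gtr0_sg//; near: z; exact: lt_nbhsr.
rewrite /continuous_at y0 {2}/dpowabs sgr0 mulr0; apply/norm_cvg0P.
have H : g * `|x| `^ (g - 1) * 1 @[x --> (0 : R)] --> (0 : R).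
  have E : g * `|0 : R| `^ (g - 1) * 1 = 0.
    by rewrite normr0 powR0 ?gt_eqF// mulr0 mul0r.
  rewrite -[X in _ --> X]E.
  by move: (cM 1); rewrite y0; exact.
apply: (cvg_trans _ H); apply: near_eq_cvg; near=> z.
by rewrite normr_dpowabs// mulr1.
Unshelve. all: by end_near. Qed.

End power_of_absolute_value.

Section one_dimensional.
Context {R : realType}.
Local Notation leb1 := (@lebesgue_measure R).

Lemma le_integral_derivative (F f : R -> R) (r x : R) :
  (forall t : R, is_derive t 1 F (f t)) -> continuous f ->
  (forall t, t <= - r -> F t = 0) ->
  (`|F x|%:E <= \int[leb1]_t `|f t|%:E)%E.
Proof.
move=> dF cf F0.
have cF : continuous F.
  by move=> t; apply/differentiable_continuous/derivable1_diffP; case: (dF t).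
pose a := Num.min (- r) (x - 1).
have ax : a < x by rewrite /a gt_min; apply/orP; right; rewrite ltrBlDr ltrDl.
have Fa : F a = 0 by apply: F0; rewrite ge_min lexx.
have dab : derivable_oo_LRcontinuous F a x.
  split; first by move=> t _; case: (dF t).
  - by apply: cvg_at_right_filter; exact: cF.
  - by apply: cvg_at_left_filter; exact: cF.
have F'f : {in `]a, x[, derive1 F =1 f}.
  by move=> t _; rewrite derive1E; exact: (@derive_val _ _ _ _ _ _ _ (dF t)).
have := continuous_FTC2 ax (continuous_subspaceT cf) dab F'f.
rewrite Fa sube0 => E.
have mf : measurable_fun setT (fun t => (f t)%:E).
  by apply/measurable_EFinP; exact: continuous_measurable_fun.
rewrite -[X in (X <= _)%E]/(`|(F x)%:E|)%E -E.
apply: (le_trans (le_abse_integral _ _ _)) => //.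
  exact: measurable_funS mf.
apply: ge0_subset_integral => //.
exact: measurableT_comp.
Qed.

(** Hardy's inequality on a line, from the derivative of t w(t)^2, whose
    integral is 0: the integral of w^2 is that of - 2 t w w', and - 2 t w w'
    <= w^2 / 2 + 2 (t w')^2. *)
Lemma hardy1 (w w' : R -> R) (r : R) :
  (forall t : R, is_derive t 1 w (w' t)) -> continuous w' ->
  (forall t, r <= `|t| -> w t = 0) ->
  (\int[leb1]_t (w t ^+ 2)%:E <= 4%:E * \int[leb1]_t (t ^+ 2 * w' t ^+ 2)%:E)%E.
Proof.
move=> dw cw' w0.
have cw : continuous w.
  by move=> t; apply/differentiable_continuous/derivable1_diffP; case: (dw t).
pose b := `|r| + 1.
have b0 : 0 < b by rewrite ltr_wpDl.
have wb t : b <= `|t| -> w t = 0.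
  by move=> bt; apply: w0; rewrite (le_trans (ler_norm r))// (le_trans _ bt)// lerDl.
have c2 (u v : R -> R) : continuous u -> continuous v -> continuous (fun t => u t * v t).
  by move=> cu cv t; apply: continuousM; [exact: cu|exact: cv].
have ci : continuous (fun t : R => t) by move=> t; exact: cvg_id.
pose F t := t * (w t * w t).
pose f t := w t * w t + t * (w t * w' t + w t * w' t).
have dF (t : R) : is_derive t 1 F (f t).
  have H := is_deriveM (is_derive_id t 1) (is_deriveM (dw t) (dw t)).
  have E : f t = t *: (w t *: w' t + w t *: w' t) + (w * w) t *: 1.
    by rewrite /f [LHS]addrC; congr (_ + _); rewrite [RHS]mulr1.
  by rewrite E; exact: H.
have cD (u v : R -> R) : continuous u -> continuous v -> continuous (fun t => u t + v t).
  by move=> cu cv t; apply: continuousD; [exact: cu|exact: cv].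
have cf : continuous f.
  exact: (cD _ _ (c2 _ _ cw cw) (c2 _ _ ci (cD _ _ (c2 _ _ cw cw') (c2 _ _ cw cw')))).
have cF : continuous F.
  by move=> t; apply/differentiable_continuous/derivable1_diffP; case: (dF t).
have Nbb : - b < b by rewrite gtrN.
have dab : derivable_oo_LRcontinuous F (- b) b.
  split; first by move=> t _; case: (dF t).
  - by apply: cvg_at_right_filter; exact: cF.
  - by apply: cvg_at_left_filter; exact: cF.
have F'f : {in `]- b, b[, derive1 F =1 f}.
  by move=> t _; rewrite derive1E; exact: (@derive_val _ _ _ _ _ _ _ (dF t)).
have := continuous_FTC2 Nbb (continuous_subspaceT cf) dab F'f.
have Fb : F b = 0 by rewrite /F wb ?ger0_norm ?(ltW b0)// !mulr0.
have FNb : F (- b) = 0 by rewrite /F wb ?normrN ?ger0_norm ?(ltW b0)// !mulr0.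
rewrite Fb FNb sube0 => E.
pose D := `[- b, b]%classic : set R.
have mD : measurable (D : set (measurableTypeR R)) by exact: measurable_itv.
pose P t := 2^-1 * w t ^+ 2; pose Q t := 2 * (t ^+ 2 * w' t ^+ 2).
have cP : continuous P.
  by apply: (c2 (cst _)); [exact: cst_continuous|exact: c2].
have cQ : continuous Q.
  apply: (c2 (cst _)); first exact: cst_continuous.
  by apply: (c2 (fun t => t ^+ 2)); exact: c2.
have itg (u : R -> R) : continuous u -> leb1.-integrable D (EFin \o u).
  move=> cu; apply: continuous_compact_integrable; first exact: segment_compact.
  exact: continuous_subspaceT.
have H : (\int[leb1]_(t in D) (P t)%:E <= \int[leb1]_(t in D) (Q t)%:E)%E.
  rewrite -sube_le0.
  rewrite -integralB//; last 2 first.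
  - exact: itg.
  - exact: itg.
  have E0 : (\int[leb1]_(t in D) (f t)%:E <= 0)%E by rewrite E.
  apply: (le_trans _ E0); apply: le_integral => //.
  - by apply: integrableB => //; exact: itg.
  - exact: itg.
  move=> t _; rewrite -EFinB lee_fin /P /Q /f.
  have := sqr_ge0 (w t + 2 * (t * w' t)); nra.
have supp (u : R -> R) : (forall t, b <= `|t| -> u t = 0) ->
    (\int[leb1]_(t in D) (u t)%:E = \int[leb1]_t (u t)%:E)%E.
  move=> u0; rewrite integral_mkcond; apply: eq_integral => t _.
  rewrite patchE; case: ifPn => // /negP tD; rewrite u0//.
  rewrite leNgt; apply/negP => tb; apply: tD; rewrite inE /D/= in_itv/=.
  by rewrite -ler_norml ltW.
have P0 : (\int[leb1]_(t in D) (P t)%:E = (2^-1)%R%:E * \int[leb1]_t (w t ^+ 2)%:E)%E.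
  rewrite supp; last by move=> t bt; rewrite /P wb// expr0n mulr0.
  under eq_integral do rewrite EFinM.
  rewrite ge0_integralZl//.
  - apply/measurable_EFinP; apply: continuous_measurable_fun; exact: c2.
  - by move=> t _; rewrite lee_fin sqr_ge0.
have mQ : measurable_fun setT (fun t : measurableTypeR R => (t ^+ 2 * w' t ^+ 2)%:E).
  apply/measurable_EFinP; apply: continuous_measurable_fun.
  by apply: (c2 (fun t => t ^+ 2)); exact: c2.
have Q0 : (\int[leb1]_(t in D) (Q t)%:E <= 2%:E * \int[leb1]_t (t ^+ 2 * w' t ^+ 2)%:E)%E.
  under eq_integral do rewrite EFinM.
  rewrite ge0_integralZl//.
  - apply: lee_wpmul2l; first by rewrite lee_fin.
    by apply: ge0_subset_integral => // t _; rewrite lee_fin mulr_ge0 ?sqr_ge0.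
  - exact: measurable_funS mQ.
  - by move=> t _; rewrite lee_fin mulr_ge0 ?sqr_ge0.
have := le_trans H Q0; rewrite P0 => {}H.
have : (2%:E * ((2^-1)%R%:E * \int[leb1]_t (w t ^+ 2)%:E) <=
   2%:E * (2%:E * \int[leb1]_t (t ^+ 2 * w' t ^+ 2)%:E))%E.
  by apply: lee_wpmul2l => //; rewrite lee_fin.
by rewrite !muleA -!EFinM mulfV// mul1e -natrM.
Qed.

End one_dimensional.

(** * Test functions *)

Section test_functions.
Context {R : realType} {N : nat}.
Local Notation V := 'rV[R]_N.
Implicit Types (Omega : set V) (phi : V -> R) (i : 'I_N).
Local Notation leb := (@lebesgue_rV R N).

Lemma test_smooth Omega phi : test_function Omega phi -> smooth phi.
Proof. by case. Qed.

Lemma test_supp Omega phi x : test_function Omega phi -> phi x != 0 -> Omega x.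
Proof. by move=> [_ _ sO] nz; apply: sO; exact: subset_closure. Qed.

Lemma test_zero Omega phi x : test_function Omega phi -> ~ Omega x -> phi x = 0.
Proof.
by move=> tp; apply: contra_notP => /eqP nz; exact: test_supp tp nz.
Qed.

Lemma test_mono Omega Omega' phi : Omega `<=` Omega' ->
  test_function Omega phi -> test_function Omega' phi.
Proof. by move=> OO [sp cp sO]; split => //; exact: subset_trans OO. Qed.

Lemma test_sub Omega phi psi : test_function Omega phi -> smooth psi ->
  (forall x, ~ closure [set x | phi x != 0] x -> psi x = 0) ->
  test_function Omega psi.
Proof.
move=> [sp cp sO] ss H.
have sub : closure [set x | psi x != 0] `<=` closure [set x | phi x != 0].
  rewrite closureE; apply: smallest_sub; first exact: closed_closure.
  by move=> x /= /eqP; apply: contra_notP => /H.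
split => //; last exact: subset_trans sO.
exact: (subclosed_compact (@closed_closure _ _) cp sub).
Qed.

Lemma test_partial Omega phi i : test_function Omega phi ->
  test_function Omega (partial i phi).
Proof.
move=> tp; apply: (test_sub tp); first exact: (smooth_partial i (test_smooth tp)).
move=> x nx; rewrite /partial.
have <- : 'D_(delta_mx ord0 i) (cst (0 : R) : V -> R) x = 0 by rewrite derive_cst.
apply: near_eq_derive.
have : nbhs x (~` closure [set x | phi x != 0]).
  by apply: open_nbhs_nbhs; split => //; exact/closed_openC/closed_closure.
apply: filterS => y /= ny; apply/eqP; apply: contra_notT ny => nz.
by apply: subset_closure; exact: nz.
Qed.

Lemma testM_r Omega phi f : test_function Omega phi -> smooth f ->
  test_function Omega (fun x => phi x * f x).
Proof.
move=> tp sf; apply: (test_sub tp); first exact: smoothM (test_smooth tp) sf.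
move=> x nx; rewrite (_ : phi x = 0) ?mul0r//; apply/eqP.
by apply: contra_notT nx => nz; exact: subset_closure.
Qed.

Lemma test_support_bounded Omega phi : test_function Omega phi ->
  exists2 r, 0 < r & forall x, phi x != 0 -> `|x| <= r.
Proof.
move=> [_ /compact_bounded[M [_ HM]] _].
exists (`|M| + 1); first by rewrite ltr_wpDl.
move=> x nz; apply: (HM (`|M| + 1)); last exact: subset_closure.
by rewrite (le_lt_trans (ler_norm M))// ltrDl.
Qed.

Lemma test_bounded Omega phi : test_function Omega phi ->
  exists2 M, 0 <= M & forall x, `|phi x| <= M.
Proof.
move=> tp; have [sp cp _] := tp.
have := compact_bounded (continuous_compact
  (continuous_subspaceT (smooth_continuous sp)) cp).
move=> [M [_ HM]]; exists (`|M| + 1); first by rewrite addr_ge0.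
move=> x; have [->|nz] := eqVneq (phi x) 0; first by rewrite normr0 addr_ge0.
apply: (HM (`|M| + 1)); last by exists x => //; exact: subset_closure.
by rewrite (le_lt_trans (ler_norm M))// ltrDl.
Qed.

Lemma test_measurable Omega phi : test_function Omega phi ->
  measurable_fun [set: V] phi.
Proof. by case=> sp _ _; apply: continuous_measurable_rV; exact: smooth_continuous. Qed.

Lemma lebesgue_cube (r : R) : (leb [set x | (`|x| <= r)%R] < +oo)%E.
Proof.
have [r0|r0] := ltP r 0.
  rewrite (_ : mkset _ = set0) ?measure0 ?ltry//.
  by apply/seteqP; split => // x /= xr; move: (normr_ge0 x); rewrite leNgt (le_lt_trans xr).
rewrite (_ : mkset _ = [set x : V | forall i, `[- r, r]%classic (x ord0 i)]); last first.
  apply/seteqP; split => [x /= xr i|x /= xr].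
    by rewrite in_itv/= -ler_norml (le_trans (coord_norm_le x i)).
  by apply: norm_le_coord => // i; have := xr i; rewrite in_itv/= -ler_norml.
rewrite (lebesgue_rV_box (fun=> measurable_itv _)).
rewrite ltey_eq; apply/orP; left.
apply: (big_ind (fun x : \bar R => x \is a fin_num)) => //.
  by move=> x y; exact: fin_numM.
by move=> i _; rewrite lebesgue_measure_itv/=; case: ifP.
Qed.

Lemma measurable_cube (r : R) : measurable [set x : V | `|x| <= r].
Proof.
apply: closed_measurable_rV.
apply: (@closed_comp _ _ (fun x : V => `|x|) [set t | t <= r]).
  by move=> x _; exact: norm_continuous.
exact: closed_le.
Qed.

Lemma integral_cube_bound (f : V -> R) (r M : R) :
  measurable_fun [set: V] f -> (forall x, 0 <= f x <= M) ->
  (forall x, f x != 0 -> `|x| <= r) ->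
  (\int[leb]_x (f x)%:E <= M%:E * leb [set x | (`|x| <= r)%R])%E.
Proof.
move=> mf fM fr.
have f0 x : 0 <= f x by case/andP: (fM x).
have M0 : 0 <= M by case/andP: (fM 0) => a b; exact: le_trans a b.
rewrite -(setIT [set x | (`|x| <= r)%R]) -integral_indic//; last exact: measurable_cube.
have mI : measurable_fun setT
    (fun x => (\1_[set x : V | `|x| <= r] x)%:E : \bar R).
  apply/measurable_EFinP; apply: measurable_indic; exact: measurable_cube.
rewrite -(@ge0_integralZl_EFin _ _ _ leb _ measurableT)//.
apply: ge0_le_integral => //.
- by move=> x _; rewrite lee_fin.
- exact/measurable_EFinP.
- by apply: measurable_funeM.
move=> x _; rewrite -EFinM lee_fin.
have [->|nz] := eqVneq (f x) 0; first by rewrite mulr_ge0.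
by rewrite indicE mem_set ?mulr1; [case/andP: (fM x)|exact: fr].
Qed.

Lemma test_powR_integral_fin Omega phi (g : R) : 0 < g -> test_function Omega phi ->
  (\int[leb]_x (`|phi x| `^ g)%:E < +oo)%E.
Proof.
move=> g0 tp; have [r r0 hr] := test_support_bounded tp.
have [M M0 HM] := test_bounded tp.
apply: le_lt_trans (@integral_cube_bound _ r (M `^ g) _ _ _) _.
- apply: (measurableT_comp (measurable_powR _)).
  by apply: measurableT_comp => //; exact: test_measurable tp.
- by move=> x; rewrite powR_ge0 ge0_ler_powR ?nnegrE// ltW.
- move=> x; rewrite powR_eq0 negb_and normr_eq0 => /orP[/hr//|].
  by rewrite negbK gt_eqF.
by rewrite lte_mul_pinfty ?lee_fin ?powR_ge0//; exact: lebesgue_cube.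
Qed.

Lemma upd_line i (x : V) t : upd i t x = upd i 0 x + t *: delta_mx ord0 i.
Proof. by rewrite updD add0r. Qed.

Lemma is_derive_upd phi i (x : V) (t : R) : smooth phi ->
  is_derive t 1 (fun r : R => phi (upd i r x)) (partial i phi (upd i t x)).
Proof.
move=> sp; have := smooth_is_derive sp i (upd i t x).
by rewrite upd_line => /is_derive_line; under eq_fun do rewrite -upd_line.
Qed.

Lemma continuous_upd i (x : V) : continuous (fun t : R => upd i t x).
Proof.
move=> t; apply/cvgrPdist_le => e e0; near=> z.
apply: norm_le_coord; first exact: ltW.
move=> j; rewrite !mxE; case: eqP => _; last by rewrite subrr normr0 ltW.
near: z; apply: cvgr_dist_le => //; exact: cvg_id.
Unshelve. all: by end_near. Qed.

Lemma continuous_comp_upd phi i (x : V) : continuous phi ->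
  continuous (fun t : R => phi (upd i t x)).
Proof.
move=> cp t.
have H1 : {for t, continuous (fun t : R => upd i t x)} by exact: continuous_upd.
have H2 : {for upd i t x, continuous phi} by exact: cp.
exact: (continuous_comp H1 H2).
Qed.

Lemma upd_norm_ge i (x : V) t : `|t| <= `|upd i t x|.
Proof. by have := coord_norm_le (upd i t x) i; rewrite updE eqxx. Qed.

(** The fundamental theorem of calculus for |phi|^g along a coordinate line,
    with the derivative bounded by its absolute value. *)
Lemma le_lineint_powabs Omega phi i (x : V) (g : R) : 1 < g -> test_function Omega phi ->
  ((`|phi x| `^ g)%:E <= lineint i
    (fun z => (g * (`|phi z| `^ (g - 1) * `|partial i phi z|))%:E) x)%E.
Proof.
move=> g1 tp; have sp := test_smooth tp.
have [r r0 hr] := test_support_bounded tp.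
pose F t := `|phi (upd i t x)| `^ g.
pose f t := dpowabs g (phi (upd i t x)) * partial i phi (upd i t x).
have dF (t : R) : is_derive t 1 F (f t).
  exact: (is_derive1_comp (is_derive_powabs (phi (upd i t x)) g1) (is_derive_upd i x t sp)).
have cf : continuous f.
  move=> t.
  have H1 : {for t, continuous (fun t : R => phi (upd i t x))}.
    by apply: continuous_comp_upd; exact: smooth_continuous.
  have H2 : {for phi (upd i t x), continuous (dpowabs g)} by exact: continuous_dpowabs.
  have H3 : {for t, continuous (fun t : R => partial i phi (upd i t x))}.
    by apply: continuous_comp_upd; apply: smooth_continuous; exact: smooth_partial.
  exact: (continuousM (continuous_comp H1 H2) H3).
have F0 t : t <= - (r + 1) -> F t = 0.
  move=> tr; rewrite /F (_ : phi _ = 0) ?normr0 ?powR0 ?gt_eqF ?(lt_trans _ g1)//.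
  apply/eqP; apply: contraT => /hr; apply: contraTT => _; rewrite -ltNge.
  rewrite (lt_le_trans _ (upd_norm_ge i x t))// ltr_normr; apply/orP; right; lra.
have := le_integral_derivative (x ord0 i) dF cf F0.
rewrite /F upd_id ger0_norm ?powR_ge0// => /le_trans; apply.
rewrite /lineint le_eqVlt; apply/orP; left; apply/eqP; apply: eq_integral => t _.
by rewrite /f normrM normr_dpowabs// mulrA.
Qed.

End test_functions.

(** * The Sobolev inequality *)

Section sobolev.
Context {R : realType}.
Local Notation leb n := (@lebesgue_rV R n).

Definition sqgrad N (phi : 'rV[R]_N -> R) (x : 'rV[R]_N) : R :=
  \sum_(i < N) (partial i phi x) ^+ 2.

Lemma sqgrad_ge0 N (phi : 'rV[R]_N -> R) x : 0 <= sqgrad phi x.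
Proof. by apply: sumr_ge0 => i _; exact: sqr_ge0. Qed.

Lemma le_sqgrad N (phi : 'rV[R]_N -> R) i x : (partial i phi x) ^+ 2 <= sqgrad phi x.
Proof.
by rewrite /sqgrad (bigD1 i)//= lerDl sumr_ge0// => j _; exact: sqr_ge0.
Qed.

Lemma measurable_sqgrad N (phi : 'rV[R]_N -> R) : smooth phi ->
  measurable_fun setT (sqgrad phi).
Proof.
move=> sp; apply: measurable_sum => i; apply: measurable_funX.
apply: continuous_measurable_rV; apply: smooth_continuous; exact: smooth_partial.
Qed.

Definition energy N (phi : 'rV[R]_N -> R) : \bar R :=
  (\int[leb N]_x (sqgrad phi x)%:E)%E.

Lemma energy_ge0 N (phi : 'rV[R]_N -> R) : (0 <= energy phi)%E.
Proof. by apply: integral_ge0 => x _; rewrite lee_fin sqgrad_ge0. Qed.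

Lemma prode_powR_cst n (x r : R) : 0 <= x -> 0 < r ->
  (\prod_(i < n) (x%:E `^ r) = (x `^ (r * n%:R))%:E)%E.
Proof.
move=> x0 r0; elim: n => [|n IH]; first by rewrite big_ord0 mulr0 powRr0.
rewrite big_ord_recl IH poweR_EFin -EFinM -powRD.
  by rewrite -natr1 mulrDr mulr1 addrC.
by apply/implyP => /eqP H; exfalso; move: H; apply/eqP; rewrite gt_eqF// ltr_wpDr ?mulr_ge0// ltW.
Qed.

(** Absorption of a power of a on the right-hand side into the left-hand side,
    possible because q < 2. The exponent m is the inverse of 1 - q / 2. *)
Lemma absorb_power (a d g q m p : R) : 0 <= a -> 0 <= d -> 0 <= g -> 0 < m -> 0 < q ->
  (1 - q / 2) * m = 1 -> q * m = p ->
  a <= (g * (a `^ 2^-1 * d `^ 2^-1)) `^ q -> a <= g `^ p * d `^ (p / 2).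
Proof.
move=> a0 d0 g0 m0 q0 qm qp.
have [->|an0] := eqVneq a 0; first by rewrite mulr_ge0 ?powR_ge0.
have ap : 0 < a by rewrite lt0r an0.
rewrite !powRM ?mulr_ge0 ?powR_ge0// -!powRrM => H.
have aq : 0 < a `^ (2^-1 * q) by rewrite powR_gt0.
have {}H : a `^ (1 - 2^-1 * q) <= g `^ q * d `^ (2^-1 * q).
  rewrite powRB; last by rewrite an0 implybT.
  rewrite powRr1// ler_pdivrMr//; apply: (le_trans H).
  by rewrite le_eqVlt; apply/orP; left; apply/eqP; ring.
have : (a `^ (1 - 2^-1 * q)) `^ m <= (g `^ q * d `^ (2^-1 * q)) `^ m.
  by rewrite ge0_ler_powR ?nnegrE ?mulr_ge0 ?powR_ge0// ltW.
rewrite powRM ?powR_ge0// -!powRrM.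
have -> : (1 - 2^-1 * q) * m = 1 by rewrite -[RHS]qm [2^-1 * q]mulrC.
have -> : 2^-1 * q * m = p / 2 by rewrite -qp; field.
by rewrite qp powRr1.
Qed.

(** The argument of Gagliardo and Nirenberg. On the line through x parallel to
    the i-th axis, |phi(x)|^gam is at most the integral of gam |phi|^(gam - 1)
    |d_i phi|. The N inequalities are multiplied and raised to the power 1 /
    (N - 1); the Loomis-Whitney inequality and the Cauchy-Schwarz inequality
    conclude. The exponent gam = 2 (N - 1) / (N - 2) is the one for which both
    gam N / (N - 1) and 2 (gam - 1) are the Sobolev exponent p, so that the
    same integral A occurs on both sides. *)
Lemma sobolev N (Omega : set 'rV[R]_N) (phi : 'rV[R]_N -> R) : (3 <= N)%N ->
  test_function Omega phi ->
  (\int[leb N]_x (`|phi x| `^ crit_exp N 0)%:E <=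
   ((2 * (N%:R - 1) / (N%:R - 2)) `^ crit_exp N 0)%:E *
     energy phi `^ (crit_exp N 0 / 2))%E.
Proof.
case: N Omega phi => [|[|[|n]]]// Omega phi _ tp.
have sp := test_smooth tp.
set p := crit_exp n.+3 0; set gam : R := 2 * (n.+3%:R - 1) / (n.+3%:R - 2).
have N1 : n.+3%:R - 1 = n.+2%:R :> R by rewrite -[n.+3]addn1 natrD addrK.
have N2 : n.+3%:R - 2 = n.+1%:R :> R by rewrite -[n.+3]addn2 natrD addrK.
have gamE : gam = 2 * n.+2%:R / n.+1%:R by rewrite /gam N1 N2.
have pE : p = 2 * n.+3%:R / n.+1%:R by rewrite /p /crit_exp subr0 N2.
have [n1 n2 n3] : [/\ 0 < n.+1%:R :> R, 0 < n.+2%:R :> R & 0 < n.+3%:R :> R] by [].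
have n21 : n.+2%:R = n.+1%:R + 1 :> R by rewrite natr1.
have n32 : n.+3%:R = n.+1%:R + 2 :> R by rewrite -[n.+3]addn2 natrD.
have gam1 : 1 < gam by rewrite gamE ltr_pdivlMr// mul1r n21; lra.
have p0 : 0 < p by rewrite pE divr_gt0// mulr_gt0.
have gp : (gam - 1) * 2 = p.
  by rewrite gamE pE n21 n32; field; rewrite gt_eqF.
have gq : gam * (n.+2%:R^-1 * n.+3%:R) = p.
  by rewrite gamE pE; field; rewrite !gt_eqF.
pose A := (\int[leb n.+3]_x (`|phi x| `^ p)%:E)%E; rewrite -/A.
have mphiR (r : R) : measurable_fun setT (fun x => `|phi x| `^ r).
  apply: (measurableT_comp (measurable_powR _)).
  by apply: measurableT_comp => //; exact: test_measurable tp.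
have mphi (r : R) : measurable_fun setT (fun x => (`|phi x| `^ r)%:E).
  exact/measurable_EFinP.
have md i : measurable_fun setT (partial i phi) by exact: (test_measurable (test_partial i tp)).
have A0 : (0 <= A)%E by apply: integral_ge0 => x _; rewrite lee_fin powR_ge0.
have Afin : A \is a fin_num.
  by rewrite ge0_fin_numE//; exact: test_powR_integral_fin tp.
pose g i z := (gam * (`|phi z| `^ (gam - 1) * `|partial i phi z|))%:E.
have g0 i z : (0 <= g i z)%E.
  by rewrite lee_fin !mulr_ge0 ?powR_ge0// ltW// (lt_trans _ gam1).
have mg i : measurable_fun setT (g i).
  apply/measurable_EFinP; apply: measurable_funM => //.
  by apply: measurable_funM => //; exact: measurableT_comp.
have Ig i : (\int[leb n.+3]_x g i x <=
    gam%:E * (A `^ 2^-1 * energy phi `^ 2^-1))%E.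
  rewrite /g; under eq_integral do rewrite EFinM.
  have gam0 : 0 <= gam by rewrite ltW// (lt_trans _ gam1).
  have mh : measurable_fun setT
      (fun x => (`|phi x| `^ (gam - 1) * `|partial i phi x|)%:E).
    apply/measurable_EFinP; apply: measurable_funM => //.
    exact: measurableT_comp.
  have h0 x : (0 <= (`|phi x| `^ (gam - 1) * `|partial i phi x|)%:E)%E.
    by rewrite lee_fin mulr_ge0 ?powR_ge0.
  rewrite (ge0_integralZl_EFin _ measurableT (fun x _ => h0 x) mh gam0).
  apply: lee_wpmul2l; first by rewrite lee_fin ltW// (lt_trans _ gam1).
  have h2 : 0 < 2^-1 :> R by rewrite invr_gt0.
  have h22 : 2^-1 + 2^-1 = 1 :> R by field.
  have md2 : measurable_fun setT (fun x => ((partial i phi x) ^+ 2)%:E).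
    by apply/measurable_EFinP; exact: measurable_funX.
  have := @holder_poweR R _ _ (leb n.+3) (fun x => (`|phi x| `^ p)%:E)
    (fun x => ((partial i phi x) ^+ 2)%:E) _ _ (mphi p) _ md2 _ h2 h2 h22.
  move=> /(_ (fun x => powR_ge0 _ _) (fun x => sqr_ge0 _)) H.
  rewrite (eq_integral (fun x => ((`|phi x| `^ p)%:E `^ 2^-1 *
     ((partial i phi x) ^+ 2)%:E `^ 2^-1)%E)); last first.
    move=> x _; rewrite !poweR_EFin -EFinM -powRrM -gp mulfK//; congr (_ * _)%:E.
    by rewrite powR12_sqrt ?sqr_ge0// sqrtr_sqr.
  apply: (le_trans H); apply: lee_wpmul2l; first exact: poweR_ge0.
  apply: le_poweR (ltW h2) _ _.
    by apply: integral_ge0 => x _; rewrite lee_fin sqr_ge0.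
  apply: ge0_le_integral => //.
  - by move=> x _; rewrite lee_fin sqr_ge0.
  - by apply/measurable_EFinP; exact: measurable_sqgrad.
  - by move=> x _; rewrite lee_fin; exact: le_sqgrad.
have n2i : 0 < n.+2%:R^-1 :> R by rewrite invr_gt0.
have main : (A <= (gam%:E * (A `^ 2^-1 * energy phi `^ 2^-1)) `^ (n.+3%:R / n.+2%:R))%E.
  have K0 : (0 <= gam%:E * (A `^ 2^-1 * energy phi `^ 2^-1))%E.
    by rewrite !mule_ge0 ?poweR_ge0// lee_fin ltW// (lt_trans _ gam1).
  have K1 : (\prod_(i < n.+3) (\int[leb n.+3]_x g i x) `^ n.+2%:R^-1 <=
      (gam%:E * (A `^ 2^-1 * energy phi `^ 2^-1)) `^ (n.+3%:R / n.+2%:R))%E.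
    apply: (@le_trans _ _ (\prod_(i < n.+3)
       (gam%:E * (A `^ 2^-1 * energy phi `^ 2^-1)) `^ n.+2%:R^-1)%E).
      apply: le_prode_ord => i; first exact: poweR_ge0.
      by apply: le_poweR (ltW n2i) _ (Ig i); exact: integral_ge0.
    move: K0; case: (gam%:E * _)%E => [k| |] // k0.
      by rewrite prode_powR_cst// poweR_EFin mulrC.
    by rewrite [leRHS]poweRyr ?leey// gt_eqF// divr_gt0.
  apply: (le_trans _ K1); apply: (le_trans _ (loomis_whitney mg g0)).
  apply: ge0_le_integral => //.
  - apply: measurable_prode => i.
    exact: (measurableT_comp (measurable_poweR _) (measurable_lineint i (mg i) (g0 i))).
  move=> x _; apply: (@le_trans _ _ (\prod_(i < n.+3) (`|phi x| `^ gam)%:E `^ n.+2%:R^-1)%E).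
    by rewrite prode_powR_cst ?powR_ge0// -powRrM gq.
  apply: le_prode_ord => i; first exact: poweR_ge0.
  apply: le_poweR (ltW n2i) _ _; first by rewrite lee_fin powR_ge0.
  exact: le_lineint_powabs tp.
have [Dy|Dy] := eqVneq (energy phi) +oo%E.
  rewrite Dy poweRyr ?gt_eqF ?divr_gt0// gt0_muley ?leey//.
  by rewrite lte_fin powR_gt0// (lt_trans _ gam1).
have Dfin : energy phi \is a fin_num by rewrite ge0_fin_numE ?energy_ge0// ltey.
have [a aE] : exists a, A = a%:E by exists (fine A); rewrite fineK.
have [d dE] : exists d, energy phi = d%:E by exists (fine (energy phi)); rewrite fineK.
have a0 : 0 <= a by move: A0; rewrite aE lee_fin.
have d0 : 0 <= d by rewrite -lee_fin -dE energy_ge0.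
move: main; rewrite aE dE !poweR_EFin -!EFinM !lee_fin.
have gam0 : 0 < gam by exact: lt_trans gam1.
have q0 : 0 < n.+3%:R / n.+2%:R :> R by rewrite divr_gt0.
apply: (absorb_power a0 d0 (ltW gam0) gam0 q0).
  have aux (k : R) : 0 < k -> (1 - (k + 2) / (k + 1) / 2) * (2 * (k + 1) / k) = 1.
    by move=> k0; field; rewrite !lt0r_neq0//; lra.
  by rewrite gamE n32 n21; exact: aux.
by rewrite -gq; field; rewrite gt_eqF.
Qed.

End sobolev.

(** * Circular cones and the Hardy-Sobolev inequality *)

Section cones.
Context {R : realType} {N : nat}.
Local Notation V := 'rV[R]_N.
Implicit Types (a i : 'I_N) (x : V) (c : R).
Local Notation leb := (@lebesgue_rV R N).

Lemma enormE x : enorm x = Num.sqrt (\sum_(i < N) x ord0 i ^+ 2).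
Proof. by rewrite /enorm /dotr; under eq_bigr do rewrite -expr2. Qed.

Lemma enorm_ge0 x : 0 <= enorm x.
Proof. exact: sqrtr_ge0. Qed.

Lemma enorm_sqr x : enorm x ^+ 2 = \sum_(i < N) x ord0 i ^+ 2.
Proof. by rewrite enormE sqr_sqrtr// sumr_ge0// => i _; exact: sqr_ge0. Qed.

Lemma enorm_coord x i : `|x ord0 i| <= enorm x.
Proof.
rewrite enormE -sqrtr_sqr ler_sqrt; last by rewrite sumr_ge0// => j _; exact: sqr_ge0.
by rewrite (bigD1 i)//= lerDl sumr_ge0// => j _; exact: sqr_ge0.
Qed.

(** The distance to the a-th coordinate axis. *)
Definition rad a x : R := Num.sqrt (\sum_(j < N | j != a) x ord0 j ^+ 2).

(** The open circular cones around the a-th half-axis: c is the cotangent of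
    the half-angle, so that c = 0 is a half-space and negative values of c
    give cones larger than a half-space. *)
Definition ocone a c : set V := [set x | c * rad a x < x ord0 a].

Lemma rad_ge0 a x : 0 <= rad a x.
Proof. exact: sqrtr_ge0. Qed.

Lemma rad_sqr a x : rad a x ^+ 2 = \sum_(j < N | j != a) x ord0 j ^+ 2.
Proof. by rewrite /rad sqr_sqrtr// sumr_ge0// => i _; exact: sqr_ge0. Qed.

Lemma rad_coord a i x : i != a -> `|x ord0 i| <= rad a x.
Proof.
move=> ia; rewrite /rad -sqrtr_sqr ler_sqrt; last by rewrite sumr_ge0// => j _; exact: sqr_ge0.
by rewrite (bigD1 i)//= lerDl sumr_ge0// => j _; exact: sqr_ge0.
Qed.

Lemma enorm_rad a x : enorm x ^+ 2 = x ord0 a ^+ 2 + rad a x ^+ 2.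
Proof. by rewrite enorm_sqr rad_sqr (bigD1 a). Qed.

(** A line parallel to the i-th axis meets the cone at height x_a in a segment
    with |x_i| <= x_a / c, so that the weight t^2 produced by the
    one-dimensional Hardy inequality is at most (x_a / c)^2 on the support. *)
Lemma hardy_cone a i c phi : 0 < c -> i != a -> test_function (ocone a c) phi ->
  (\int[leb]_x (phi x ^+ 2 * (x ord0 a)^-1 ^+ 2)%:E <=
   (4 / c ^+ 2)%:E * energy phi)%E.
Proof.
move=> c0 ia tp; have sp := test_smooth tp.
have [r r0 hr] := test_support_bounded tp.
have mphi := test_measurable tp.
have mdi : measurable_fun setT (partial i phi) := test_measurable (test_partial i tp).
have cc0 : 0 <= 4 / c ^+ 2 by rewrite divr_ge0// sqr_ge0.
have mf : measurable_fun setT (fun x => (phi x ^+ 2 * (x ord0 a)^-1 ^+ 2)%:E).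
  apply/measurable_EFinP; apply: measurable_funM; first exact: measurable_funX.
  under eq_fun => x.
    rewrite -real_normK ?num_real// normfV -(powR_inv1 (normr_ge0 (x ord0 a))).
    over.
  apply: measurable_funX; apply: (measurableT_comp (measurable_powR _)).
  by apply: measurableT_comp => //; exact: measurable_coor.
have mg : measurable_fun setT (fun x => (4 / c ^+ 2 * (partial i phi x) ^+ 2)%:E).
  by apply/measurable_EFinP; apply: measurable_funM => //; exact: measurable_funX.
apply: (@le_trans _ _ (\int[leb]_x (4 / c ^+ 2 * (partial i phi x) ^+ 2)%:E)%E); last first.
  under eq_integral do rewrite EFinM.
  rewrite ge0_integralZl_EFin//; last 2 first.
  - by move=> x _; rewrite lee_fin sqr_ge0.
  - by apply/measurable_EFinP; exact: measurable_funX.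
  apply: lee_wpmul2l; first by rewrite lee_fin.
  apply: ge0_le_integral => //.
  - by move=> x _; rewrite lee_fin sqr_ge0.
  - by apply/measurable_EFinP; exact: measurable_funX.
  - by apply/measurable_EFinP; exact: measurable_sqgrad.
  - by move=> x _; rewrite lee_fin; exact: le_sqgrad.
apply: (le_integral_lineint (i := i)) => //.
- by move=> x; rewrite lee_fin mulr_ge0// sqr_ge0.
- by move=> x; rewrite lee_fin mulr_ge0// sqr_ge0.
move=> x; rewrite /lineint.
pose w t := phi (upd i t x); pose w' t := partial i phi (upd i t x).
have cw' : continuous w'.
  apply: continuous_comp_upd; apply: smooth_continuous; exact: smooth_partial.
have w0 t : r + 1 <= `|t| -> w t = 0.
  move=> tr; apply/eqP; apply: contraT => /hr; apply: contraTT => _; rewrite -ltNge.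
  by rewrite (lt_le_trans _ (upd_norm_ge i x t))// (lt_le_trans _ tr)// ltrDl.
have H := hardy1 (fun t => is_derive_upd i x t sp) cw' w0.
have mw' : measurable_fun (setT : set (measurableTypeR R)) w'.
  exact: continuous_measurable_fun.
have xa t : upd i t x ord0 a = x ord0 a by rewrite updE eq_sym (negbTE ia).
have mw : measurable_fun (setT : set (measurableTypeR R)) (fun t => (w t ^+ 2)%:E).
  apply/measurable_EFinP; apply: measurable_funX; apply: continuous_measurable_fun.
  by apply: continuous_comp_upd; exact: smooth_continuous.
have mtw : measurable_fun (setT : set (measurableTypeR R)) (fun t => (t ^+ 2 * w' t ^+ 2)%:E).
  apply/measurable_EFinP; apply: measurable_funM; apply: measurable_funX.
    exact: measurable_id.
  exact: continuous_measurable_fun.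
have k0 : 0 <= (x ord0 a)^-1 ^+ 2 by exact: sqr_ge0.
under eq_integral => t _ do rewrite xa mulrC EFinM -/(w t).
rewrite ge0_integralZl_EFin//; last by move=> t _; rewrite lee_fin sqr_ge0.
apply: (le_trans (lee_wpmul2l _ H)); first by rewrite lee_fin.
rewrite muleA -EFinM -ge0_integralZl_EFin//; last 2 first.
- by move=> t _; rewrite lee_fin mulr_ge0 ?sqr_ge0.
- by rewrite mulr_ge0.
apply: ge0_le_integral => //.
- move=> t _; rewrite -EFinM lee_fin; apply: mulr_ge0; first exact: mulr_ge0.
  by apply: mulr_ge0; exact: sqr_ge0.
- exact: (measurable_funeM _ mtw).
- by apply/measurable_EFinP; apply: measurable_funM => //; exact: measurable_funX.
move=> t _; rewrite -EFinM lee_fin -/(w' t).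
have [->|nz] := eqVneq (w' t) 0; first by rewrite expr0n/= !mulr0.
have := test_supp (test_partial i tp) nz; rewrite /ocone/= xa => hc.
have ht : c * `|t| < x ord0 a.
  apply: le_lt_trans hc; rewrite ler_pM2l//.
  by have := rad_coord (upd i t x) ia; rewrite updE eqxx.
have xa0 : 0 < x ord0 a by apply: le_lt_trans ht; rewrite mulr_ge0// ltW.
rewrite mulrA ler_wpM2r ?sqr_ge0//.
rewrite exprVn [_ * 4]mulrC -mulrA ler_wpM2l//.
rewrite mulrC ler_pdivrMr ?exprn_gt0// mulrC ler_pdivlMr ?exprn_gt0//.
rewrite -exprMn -(real_normK (num_real (t * c))) ler_pXn2r ?nnegrE ?normr_ge0 ?(ltW xa0)//.
by rewrite normrM (gtr0_norm c0) mulrC ltW.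
Qed.

Definition wnorm (s : R) (phi : V -> R) : \bar R :=
  (\int[leb]_x (`|phi x| `^ crit_exp N s / enorm x `^ s)%:E)%E.

Lemma measurable_enorm : measurable_fun [set: V] (@enorm R N).
Proof.
apply: (measurableT_comp (continuous_measurable_fun (@sqrt_continuous R))).
by apply: measurable_sum => i; apply: measurable_funM; exact: measurable_coor.
Qed.

Lemma measurable_weight (s : R) : measurable_fun [set: V] (fun x => (enorm x `^ s)^-1).
Proof.
under eq_fun do rewrite -powRN; apply: (measurableT_comp (measurable_powR _)).
exact: measurable_enorm.
Qed.

Lemma measurable_normr_powR (D : set V) (phi : V -> R) (r : R) : measurable_fun D phi ->
  measurable_fun D (fun x => `|phi x| `^ r).
Proof.
move=> mphi; apply: (measurableT_comp (measurable_powR _)).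
exact: measurableT_comp.
Qed.

Definition sobolev_cst : R :=
  (2 * (N%:R - 1) / (N%:R - 2)) `^ crit_exp N 0.

(** Interpolation between Hardy's inequality, with weight s / 2, and Sobolev's
    inequality, with weight 1 - s / 2. Since s > 0, the small constant of the
    former makes the constant small when the cone is thin. *)
Lemma hardy_sobolev_cone a c (s : R) phi : (3 <= N)%N -> 0 < s -> s < 2 -> 0 < c ->
  test_function (ocone a c) phi ->
  (wnorm s phi <= ((4 / c ^+ 2) `^ (s / 2) * sobolev_cst `^ (1 - s / 2))%:E *
     energy phi `^ (crit_exp N s / 2))%E.
Proof.
move=> N3 s0 s2 c0 tp.
have mphi := test_measurable tp.
have [i ia] : exists i, i != a.
  have [e|ne] := eqVneq (Ordinal (leq_trans (isT : (0 < 3)%N) N3)) a.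
    exists (Ordinal (leq_trans (isT : (1 < 3)%N) N3)).
    by rewrite -e -(inj_eq val_inj).
  by exists (Ordinal (leq_trans (isT : (0 < 3)%N) N3)).
have N2 : 0 < N%:R - 2 :> R by rewrite subr_gt0 (ltr_nat R 2).
have s20 : 0 < s / 2 by rewrite divr_gt0.
have s21 : 0 < 1 - s / 2 by lra.
have ss : s / 2 + (1 - s / 2) = 1 by ring.
pose p0 := crit_exp N (0 : R); set p := crit_exp N s.
have pp : s + p0 * (1 - s / 2) = p.
  by rewrite /p /p0 /crit_exp; field; rewrite gt_eqF.
have p00 : 0 < p0 by rewrite /p0 /crit_exp subr0 divr_gt0// mulr_gt0// ltr0n (leq_trans _ N3).
pose f x := (phi x ^+ 2 * (x ord0 a)^-1 ^+ 2)%:E.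
pose g x := (`|phi x| `^ p0)%:E.
have mf : measurable_fun setT f.
  apply/measurable_EFinP; apply: measurable_funM; first exact: measurable_funX.
  under eq_fun => x.
    rewrite -real_normK ?num_real// normfV -(powR_inv1 (normr_ge0 (x ord0 a))).
    over.
  apply: measurable_funX; apply: (measurableT_comp (measurable_powR _)).
  by apply: measurableT_comp => //; exact: measurable_coor.
have mg : measurable_fun setT g by apply/measurable_EFinP; exact: measurable_normr_powR.
have f0 x : (0 <= f x)%E by rewrite lee_fin mulr_ge0// sqr_ge0.
have g0 x : (0 <= g x)%E by rewrite lee_fin powR_ge0.
have pw x : ((`|phi x| `^ p / enorm x `^ s)%:E <= f x `^ (s / 2) * g x `^ (1 - s / 2))%E.
  rewrite /f /g !poweR_EFin -EFinM lee_fin.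
  have [z|nz] := eqVneq (phi x) 0.
    rewrite z normr0 powR0 ?mul0r ?mulr_ge0 ?powR_ge0// gt_eqF//.
    by rewrite -pp addr_gt0// mulr_gt0.
  have xa : 0 < x ord0 a.
    by apply: le_lt_trans (test_supp tp nz); rewrite mulr_ge0 ?rad_ge0// ltW.
  have ex : x ord0 a <= enorm x by rewrite (le_trans _ (enorm_coord x a))// ler_norm.
  have np : 0 < `|phi x| by rewrite normr_gt0.
  rewrite -real_normK ?num_real// -exprMn -powR_mulrn ?mulr_ge0 ?invr_ge0 ?(ltW xa)//.
  rewrite -powRrM mulrCA mulfV// mulr1 powRM ?invr_ge0 ?(ltW xa)//.
  rewrite -powRrM mulrAC -powRD; last by rewrite normr_eq0 nz implybT.
  rewrite pp ler_wpM2l ?powR_ge0//.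
  rewrite -(powR_inv1 (ltW xa)) -powRrM mulN1r powRN.
  rewrite lef_pV2 ?posrE ?powR_gt0//; last exact: lt_le_trans ex.
  by rewrite ge0_ler_powR ?nnegrE ?(ltW s0) ?(ltW xa)// (le_trans (ltW xa)).
apply: (@le_trans _ _ (\int[leb]_x (f x `^ (s / 2) * g x `^ (1 - s / 2)))%E).
  apply: ge0_le_integral => //.
  - by move=> x _; rewrite lee_fin divr_ge0 ?powR_ge0.
  - apply/measurable_EFinP; apply: measurable_funM; first exact: measurable_normr_powR.
    exact: measurable_weight.
  - by apply: emeasurable_funM; apply: (measurableT_comp (measurable_poweR _)).
apply: (le_trans (holder_poweR _ mf f0 mg g0 s20 s21 ss)).
have H := hardy_cone c0 ia tp.
have S := sobolev N3 tp.
have cc0 : 0 <= 4 / c ^+ 2 by rewrite divr_ge0// sqr_ge0.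
have E0 := energy_ge0 phi.
have If0 : (0 <= \int[leb]_x f x)%E by exact: integral_ge0.
have Ig0 : (0 <= \int[leb]_x g x)%E by exact: integral_ge0.
apply: (le_trans (lee_pmul _ _ (le_poweR (ltW s20) If0 H) (le_poweR (ltW s21) Ig0 S)));
  rewrite ?poweR_ge0//.
rewrite !poweRM ?lee_fin ?poweR_ge0 ?powR_ge0// -!poweRrM.
rewrite muleACA -poweRD; last first.
  by rewrite add_neq0_poweRD_def// gt_eqF// addr_gt0// mulr_gt0// divr_gt0.
rewrite !poweR_EFin -EFinM.
rewrite (_ : s / 2 + p0 / 2 * (1 - s / 2) = p / 2)//.
by rewrite -pp; field.
Qed.

End cones.

(** * Rayleigh quotients of test functions on thin cones *)

Section rayleigh_quotient.
Context {R : realType} {N : nat}.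
Local Notation V := 'rV[R]_N.
Local Notation leb := (@lebesgue_rV R N).
Context (s kappa alpha beta lambda mu : R) (hN : (3 <= N)%N)
  (hs0 : 0 < s) (hs2 : s < 2) (hlambda : 0 < lambda) (hmu : 0 < mu)
  (hkappa : 0 < kappa) (halpha : 1 < alpha) (hbeta : 1 < beta)
  (hab : alpha + beta = crit_exp N s).
Implicit Types (u v : V -> R) (x : V).
Local Notation p := (crit_exp N s).
Local Notation den := (S_den [set: V] s kappa alpha beta lambda mu).

Lemma crit_exp_gt0 : 0 < p.
Proof. by rewrite -hab; move: halpha hbeta; lra. Qed.

Lemma crit_exp_ge2 : 2 <= p.
Proof. by rewrite -hab; move: halpha hbeta; lra. Qed.

Definition dens u v x : R :=
  lambda * (`|u x| `^ p / enorm x `^ s)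
     + mu * (`|v x| `^ p / enorm x `^ s)
     + p * kappa * (`|u x| `^ alpha * `|v x| `^ beta / enorm x `^ s).

Lemma S_denE Omega u v :
  S_den Omega s kappa alpha beta lambda mu u v = (\int[leb]_(x in Omega) (dens u v x)%:E)%E.
Proof. by []. Qed.

Lemma densE u v x : dens u v x =
  lambda * (`|u x| `^ p / enorm x `^ s)
     + mu * (`|v x| `^ p / enorm x `^ s)
     + p * kappa * (`|u x| `^ alpha * `|v x| `^ beta / enorm x `^ s).
Proof. by []. Qed.

Lemma dens_ge0 u v x : 0 <= dens u v x.
Proof.
have p0 := crit_exp_gt0.
have w0 (b : R) : 0 <= b -> 0 <= b / enorm x `^ s.
  by move=> b0; rewrite mulr_ge0// invr_ge0 powR_ge0.
apply: addr_ge0; first apply: addr_ge0.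
- by apply: mulr_ge0 (ltW hlambda) (w0 _ _); exact: powR_ge0.
- by apply: mulr_ge0 (ltW hmu) (w0 _ _); exact: powR_ge0.
apply: mulr_ge0; first exact: mulr_ge0 (ltW p0) (ltW hkappa).
by apply: w0; apply: mulr_ge0; exact: powR_ge0.
Qed.

Lemma measurable_dens (D : set V) u v : measurable_fun D u -> measurable_fun D v ->
  measurable_fun D (dens u v).
Proof.
move=> mu' mv.
have mw : measurable_fun D (fun x => (enorm x `^ s)^-1).
  by apply: measurable_funTS; exact: measurable_weight.
have m1 (w : V -> R) (r : R) : measurable_fun D w ->
    measurable_fun D (fun x => `|w x| `^ r) by exact: measurable_normr_powR.
apply: measurable_funD; first apply: measurable_funD.
- by apply: measurable_funM => //; apply: measurable_funM => //; exact: m1.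
- by apply: measurable_funM => //; apply: measurable_funM => //; exact: m1.
- apply: measurable_funM => //; apply: measurable_funM => //.
  by apply: measurable_funM; exact: m1.
Qed.

Lemma S_den_ge0 Omega u v : (0 <= S_den Omega s kappa alpha beta lambda mu u v)%E.
Proof. by apply: integral_ge0 => x _; rewrite lee_fin dens_ge0. Qed.

Lemma le_mul_powR (a b : R) : 0 <= a -> 0 <= b ->
  a `^ alpha * b `^ beta <= a `^ p + b `^ p.
Proof.
have al0 : 0 < alpha := lt_trans ltr01 halpha.
have be0 : 0 < beta := lt_trans ltr01 hbeta.
have pE (c : R) : c `^ p = c `^ alpha * c `^ beta.
  by rewrite -hab powRD// gt_eqF// addr_gt0.
move=> a0 b0; rewrite !pE; have [ab|ba] := leP a b.
  apply: (@le_trans _ _ (b `^ alpha * b `^ beta)); last by rewrite lerDr mulr_ge0 ?powR_ge0.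
  by rewrite ler_wpM2r ?powR_ge0// ge0_ler_powR ?nnegrE// ltW.
apply: (@le_trans _ _ (a `^ alpha * a `^ beta)); last by rewrite lerDl mulr_ge0 ?powR_ge0.
by rewrite ler_wpM2l ?powR_ge0// ge0_ler_powR ?nnegrE// ltW.
Qed.

Lemma den_le_wnorm u v : measurable_fun setT u -> measurable_fun setT v ->
  (den u v <= (lambda + mu + p * kappa)%:E * (wnorm s u + wnorm s v))%E.
Proof.
move=> mu' mv; have p0 := crit_exp_gt0.
have mw (w : V -> R) : measurable_fun setT w ->
    measurable_fun setT (fun x => (`|w x| `^ p / enorm x `^ s)%:E).
  move=> mw; apply/measurable_EFinP; apply: measurable_funM.
    exact: measurable_normr_powR.
  exact: measurable_weight.
have w0 (w : V -> R) x : (0 <= (`|w x| `^ p / enorm x `^ s)%:E)%E.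
  by rewrite lee_fin divr_ge0 ?powR_ge0.
rewrite /wnorm -ge0_integralD//; last 2 first.
- exact: mw.
- exact: mw.
have M0 : 0 <= lambda + mu + p * kappa by rewrite addr_ge0 ?(mulr_ge0 (ltW p0) (ltW hkappa))// addr_ge0// ltW.
rewrite -(ge0_integralZl_EFin _ measurableT _ _ M0); last 2 first.
- by move=> x _; rewrite adde_ge0.
- by apply: emeasurable_funD; exact: mw.
rewrite S_denE; apply: ge0_le_integral => //.
- by move=> x _; rewrite lee_fin dens_ge0.
- by apply/measurable_EFinP; exact: measurable_dens.
- by apply: measurable_funeM; apply: emeasurable_funD; exact: mw.
move=> x _; rewrite -EFinD -EFinM lee_fin /dens.
have H := le_mul_powR (normr_ge0 (u x)) (normr_ge0 (v x)).
have W : 0 <= (enorm x `^ s)^-1 by rewrite invr_ge0 powR_ge0.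
have U : 0 <= `|u x| `^ p by exact: powR_ge0.
have V' : 0 <= `|v x| `^ p by exact: powR_ge0.
have {}H := ler_wpM2r W H.
have pk : 0 <= p * kappa by rewrite mulr_ge0 ?ltW.
have {}H := ler_wpM2l pk H.
have U' := mulr_ge0 U W; have V'' := mulr_ge0 V' W.
have H1 := mulr_ge0 (ltW hmu) U'; have H2 := mulr_ge0 (ltW hlambda) V''.
move: H H1 H2; rewrite mulrDl.
set A := `|u x| `^ p / _; set B := `|v x| `^ p / _; set C := _ * _ / _.
set K := p * kappa => H H1 H2.
rewrite (_ : (lambda + mu + K) * (A + B) =
   lambda * A + mu * B + K * (A + B) + (mu * A + lambda * B)); last by ring.
by rewrite -[leLHS]addr0; apply: lerD; [exact: lerD|exact: addr_ge0].
Qed.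

(** The inequality S(Omega) >= L, restricted to test functions and without
    division. The integrals may be taken over the whole space as test
    functions vanish outside Omega. *)
Definition rayleigh_ge (Omega : set V) (L : R) : Prop :=
  forall u v, test_function Omega u -> test_function Omega v ->
    (L%:E * den u v `^ (2 / p) <= energy u + energy v)%E.

Lemma rayleigh_mono Omega Omega' L : Omega `<=` Omega' ->
  rayleigh_ge Omega' L -> rayleigh_ge Omega L.
Proof. by move=> OO H u v tu tv; exact: H (test_mono OO tu) (test_mono OO tv). Qed.

(** The infimum is arbitrarily large on thin cones, as the constant of the
    Hardy-Sobolev inequality tends to 0 when c tends to +oo. *)
Lemma thin_cone (a : 'I_N) L : 0 <= L -> exists c, rayleigh_ge (ocone a c) L.
Proof.
move=> L0; have p0 := crit_exp_gt0; have p2 := crit_exp_ge2.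
have p20 : 0 < p / 2 by rewrite divr_gt0.
have p20' : 0 < 2 / p by rewrite divr_gt0.
pose M := lambda + mu + p * kappa.
have M0 : 0 < M by rewrite !addr_gt0// mulr_gt0.
pose C := @sobolev_cst R N `^ (1 - s / 2).
have C0 : 0 < C.
  rewrite powR_gt0// powR_gt0// divr_gt0// ?mulr_gt0// subr_gt0.
    by rewrite (ltr_nat R 1) (leq_trans _ hN).
  by rewrite (ltr_nat R 2) (leq_trans _ hN).
(* e is chosen so that L (2 M C e)^(2/p) <= 1 *)
pose e := ((L + 1) `^ (- (p / 2))) / (2 * M * C).
have e0 : 0 < e by rewrite divr_gt0 ?powR_gt0 ?mulr_gt0// ltr_wpDl.
pose eta := e `^ (2 / s).
have eta0 : 0 < eta by rewrite powR_gt0.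
pose c := 2 / Num.sqrt eta.
have c0 : 0 < c by rewrite divr_gt0 ?sqrtr_gt0.
have cE : (4 / c ^+ 2) `^ (s / 2) = e.
  rewrite /c expr_div_n sqr_sqrtr ?(ltW eta0)//.
  rewrite (_ : 4 / (2 ^+ 2 / eta) = eta); last by field; rewrite gt_eqF.
  rewrite /eta -powRrM (_ : 2 / s * (s / 2) = 1) ?powRr1 ?(ltW e0)//.
  by field; rewrite gt_eqF.
exists c => u v tu tv.
have mu' := test_measurable tu; have mv := test_measurable tv.
have Hu := hardy_sobolev_cone hN hs0 hs2 c0 tu.
have Hv := hardy_sobolev_cone hN hs0 hs2 c0 tv.
rewrite cE -/C in Hu Hv.
have [Eu Ev] := (energy_ge0 u, energy_ge0 v).
have E0 : (0 <= energy u + energy v)%E := adde_ge0 Eu Ev.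
have H1 : (den u v <= (2 * M * C * e)%:E * (energy u + energy v) `^ (p / 2))%E.
  apply: (le_trans (den_le_wnorm mu' mv)); rewrite -/M.
  apply: (@le_trans _ _ (M%:E * ((e * C)%:E * (energy u + energy v) `^ (p / 2)
      + (e * C)%:E * (energy u + energy v) `^ (p / 2)))%E).
    apply: lee_wpmul2l; first by rewrite lee_fin ltW.
    have eC0 : (0 <= (e * C)%:E)%E by rewrite lee_fin mulr_ge0 ?(ltW e0) ?(ltW C0).
    have K1 := le_poweR (ltW p20) Eu (leeDl (energy u) Ev).
    have K2 := le_poweR (ltW p20) Ev (leeDr (energy v) Eu).
    exact: leeD (le_trans Hu (lee_wpmul2l eC0 K1)) (le_trans Hv (lee_wpmul2l eC0 K2)).
  have eC0 : (0 <= (e * C)%:E)%E by rewrite lee_fin mulr_ge0 ?(ltW e0) ?(ltW C0).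
  rewrite -(ge0_muleDl _ eC0 eC0).
  rewrite -EFinD muleA -EFinM.
  by rewrite (_ : M * (e * C + e * C) = 2 * M * C * e)//; ring.
have MCe : 2 * M * C * e = (L + 1) `^ (- (p / 2)).
  by rewrite /e mulrC divfK// gt_eqF// !mulr_gt0.
have K0 : 0 <= 2 * M * C * e by rewrite MCe powR_ge0.
have H2 := le_poweR (ltW p20') (S_den_ge0 [set: V] u v) H1.
rewrite poweRM ?lee_fin ?poweR_ge0// -poweRrM in H2.
have pp : p / 2 * (2 / p) = 1 by field; rewrite gt_eqF.
rewrite pp (poweRe1 E0) in H2.
apply: (@le_trans _ _ (L%:E * ((2 * M * C * e)%:E `^ (2 / p) * (energy u + energy v)))%E).
  by apply: lee_wpmul2l => //; rewrite lee_fin.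
rewrite poweR_EFin muleA -EFinM.
have c1 : ((L * (2 * M * C * e) `^ (2 / p))%:E <= 1%:E :> \bar R)%E.
  rewrite lee_fin MCe -powRrM mulNr pp.
  rewrite powR_inv1; last by rewrite addr_ge0.
  by rewrite ler_pdivrMr ?mul1r ?lerDl// ltr_wpDl.
have := lee_wpmul2r E0 c1; rewrite mul1e.
exact.
Qed.

End rayleigh_quotient.

(** * A smooth approximation of the distance to the axis *)

Section shear_geometry.
Context {R : realType} {N : nat}.
Local Notation V := 'rV[R]_N.
Implicit Types (a i : 'I_N) (x : V) (rho eps t : R).
Local Notation e_ i := (delta_mx ord0 i : V).

Definition hq a rho x : R := rho ^+ 2 + \sum_(j < N | j != a) x ord0 j * x ord0 j.

(** A smooth substitute for rad a, which is singular on the axis. It lies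
    between rad a and rho + rad a, does not depend on the a-th coordinate, and
    has a gradient of length at most 1. *)
Definition hyp a rho x : R := hq a rho x `^ 2^-1.

Lemma hqE a rho x : hq a rho x = rho ^+ 2 + rad a x ^+ 2.
Proof. by rewrite rad_sqr. Qed.

Lemma hq_gt0 a rho x : 0 < rho -> 0 < hq a rho x.
Proof. by move=> r0; rewrite hqE ltr_pwDl ?exprn_gt0// sqr_ge0. Qed.

Lemma smooth_hq a rho : smooth (hq a rho).
Proof.
apply: smoothD; first exact: smooth_cst.
by apply: smooth_sum => j; apply: smoothM; exact: smooth_coord.
Qed.

Lemma smooth_hyp a rho : 0 < rho -> smooth (hyp a rho).
Proof.
by move=> r0; apply: smooth_powR; [exact: smooth_hq|move=> x; exact: hq_gt0].
Qed.

Lemma hyp_sqr a rho x : 0 < rho -> hyp a rho x ^+ 2 = rho ^+ 2 + rad a x ^+ 2.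
Proof.
move=> r0; rewrite -powR_mulrn ?powR_ge0// -powRrM mulVf// powRr1 ?hqE//.
by rewrite addr_ge0 ?sqr_ge0.
Qed.

Lemma hyp_ge0 a rho x : 0 <= hyp a rho x.
Proof. exact: powR_ge0. Qed.

Lemma rad_le_hyp a rho x : 0 < rho -> rad a x <= hyp a rho x.
Proof.
move=> r0; rewrite -(ler_pXn2r (ltn0Sn 1)) ?nnegrE ?rad_ge0 ?hyp_ge0//.
by rewrite hyp_sqr// lerDr sqr_ge0.
Qed.

Lemma hyp_le a rho x : 0 < rho -> hyp a rho x <= rho + rad a x.
Proof.
move=> r0; have r0' := ltW r0; have rx := rad_ge0 a x.
rewrite -(ler_pXn2r (ltn0Sn 1)) ?nnegrE ?hyp_ge0 ?addr_ge0//.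
by rewrite hyp_sqr// sqrrD addrAC lerDl mulrn_wge0// mulr_ge0.
Qed.

Lemma add_coord x t i j : (x + t *: e_ i) ord0 j = x ord0 j + t * (j == i)%:R.
Proof. by rewrite !mxE eqxx. Qed.

Lemma rad_shear a x t : rad a (x + t *: e_ a) = rad a x.
Proof.
rewrite /rad; congr Num.sqrt; apply: eq_bigr => j ja.
by rewrite add_coord (negbTE ja) mulr0 addr0.
Qed.

Lemma hyp_shear a rho x t : hyp a rho (x + t *: e_ a) = hyp a rho x.
Proof. by rewrite /hyp !hqE rad_shear. Qed.

Lemma hyp_upd a rho t x : hyp a rho (upd a t x) = hyp a rho x.
Proof.
have -> : upd a t x = x + (t - x ord0 a) *: e_ a.
  by rewrite -{2}(upd_id a x) updD addrC subrK.
exact: hyp_shear.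
Qed.

Lemma partial_hyp a rho i x : 0 < rho ->
  partial i (hyp a rho) x = (i != a)%:R * x ord0 i / hyp a rho x.
Proof.
move=> r0; have q0 := hq_gt0 a x r0.
have dq : is_derive x (e_ i) (hq a rho) ((i != a)%:R * (2 * x ord0 i)).
  have line t : hq a rho (x + t *: e_ i) =
      hq a rho x + (i != a)%:R * (2 * x ord0 i * t + t * t).
    rewrite /hq -addrA; congr (_ + _).
    have [->|ia] := eqVneq i a.
      rewrite mul0r addr0; apply: eq_bigr => j ja.
      by rewrite add_coord (negbTE ja) mulr0 addr0.
    rewrite mul1r (bigD1 i)//= [in RHS](bigD1 i)//= add_coord eqxx mulr1.
    rewrite (eq_bigr (fun j => x ord0 j * x ord0 j)); last first.
      by move=> j /andP[_ ji]; rewrite add_coord (negbTE ji) mulr0 addr0.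
    by ring.
  apply: is_derive_cvg.
  have H : (i != a)%:R * (2 * x ord0 i + h) @[h --> (0 : R)^'] -->
      (i != a)%:R * (2 * x ord0 i + 0).
    apply: cvgM; first exact: cvg_cst.
    by apply: cvgD; [exact: cvg_cst|exact: nbhs_dnbhs].
  rewrite addr0 in H; apply: (cvg_trans _ H); apply: near_eq_cvg; near=> h.
  have h0 : h != 0 by near: h; exact: nbhs_dnbhs_neq.
  by rewrite line; field.
have := is_derive_comp1 dq (is_derive1_powR 2^-1 q0) => H.
rewrite /partial (@derive_val _ _ _ _ _ _ _ H).
rewrite (_ : 2^-1 - 1 = - 2^-1); last by field.
rewrite powRN /hyp.
by field; rewrite gt_eqF// powR_gt0.
Unshelve. all: by end_near. Qed.

Lemma sum_partial_hyp a rho x : 0 < rho ->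
  \sum_(i < N) (partial i (hyp a rho) x) ^+ 2 <= 1.
Proof.
move=> r0; have h0 : 0 < hyp a rho x by rewrite powR_gt0// hq_gt0.
rewrite (eq_bigr (fun i => ((i != a)%:R * x ord0 i ^+ 2) / hyp a rho x ^+ 2)); last first.
  move=> i _; rewrite partial_hyp// expr_div_n exprMn; congr (_ * _ / _).
  by case: (i != a); rewrite ?expr1n ?expr0n.
rewrite -mulr_suml ler_pdivrMr ?exprn_gt0// mul1r hyp_sqr//.
rewrite (bigD1 a)//= eqxx mul0r add0r rad_sqr.
rewrite (eq_bigr (fun i => x ord0 i ^+ 2)); last by move=> i ->; rewrite mul1r.
by rewrite lerDr sqr_ge0.
Qed.

Lemma enorm_axis x t a : enorm (x + t *: e_ a) <= enorm x + `|t|.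
Proof.
have e0 := enorm_ge0 x; have t0 := normr_ge0 t.
rewrite -(ler_pXn2r (ltn0Sn 1)) ?nnegrE ?enorm_ge0 ?addr_ge0//.
have -> : enorm (x + t *: e_ a) ^+ 2 = enorm x ^+ 2 + 2 * (x ord0 a * t) + t ^+ 2.
  by rewrite (enorm_rad a) rad_shear add_coord eqxx mulr1 (enorm_rad a x); ring.
have -> : (enorm x + `|t|) ^+ 2 = enorm x ^+ 2 + 2 * (enorm x * `|t|) + t ^+ 2.
  by rewrite -[t ^+ 2]real_normK ?num_real//; ring.
have xt : x ord0 a * t <= enorm x * `|t|.
  apply: (le_trans (ler_norm _)); rewrite normrM ler_wpM2r//; exact: enorm_coord.
by rewrite lerD2r lerD2l ler_pM2l.
Qed.

Lemma ocone0 a c : ~ ocone a c (0 : V).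
Proof.
rewrite /ocone/= mxE /rad big1 ?sqrtr0 ?mulr0 ?ltxx//.
by move=> i _; rewrite mxE expr0n.
Qed.

Lemma ocone_enorm_gt0 a c x : ocone a c x -> 0 < enorm x.
Proof.
move=> cx; rewrite lt0r enorm_ge0 andbT; apply/eqP => e0.
have x0 : x = 0.
  apply/rowP => j; rewrite mxE; apply/eqP; rewrite -normr_le0 -e0.
  exact: enorm_coord.
by apply: (@ocone0 a c); rewrite -x0.
Qed.

(** The vertex does not belong to the cone, so it is at a positive distance
    from the support; this leaves room for a smoothing parameter rho. *)
Lemma test_away0 a c (u : V -> R) : test_function (ocone a c) u ->
  exists2 rho, 0 < rho & forall x, u x != 0 -> rho <= enorm x.
Proof.
move=> [su cu sO].
have : nbhs (0 : V) (~` closure [set x | u x != 0]).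
  apply: open_nbhs_nbhs; split; first exact/closed_openC/closed_closure.
  by move=> /sO; exact: ocone0.
move=> /nbhs_ballP[r /= r0 rU]; exists r => // x nz.
rewrite leNgt; apply/negP => xr; apply: (rU x); last exact: subset_closure.
rewrite -ball_normE/= sub0r normrN; apply: le_lt_trans xr.
by apply: norm_le_coord => [|i]; [exact: enorm_ge0|exact: enorm_coord].
Qed.

End shear_geometry.

(** * Shearing circular cones *)

Section integral_monotony.
Context {R : realType} d (T : measurableType d) (mu : {measure set T -> \bar R}).
Local Open Scope ereal_scope.

Lemma le_integralT (f g : T -> \bar R) :
  measurable_fun setT f -> (forall x, 0 <= f x) -> measurable_fun setT g ->
  (forall x, f x <= g x) -> \int[mu]_x f x <= \int[mu]_x g x.
Proof.
move=> mf f0 mg fg; apply: ge0_le_integral.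
- exact: measurableT.
- by move=> x _; exact: f0.
- exact: mf.
- exact: mg.
- by move=> x _; exact: fg.
Qed.

End integral_monotony.

Section shear_cone.
Context {R : realType} {N : nat}.
Local Notation V := 'rV[R]_N.
Local Notation leb := (@lebesgue_rV R N).
Local Notation e_ i := (delta_mx ord0 i : V).
Implicit Types (a i : 'I_N) (x : V) (rho eps c t : R) (u v : V -> R).

Definition slope a rho eps x : R := - eps * hyp a rho x.
(** The map x |-> x - eps h(x) e_a, with h close to rad a, maps points outside
    the cone of slope c + eps to points outside the cone of slope c: a test
    function of the cone of slope c composed with it is a test function of the
    cone of slope c + eps. *)
Definition shear a rho eps x : V := x + slope a rho eps x *: e_ a.
Definition sheared a rho eps u x : R := u (shear a rho eps x).

Lemma smooth_slope a rho eps : 0 < rho -> smooth (slope a rho eps).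
Proof. by move=> r0; exact: (smoothM (smooth_cst (- eps)) (smooth_hyp a r0)). Qed.

Lemma slope_upd a rho eps t x : slope a rho eps (upd a t x) = slope a rho eps x.
Proof. by rewrite /slope hyp_upd. Qed.

Lemma shear_coord a rho eps x : shear a rho eps x ord0 a = x ord0 a - eps * hyp a rho x.
Proof. by rewrite /shear add_coord eqxx mulr1 /slope mulNr. Qed.

Lemma shear_ocone a rho eps c x : 0 < rho -> 0 <= eps ->
  ocone a c (shear a rho eps x) -> ocone a (c + eps) x.
Proof.
move=> r0 e0; rewrite /ocone/= shear_coord /shear rad_shear ltrBrDr mulrDl.
by apply: le_lt_trans; rewrite lerD2l ler_wpM2l// rad_le_hyp.
Qed.

Lemma continuous_shear_map a rho eps : 0 < rho -> continuous (shear a rho eps).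
Proof.
by move=> r0; apply: continuous_shear; exact: smooth_continuous (smooth_slope a eps r0).
Qed.

Lemma shearK a rho eps x : shear a rho (- eps) (shear a rho eps x) = x.
Proof.
have E : slope a rho (- eps) (shear a rho eps x) = - slope a rho eps x.
  by rewrite /slope /shear hyp_shear opprK mulNr opprK.
by rewrite {1}/shear E /shear -addrA -scalerDl subrr scale0r addr0.
Qed.

Lemma test_sheared a rho eps c u : 0 < rho -> 0 <= eps ->
  test_function (ocone a c) u -> test_function (ocone a (c + eps)) (sheared a rho eps u).
Proof.
move=> r0 e0 tu; have [su cu sO] := tu.
set K := closure [set x | u x != 0] in cu sO.
pose K' := shear a rho (- eps) @` K.
have cK' : compact K'.
  apply: continuous_compact => //; apply: continuous_subspaceT.
  exact: continuous_shear_map.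
have KK' x : K (shear a rho eps x) -> K' x.
  by move=> Kx; exists (shear a rho eps x) => //; exact: shearK.
have sub : closure [set x | sheared a rho eps u x != 0] `<=` K'.
  rewrite closureE; apply: smallest_sub.
    by apply: compact_closed => //; exact: norm_hausdorff.
  by move=> x /= nz; apply: KK'; exact: subset_closure.
split.
- exact: (smooth_shear _ su (smooth_slope a eps r0)).
- exact: (subclosed_compact (@closed_closure _ _) cK' sub).
- move=> x /sub[y Ky <-]; apply: (shear_ocone r0 e0).
  by rewrite -{1}(opprK eps) shearK; exact: sO.
Qed.

(** The differential of the shear is I - eps e_a (grad h)^T, of operator norm
    at most 1 + eps; Young's inequality is used with the weight that produces
    this constant. *)
Lemma sqgrad_sheared a rho eps u x : 0 < rho -> 0 < eps -> smooth u ->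
  sqgrad (sheared a rho eps u) x <= (1 + eps) ^+ 2 * sqgrad u (shear a rho eps x).
Proof.
move=> r0 e0 su; set y := shear a rho eps x.
have pE i : partial i (sheared a rho eps u) x =
    partial i u y + (- eps * partial i (hyp a rho) x) * partial a u y.
  have H := is_derive_shear_coord a i x su (smooth_slope a eps r0).
  rewrite /partial (@derive_val _ _ _ _ _ _ _ H) -/(shear a rho eps x) -/y.
  congr (_ + _ * _); rewrite /slope partialM; [|exact: smooth_cst|exact: smooth_hyp].
  by rewrite /partial derive_cst mulr0 addr0.
set G := partial a u y.
have bnd i : (partial i (sheared a rho eps u) x) ^+ 2 <=
    (1 + eps) * partial i u y ^+ 2 +
    (eps + eps ^+ 2) * G ^+ 2 * (partial i (hyp a rho) x) ^+ 2.
  rewrite pE -/G; set A := partial i u y; set B := partial i (hyp a rho) x.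
  have -> : (1 + eps) * A ^+ 2 + (eps + eps ^+ 2) * G ^+ 2 * B ^+ 2 =
    (A + - eps * B * G) ^+ 2 + eps * (A + B * G) ^+ 2 by ring.
  by rewrite lerDl mulr_ge0 ?sqr_ge0// ltW.
apply: (@le_trans _ _ ((1 + eps) * sqgrad u y + (eps + eps ^+ 2) * G ^+ 2)).
  rewrite {1}/sqgrad; apply: (le_trans (ler_sum _ (fun i _ => bnd i))).
  rewrite big_split/= -!mulr_sumr lerD2l ler_piMr ?sum_partial_hyp//.
  by rewrite mulr_ge0 ?sqr_ge0// addr_ge0 ?sqr_ge0// ltW.
have GG : G ^+ 2 <= sqgrad u y by exact: le_sqgrad.
have ee : 0 <= eps + eps ^+ 2 by rewrite addr_ge0 ?sqr_ge0// ltW.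
apply: (le_trans (lerD (lexx _) (ler_wpM2l ee GG))).
by rewrite -mulrDl le_eqVlt; apply/orP; left; apply/eqP; congr (_ * _); ring.
Qed.

Lemma measurable_slope a rho eps : 0 < rho -> measurable_fun setT (slope a rho eps).
Proof.
by move=> r0; apply: continuous_measurable_rV; exact: smooth_continuous (smooth_slope a eps r0).
Qed.

Lemma integral_sheared a rho eps (f : V -> \bar R) : 0 < rho ->
  measurable_fun setT f -> (forall x, 0 <= f x)%E ->
  (\int[leb]_x f (shear a rho eps x) = \int[leb]_x f x)%E.
Proof.
move=> r0 mf f0; rewrite /shear integral_shear//; first exact: measurable_slope.
by move=> t x; exact: slope_upd.
Qed.

Lemma measurable_shear a rho eps : 0 < rho -> measurable_fun setT (shear a rho eps).
Proof.
move=> r0; apply: measurable_fun_coorP => j.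
under eq_fun do rewrite add_coord.
apply: measurable_funD; first exact: measurable_coor.
by apply: measurable_funM => //; exact: measurable_slope.
Qed.

Lemma energy_sheared a rho eps c u : 0 < rho -> 0 < eps -> test_function (ocone a c) u ->
  (energy (sheared a rho eps u) <= ((1 + eps) ^+ 2)%:E * energy u)%E.
Proof.
move=> r0 e0 tu; have su := test_smooth tu.
have e1 : 0 <= (1 + eps) ^+ 2 by exact: sqr_ge0.
have mE : measurable_fun setT (fun x => (sqgrad u x)%:E).
  by apply/measurable_EFinP; exact: measurable_sqgrad.
have E0 x : (0 <= (sqgrad u x)%:E)%E by rewrite lee_fin sqgrad_ge0.
rewrite /energy -(integral_sheared a eps r0 mE E0).
rewrite -(ge0_integralZl_EFin _ measurableT _ _ e1); last 2 first.
- by move=> x _; exact: E0.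
- exact: (measurableT_comp mE (measurable_shear a eps r0)).
apply: le_integralT.
- apply/measurable_EFinP; apply: measurable_sqgrad.
  exact: test_smooth (test_sheared r0 (ltW e0) tu).
- by move=> x; rewrite lee_fin sqgrad_ge0.
- apply: measurable_funeM.
  exact: (measurableT_comp mE (measurable_shear a eps r0)).
- by move=> x; rewrite -EFinM lee_fin; exact: sqgrad_sheared.
Qed.

Lemma enorm_shear a rho eps x : 0 < rho -> 0 < eps -> rho <= enorm (shear a rho eps x) ->
  enorm x <= (1 + 2 * eps) * enorm (shear a rho eps x).
Proof.
move=> r0 e0 re; set y := shear a rho eps x in re *.
have -> : x = y + (eps * hyp a rho x) *: e_ a.
  by rewrite /y /shear /slope -addrA -scalerDl mulNr addNr scale0r addr0.
apply: (le_trans (enorm_axis _ _ _)).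
rewrite ger0_norm; last by rewrite mulr_ge0 ?hyp_ge0// ltW.
have hx : hyp a rho x <= enorm y + enorm y.
  apply: (le_trans (hyp_le a x r0)); apply: lerD => //.
  rewrite -(rad_shear a x (slope a rho eps x)) -/(shear a rho eps x) -/y.
  rewrite -(ler_pXn2r (ltn0Sn 1)) ?nnegrE ?enorm_ge0 ?rad_ge0//.
  by rewrite (enorm_rad a) lerDr sqr_ge0.
rewrite mulrDl mul1r lerD2l -mulrA mulrCA ler_wpM2l ?(ltW e0)//.
by rewrite mulr2n mulrDl mul1r.
Qed.

Context (s kappa alpha beta lambda mu : R) (hN : (3 <= N)%N)
  (hs0 : 0 < s) (hs2 : s < 2) (hlambda : 0 < lambda) (hmu : 0 < mu)
  (hkappa : 0 < kappa) (halpha : 1 < alpha) (hbeta : 1 < beta)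
  (hab : alpha + beta = crit_exp N s).
Local Notation p := (crit_exp N s).
Local Notation den := (S_den [set: V] s kappa alpha beta lambda mu).
Local Notation dens := (@dens R N s kappa alpha beta lambda mu).

(** The shear preserves the volume, so only the weight |x|^-s changes; y being
    the sheared point, |x| <= (1 + 2 eps) |y| as soon as |y| >= rho, which
    holds on the supports. *)
Lemma den_sheared a rho eps c u v : 0 < rho -> 0 < eps ->
  test_function (ocone a c) u -> test_function (ocone a c) v ->
  (forall x, u x != 0 -> rho <= enorm x) -> (forall x, v x != 0 -> rho <= enorm x) ->
  (den u v <= ((1 + 2 * eps) `^ s)%:E *
     den (sheared a rho eps u) (sheared a rho eps v))%E.
Proof.
move=> r0 e0 tu tv hu hv.
have p0 : 0 < p := crit_exp_gt0 halpha hbeta hab.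
have d0 w1 w2 x : 0 <= dens w1 w2 x by exact: (dens_ge0 hlambda hmu hkappa halpha hbeta hab).
have k0 : 0 <= (1 + 2 * eps) `^ s by exact: powR_ge0.
have tu' := test_sheared r0 (ltW e0) tu; have tv' := test_sheared r0 (ltW e0) tv.
have md : measurable_fun setT (fun x => (dens u v x)%:E).
  apply/measurable_EFinP.
  exact: measurable_dens (test_measurable tu) (test_measurable tv).
have md' : measurable_fun setT
    (fun x => (dens (sheared a rho eps u) (sheared a rho eps v) x)%:E).
  apply/measurable_EFinP.
  exact: measurable_dens (test_measurable tu') (test_measurable tv').
rewrite !S_denE -(integral_sheared a eps r0 md); last by move=> x; rewrite lee_fin.
rewrite -(ge0_integralZl_EFin _ measurableT _ md' k0); last by move=> x _; rewrite lee_fin.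
apply: le_integralT.
- exact: (measurableT_comp md (measurable_shear a eps r0)).
- by move=> x; rewrite lee_fin.
- exact: measurable_funeM.
move=> x; rewrite -EFinM lee_fin.
have factor (w1 w2 : V -> R) z : dens w1 w2 z =
  (lambda * `|w1 z| `^ p + mu * `|w2 z| `^ p +
   p * kappa * (`|w1 z| `^ alpha * `|w2 z| `^ beta)) / enorm z `^ s.
  by rewrite /dens; ring.
rewrite !factor /sheared; set y := shear a rho eps x.
set T := _ + _ + _.
have T0 : 0 <= T.
  have pk : 0 <= p * kappa by rewrite mulr_ge0 ?ltW.
  rewrite /T; apply: addr_ge0; first apply: addr_ge0.
  - by apply: mulr_ge0 (ltW hlambda) _; exact: powR_ge0.
  - by apply: mulr_ge0 (ltW hmu) _; exact: powR_ge0.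
  - by apply: mulr_ge0 pk _; apply: mulr_ge0; exact: powR_ge0.
have [nz|z] := boolP ((u y != 0) || (v y != 0)); last first.
  rewrite (_ : T = 0) ?mul0r ?mulr0//.
  move: z; rewrite negb_or !negbK => /andP[/eqP uy /eqP vy].
  have pN : p != 0 by rewrite gt_eqF.
  have aN : alpha != 0 by rewrite gt_eqF// (lt_trans ltr01 halpha).
  by rewrite /T uy vy normr0 (powR0 pN) (powR0 aN) mul0r !mulr0 !addr0.
have cy : ocone a c y by case/orP: nz => [/(test_supp tu)|/(test_supp tv)].
have ry : rho <= enorm y by case/orP: nz => [/hu|/hv].
have x0 : 0 < enorm x by apply: ocone_enorm_gt0 (shear_ocone r0 (ltW e0) cy).
have y0 : 0 < enorm y := lt_le_trans r0 ry.
have xy := enorm_shear r0 e0 ry.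
rewrite mulrCA ler_wpM2l// ler_pdivlMr ?powR_gt0// mulrC ler_pdivrMr ?powR_gt0//.
have e1 : 0 <= 1 + 2 * eps by rewrite addr_ge0// mulr_ge0// ltW.
rewrite -powRM ?(ltW y0)//; apply: ge0_ler_powR; rewrite ?nnegrE ?(ltW hs0) ?(ltW x0)//.
by rewrite mulr_ge0// ltW.
Qed.

(** Continuity of S on the family of circular cones: test functions of the
    cone of slope c are sheared into the cone of slope c + eps, and all
    factors tend to 1 with eps. The exponent of (1 + 2 eps) in the
    denominators is 2 s / p, which is at most 2. *)
Lemma rayleigh_shear a eps c L : 0 < eps -> 0 <= L ->
  rayleigh_ge s kappa alpha beta lambda mu (ocone a (c + eps))
    (((1 + 2 * eps) * (1 + eps)) ^+ 2 * L) ->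
  rayleigh_ge s kappa alpha beta lambda mu (ocone a c) L.
Proof.
move=> e0 L0 H u v tu tv.
have p0 : 0 < p := crit_exp_gt0 halpha hbeta hab.
have p2 : 2 <= p := crit_exp_ge2 halpha hbeta hab.
have p20 : 0 < 2 / p by rewrite divr_gt0.
have [r1 r10 hu] := test_away0 tu; have [r2 r20 hv] := test_away0 tv.
pose rho := Num.min r1 r2.
have r0 : 0 < rho by rewrite lt_min r10.
have hu' x : u x != 0 -> rho <= enorm x by move=> /hu; apply: le_trans; rewrite ge_min lexx.
have hv' x : v x != 0 -> rho <= enorm x.
  by move=> /hv; apply: le_trans; rewrite ge_min lexx orbT.
have tu' := test_sheared r0 (ltW e0) tu; have tv' := test_sheared r0 (ltW e0) tv.
have {}H := H _ _ tu' tv'.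
have Eu := energy_sheared r0 e0 tu; have Ev := energy_sheared r0 e0 tv.
have D := den_sheared r0 e0 tu tv hu' hv'.
set u' := sheared a rho eps u in tu' Eu H D.
set v' := sheared a rho eps v in tv' Ev H D.
have D0 : (0 <= den u v)%E.
  exact: (S_den_ge0 hlambda hmu hkappa halpha hbeta hab).
have D0' : (0 <= den u' v')%E.
  exact: (S_den_ge0 hlambda hmu hkappa halpha hbeta hab).
have e1 : 1 <= 1 + 2 * eps by rewrite lerDl mulr_ge0// ltW.
have D2 : (den u v `^ (2 / p) <= ((1 + 2 * eps) ^+ 2)%:E * den u' v' `^ (2 / p))%E.
  apply: (le_trans (le_poweR (ltW p20) D0 D)).
  rewrite poweRM ?lee_fin ?powR_ge0// poweR_EFin -powRrM.
  apply: lee_wpmul2r; first exact: poweR_ge0.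
  rewrite lee_fin -powR_mulrn; last by rewrite (le_trans ler01).
  apply: ler_powR => //; rewrite mulrA ler_pdivrMr// mulrC ler_pM2l//.
  exact: le_trans (ltW hs2) p2.
have c0 : 0 < (1 + eps) ^+ 2 by rewrite exprn_gt0// ltr_wpDl.
have cL : (0 <= ((1 + eps) ^+ 2 * L)%:E)%E by rewrite lee_fin mulr_ge0 ?(ltW c0).
have E1 : (((1 + eps) ^+ 2)%:E * (L%:E * den u v `^ (2 / p)) <=
    ((1 + eps) ^+ 2)%:E * (energy u + energy v))%E.
  rewrite muleA -EFinM; apply: (le_trans (lee_wpmul2l cL D2)).
  rewrite muleA -EFinM.
  rewrite (_ : _ * L * _ = ((1 + 2 * eps) * (1 + eps)) ^+ 2 * L); last by ring.
  apply: (le_trans H); rewrite muleDr//; last first.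
    by rewrite ge0_adde_def// inE energy_ge0.
  exact: leeD Eu Ev.
move: E1; rewrite lee_pmul2l//.
Qed.

End shear_cone.

(** * Limits of Rayleigh inequalities *)

Section limits_of_rayleigh_inequalities.
Context {R : realType}.
Local Open Scope ereal_scope.

Lemma lt_limn_einf (u : (\bar R)^nat) (l : \bar R) : l < limn_einf u ->
  exists K, forall k, (K <= k)%N -> l < u k.
Proof.
rewrite limn_einf_lim => lu.
have [K _ lK] : exists2 K, True & l < einfs u K.
  have E : limn (einfs u) = ereal_sup (range (einfs u)).
    by apply/cvg_lim => //; exact: cvg_einfs_sup.
  by move: lu; rewrite E => /ereal_sup_gt[_ [K _ <-] lK]; exists K.
exists K => k Kk; apply: (lt_le_trans lK).
by apply: ereal_inf_lbound; exists k.
Qed.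

(** The passage to the limit common to all approximations below: the energies
    of the approximations exceed E by a multiple of eps k, up to a factor 1 +
    t, while Fatou's lemma bounds the limit of the denominators only from
    below. The parameter t comes from Young's inequality, and it is chosen
    after a number strictly between the two sides. *)
Lemma rayleigh_limit (L r : R) (D E : \bar R) (d eps : (\bar R)^nat) :
  (0 <= L)%R -> (0 < r)%R -> 0 <= D -> 0 <= E -> (forall k, 0 <= d k) ->
  (forall k, 0 <= eps k) -> eps @ \oo --> 0 -> D <= limn_einf d ->
  (forall t : R, (0 < t)%R -> forall k,
     L%:E * d k `^ r <= (1 + t)%:E * E + (1 + t^-1)%:E * eps k) ->
  L%:E * D `^ r <= E.
Proof.
move=> L0 r0 D0 E0 d0 eps0 ceps Dd H.
have [->|Ey] := eqVneq E +oo; first exact: leey.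
have Efin : E \is a fin_num by rewrite ge0_fin_numE// ltey.
move: L0; rewrite le_eqVlt => /predU1P[<-|L0]; first by rewrite mul0e.
rewrite leNgt; apply/negP => lt.
(* a real number strictly between E and L D^r *)
have [z [Ez zD]] : exists z : R, E < z%:E /\ z%:E < L%:E * D `^ r.
  case: (L%:E * D `^ r) lt => [y| |]//; rewrite -(fineK Efin).
    rewrite lte_fin => lt; exists ((fine E + y) / 2)%R.
    by rewrite !lte_fin; split; lra.
    by move=> _; exists (fine E + 1)%R; rewrite lte_fin ltry ltrDl.
  by rewrite ltNge leNye.
have z0 : (0 < z)%R by rewrite -lte_fin (le_lt_trans E0).
pose l := ((z / L) `^ r^-1)%R.
have lr : (L * l `^ r = z)%R.
  rewrite /l -powRrM mulVf ?gt_eqF// powRr1 ?divr_ge0 ?ltW//.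
  by rewrite mulrC divfK// gt_eqF.
have lD : l%:E < D.
  rewrite ltNge; apply/negP => Dl; move: zD; rewrite ltNge; apply/negP/negPn.
  rewrite -lr EFinM -poweR_EFin; apply: lee_wpmul2l; first by rewrite lee_fin ltW.
  exact: le_poweR (ltW r0) D0 Dl.
have [K HK] := lt_limn_einf (lt_le_trans lD Dd).
have zk k : (K <= k)%N -> z%:E <= L%:E * d k `^ r.
  move=> /HK/ltW dk; rewrite -lr EFinM -poweR_EFin.
  apply: lee_wpmul2l; first by rewrite lee_fin ltW.
  by apply: le_poweR (ltW r0) _ dk; rewrite lee_fin powR_ge0.
pose e := fine E; have e0 : (0 <= e)%R by exact: fine_ge0.
have eE : E = e%:E by rewrite fineK.
have ez : (e < z)%R by rewrite -lte_fin -eE.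
pose t := ((z - e) / (2 * (e + 1)))%R.
have t0 : (0 < t)%R by rewrite divr_gt0 ?subr_gt0// mulr_gt0// ltr_wpDl.
have te : ((1 + t) * e <= e + (z - e) / 2)%R.
  rewrite mulrDl mul1r lerD2l /t invfM mulrA -mulrA ler_piMr ?divr_ge0 ?subr_ge0 ?(ltW ez)//.
  by rewrite mulrC ler_pdivrMr ?mul1r ?lerDl// ltr_wpDl.
have tt : (0 < 1 + t^-1)%R by rewrite addr_gt0// invr_gt0.
pose w := ((z - e) / 4 / (1 + t^-1))%R.
have w0 : (0 < w)%R by rewrite !divr_gt0// subr_gt0.
have [K' _ HK'] : \forall k \near \oo, eps k < w%:E.
  apply: (ceps [set y | y < w%:E]).
  by apply: open_nbhs_nbhs; split; [exact: open_ereal_lt_ereal|rewrite /= lte_fin].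
pose k := maxn K K'.
have := le_trans (zk k (leq_maxl _ _)) (H t t0 k).
have := HK' k (leq_maxr _ _); rewrite /= => ew.
apply/negP; rewrite -ltNge eE -EFinM.
apply: (@le_lt_trans _ _ (((1 + t) * e)%:E + (1 + t^-1)%:E * w%:E)).
  by apply: leeD => //; apply: lee_wpmul2l (ltW ew); rewrite lee_fin ltW.
rewrite -EFinM -EFinD lte_fin /w [X in (_ + X)%R]mulrC divfK; last by rewrite gt_eqF.
by move: te ez; set T := ((1 + t) * e)%R; lra.
Qed.

Lemma fatou_ae d (T : measurableType d) (mu : {measure set T -> \bar R})
    (D : set T) (f : (T -> \bar R)^nat) (g : T -> \bar R) :
  measurable D -> (forall n, measurable_fun D (f n)) ->
  (forall n x, 0 <= f n x) -> measurable_fun D g -> (forall x, 0 <= g x) ->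
  {ae mu, forall x, D x -> f n x @[n --> \oo] --> g x} ->
  \int[mu]_(x in D) g x <= limn_einf (fun n => \int[mu]_(x in D) f n x).
Proof.
move=> mD mf f0 mg g0 cfg.
apply: le_trans (fatou mu mD mf (fun n x _ => f0 n x)).
rewrite le_eqVlt; apply/orP; left; apply/eqP.
apply: ge0_ae_eq_integral => //.
- have mN : measurable_fun D (fun x => limn_esup (fun n => - f n x)).
    by apply: measurable_fun_limn_esup => n; exact: measurableT_comp.
  exact: measurableT_comp mN.
- move=> x _; rewrite limn_einf_lim; apply: lime_ge.
    by apply: ereal_nondecreasing_is_cvgn; exact: nondecreasing_einfs.
  apply: nearW => n; apply: le_ereal_inf_tmp => _ [m _ <-]; exact: f0.
apply: filterS cfg => x + Dx => /(_ Dx) c.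
by rewrite is_cvg_limn_einfE; [rewrite (cvg_lim _ c)|apply/cvg_ex; exists (g x)].
Qed.

End limits_of_rayleigh_inequalities.

(** * Logarithmic cutoffs near a subspace of codimension two *)

Section energy_facts.
Context {R : realType} {N : nat}.
Local Notation V := 'rV[R]_N.
Local Notation leb := (@lebesgue_rV R N).

Lemma energy_fin Omega (u : V -> R) : test_function Omega u -> energy u \is a fin_num.
Proof.
move=> tu; rewrite ge0_fin_numE ?energy_ge0//.
have mp i : measurable_fun setT (fun x => (partial i u x ^+ 2)%:E).
  apply/measurable_EFinP; apply: measurable_funX.
  exact: test_measurable (test_partial i tu).
have p0 i x : (0 <= (partial i u x ^+ 2)%:E)%E by rewrite lee_fin sqr_ge0.
rewrite /energy; under eq_integral do rewrite -sumEFin.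
rewrite (ge0_integral_sum _ measurableT mp (fun i x _ => p0 i x)).
apply: lte_sum_pinfty => i _.
under eq_integral do rewrite -real_normK ?num_real// -powR_mulrn//.
exact: test_powR_integral_fin (test_partial i tu).
Qed.

End energy_facts.

Section log_cutoff.
Context {R : realType} {N : nat}.
Local Notation V := 'rV[R]_N.
Local Notation leb := (@lebesgue_rV R N).
Local Notation e_ i := (delta_mx ord0 i : V).
Context (a i j : 'I_N) (ia : i != a) (ja : j != a) (ij : i != j).
Implicit Types (x : V) (k m : nat) (u v : V -> R).

(** The squared distance to the subspace x_i = x_j = 0 of codimension two. *)
Definition q2 x : R := x ord0 i * x ord0 i + x ord0 j * x ord0 j.

Lemma q2E x : q2 x = x ord0 i * x ord0 i + x ord0 j * x ord0 j.
Proof. by []. Qed.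

Lemma q2_ge0 x : 0 <= q2 x.
Proof. by rewrite addr_ge0// -expr2 sqr_ge0. Qed.

Lemma smooth_q2 : smooth q2.
Proof.
exact: (smoothD (smoothM (smooth_coord i) (smooth_coord i))
                (smoothM (smooth_coord j) (smooth_coord j))).
Qed.

Lemma partial_q2 l x : partial l q2 x =
  2 * x ord0 i * (l == i)%:R + 2 * x ord0 j * (l == j)%:R.
Proof.
have si := @smooth_coord R N i; have sj := @smooth_coord R N j.
rewrite /q2 partialD; [|exact: smoothM|exact: smoothM].
rewrite !partialM// /partial.
rewrite (@derive_val _ _ _ _ _ _ _ (is_derive_coord l i x)).
rewrite (@derive_val _ _ _ _ _ _ _ (is_derive_coord l j x)).
by ring.
Qed.

Lemma sum_partial_q2 x : \sum_(l < N) partial l q2 x ^+ 2 = 4 * q2 x.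
Proof.
rewrite (bigD1 i)//= (bigD1 j)/=; last by rewrite eq_sym.
rewrite big1 => [|l /andP[li lj]]; last first.
  by rewrite partial_q2 (negbTE li) (negbTE lj) !mulr0 addr0 expr0n.
have ji : (j == i) = false by rewrite eq_sym (negbTE ij).
rewrite !partial_q2 !eqxx ji (negbTE ij) /q2 /= !mulr1 !mulr0 !addr0 add0r.
by ring.
Qed.

Lemma q2_le_rad x : q2 x <= rad a x ^+ 2.
Proof.
rewrite rad_sqr (bigD1 i)//= (bigD1 j)/=; last by rewrite ja eq_sym.
by rewrite /q2 -!expr2 addrA lerDl sumr_ge0// => l _; exact: sqr_ge0.
Qed.

Definition scale m x : R := 4 ^+ m * q2 x.
(** An average of k + 1 cutoffs that vanish near the subspace x_i = x_j = 0,
    one for each of the scales 2^-m. In codimension two their Dirichlet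
    integrals are comparable, and the gradients have disjoint supports:
    averaging divides the energy by k + 1. This is the classical logarithmic
    cutoff, discretised. *)
Definition cutoff k x : R := k.+1%:R^-1 * \sum_(m < k.+1) step (scale m x).

Lemma scaleE m x : scale m x = 4 ^+ m * q2 x.
Proof. by []. Qed.

Lemma cutoffE k :
  cutoff k = fun x => k.+1%:R^-1 * \sum_(m < k.+1) step (scale m x).
Proof. by []. Qed.

Lemma smooth_scale m : smooth (scale m).
Proof. exact: smoothM (smooth_cst _) smooth_q2. Qed.

Lemma smooth_cutoff k : smooth (cutoff k).
Proof.
apply: smoothM; first exact: smooth_cst.
by apply: smooth_sum => m; apply: smooth_step; exact: smooth_scale.
Qed.

Lemma cutoff_ge0 k x : 0 <= cutoff k x.
Proof.
by rewrite mulr_ge0// ?invr_ge0// sumr_ge0// => m _; exact: step_ge0.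
Qed.

Lemma cutoff_le1 k x : cutoff k x <= 1.
Proof.
rewrite /cutoff mulrC ler_pdivrMr// mul1r.
apply: (@le_trans _ _ (\sum_(m < k.+1) (1 : R))).
  by apply: ler_sum => m _; exact: step_le1.
by rewrite sumr_const card_ord.
Qed.

Lemma cutoff_eq0 k x : 4 ^+ k * q2 x <= 1 -> cutoff k x = 0.
Proof.
move=> qk; rewrite /cutoff big1 ?mulr0// => m _; apply: step_le.
apply: le_trans qk; rewrite /scale ler_wpM2r ?q2_ge0//.
by apply: ler_weXn2l; [rewrite ler1n|rewrite -ltnS].
Qed.

Lemma cvg_cutoff x : q2 x != 0 -> cutoff k x @[k --> \oo] --> (1 : R).
Proof.
move=> q0; have qp : 0 < q2 x by rewrite lt0r q0 q2_ge0.
(* all scales beyond m0 contribute 1 *)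
have [m0 Hm0] : exists m0, forall m, (m0 <= m)%N -> step (scale m x) = 1.
  exists (Num.truncn (4 / q2 x)).+1 => m mm; apply: step_ge.
  rewrite /scale -ler_pdivrMr//; apply: (le_trans (ltW (truncnS_gt _))).
  apply: (@le_trans _ _ m%:R); first by rewrite ler_nat.
  rewrite -natrX ler_nat; exact/ltnW/ltn_expl.
have low k : 1 - m0%:R * k.+1%:R^-1 <= cutoff k x.
  rewrite /cutoff -[leLHS]mul1r -{1}(@mulVf _ k.+1%:R)// -mulrA ler_wpM2l//.
  rewrite mulrBr mulr1 mulrCA mulfV// mulr1 lerBlDr -lerBlDl.
  have -> : k.+1%:R - \sum_(m < k.+1) step (scale m x) =
      \sum_(m < k.+1) (1 - step (scale m x)).
    by rewrite sumrB sumr_const card_ord.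
  apply: (@le_trans _ _ (\sum_(m < k.+1) (m < m0)%N%:R)).
    apply: ler_sum => m _; case: ltnP => mm0; last by rewrite Hm0// subrr.
    by rewrite lerBlDr lerDl step_ge0.
  rewrite -natr_sum ler_nat.
  rewrite -(big_mkord xpredT (fun m => nat_of_bool (m < m0)%N)).
  elim: k.+1 => [|n IH]; first by rewrite big_geq.
  rewrite big_nat_recr//=; case: ltnP => nm; last by rewrite addn0.
  rewrite addn1; apply: (leq_trans _ nm); rewrite ltnS.
  apply: (@leq_trans (\sum_(0 <= m < n) 1)%N); last by rewrite sum_nat_const_nat muln1 subn0.
  by apply: leq_sum => m _; exact: leq_b1.
have lim : 1 - m0%:R * k.+1%:R^-1 @[k --> \oo] --> (1 : R).
  rewrite -[X in _ --> X]subr0 -[X in _ --> _ - X](mulr0 m0%:R).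
  apply: cvgB; first exact: cvg_cst.
  by apply: cvgM; [exact: cvg_cst|exact: cvg_harmonic].
apply: (squeeze_cvgr _ lim (cvg_cst (1 : R))).
by apply: nearW => k; rewrite low cutoff_le1.
Qed.

(** The subspace x_i = x_j = 0 contains the a-th axis, so the support of the
    product stays away from this axis. As it is also bounded, it lies in a
    circular cone, of very negative slope. *)
Lemma test_cutoff k u : test_function [set: V] u ->
  exists c, test_function (ocone a c) (fun x => u x * cutoff k x).
Proof.
move=> tu; have [r r0 hr] := test_support_bounded tu.
have tk := testM_r tu (smooth_cutoff k).
pose c := - ((r + 1) * 2 ^+ k); exists c.
have [sk ck _] := tk; split => //.
have cl : closed [set x : V | `|x| <= r /\ 1 <= 4 ^+ k * q2 x].
  apply: closedI.
    apply: (@closed_comp _ _ (fun x : V => `|x|) [set t | t <= r]).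
      by move=> x _; exact: norm_continuous.
    exact: closed_le.
  apply: (@closed_comp _ _ (scale k) [set t | 1 <= t]).
    by move=> x _; exact: (smooth_continuous (smooth_scale k)).
  exact: closed_ge.
have sub : closure [set x | u x * cutoff k x != 0] `<=`
    [set x : V | `|x| <= r /\ 1 <= 4 ^+ k * q2 x].
  rewrite closureE; apply: smallest_sub => // x /=.
  rewrite mulf_eq0 negb_or => /andP[/hr xr nz]; split => //.
  by rewrite leNgt; apply: contra nz => /ltW/cutoff_eq0 ->.
move=> x /sub[xr qx]; rewrite /ocone/=.
have radk : 1 <= 2 ^+ k * rad a x.
  rewrite -(ler_pXn2r (ltn0Sn 1)) ?nnegrE ?mulr_ge0 ?rad_ge0//.
  rewrite expr1n exprMn -exprM mulnC exprM -natrX.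
  by apply: (le_trans qx); rewrite ler_wpM2l// q2_le_rad.
have xa : - r <= x ord0 a.
  have := le_trans (coord_norm_le x a) xr; rewrite ler_norml => /andP[].
  by [].
apply: lt_le_trans xa; rewrite /c mulNr ltrN2 -mulrA.
apply: (@lt_le_trans _ _ (r + 1)); first by rewrite ltrDl.
by rewrite ler_peMr// addr_ge0// ltW.
Qed.

End log_cutoff.

(** * The energy of the logarithmic cutoffs *)

Section cutoff_energy.
Context {R : realType} {N : nat}.
Local Notation V := 'rV[R]_N.
Local Notation leb := (@lebesgue_rV R N).
Context (a i j : 'I_N) (ia : i != a) (ja : j != a) (ij : i != j).
Implicit Types (x : V) (k m : nat) (u v : V -> R).
Local Notation q2 := (@q2 R N i j).
Local Notation scale := (@scale R N i j).
Local Notation cutoff := (@cutoff R N i j).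

Lemma partialZ (c : R) (f : V -> R) l x : smooth f ->
  partial l (fun x => c * f x) x = c * partial l f x.
Proof.
move=> sf; rewrite (partialM _ _ (smooth_cst c) sf).
by rewrite (_ : partial l (fun _ : V => c) x = 0) ?mulr0 ?addr0//; exact: derive_cst.
Qed.

Lemma sqr_sum_disjoint n (b : 'I_n -> R) :
  (forall l l' : 'I_n, l != l' -> b l * b l' = 0) -> (\sum_(l < n) b l) ^+ 2 = \sum_(l < n) b l ^+ 2.
Proof.
move=> H; rewrite expr2 mulr_suml; apply: eq_bigr => l _.
rewrite mulr_sumr (bigD1 l)//= big1 ?addr0// => m ml.
by rewrite H// eq_sym.
Qed.

(** A box that contains the part of the shell 1 < scale m < 4 within the cube
    of radius r. Its measure is of order 4^-m, whereas the squared gradient of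
    the cutoff at scale m is of order 4^m. *)
Definition scale_box (r : R) m : set V :=
  [set x | forall l, `[- (if (l == i) || (l == j) then 2 / 2 ^+ m else r),
                       (if (l == i) || (l == j) then 2 / 2 ^+ m else r)]%classic (x ord0 l)].

Lemma measurable_scale_box r m : measurable (scale_box r m).
Proof.
pose rho l := if (l == i) || (l == j) then 2 / 2 ^+ m else r.
exact: (@measurable_box R N (fun l => `[- rho l, rho l]%classic)
  (fun l => measurable_itv _)).
Qed.

Lemma lebesgue_scale_box r m : 0 < r ->
  leb (scale_box r m) =
    (16 / 4 ^+ m * \prod_(l < N | (l != i) && (l != j)) (2 * r))%:E.
Proof.
move=> r0; pose rho l := if (l == i) || (l == j) then 2 / 2 ^+ m else r.
have rho0 l : 0 < rho l by rewrite /rho; case: ifP => // _; rewrite divr_gt0// exprn_gt0.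
rewrite (@lebesgue_rV_box R N (fun l => `[- rho l, rho l]%classic)
  (fun l => measurable_itv _)).
rewrite (eq_bigr (fun l => (2 * rho l)%:E)); last first.
  move=> l _; rewrite lebesgue_measure_itv/= lte_fin gtrN//.
  by rewrite -EFinB opprK mulr_natl mulr2n.
transitivity ((\prod_(l < N) (2 * rho l))%:E).
  by elim/big_rec2 : _ => // l y1 y2 _ ->.
congr EFin; rewrite (bigD1 i)//= (bigD1 j)/=; last by rewrite eq_sym.
have -> : rho i = 2 / 2 ^+ m by rewrite /rho eqxx.
have -> : rho j = 2 / 2 ^+ m by rewrite /rho eqxx orbT.
rewrite [LHS]mulrA; congr (_ * _).
  have -> : 4 ^+ m = 2 ^+ m * 2 ^+ m :> R by rewrite -exprMn -natrM.
  have : 2 ^+ m != 0 :> R by rewrite expf_neq0.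
  by move: (2 ^+ m : R) => w w0; field.
apply: eq_bigr => l /andP[li lj].
by rewrite /rho (negbTE li) (negbTE lj).
Qed.

Lemma partial_cutoff (g' : R -> R) k (l : 'I_N) x : (forall y : R, is_derive y 1 (@step R) (g' y)) ->
  partial l (cutoff k) x =
  k.+1%:R^-1 * (\sum_(m < k.+1) g' (scale m x) * 4 ^+ m) * partial l q2 x.
Proof.
move=> dg.
have pm m : partial l (fun x => step (scale m x)) x =
    g' (scale m x) * 4 ^+ m * partial l q2 x.
  have ds := smooth_is_derive (@smooth_scale R N i j m) l x.
  have := is_derive_comp1 ds (dg (scale m x)) => H.
  rewrite /partial (@derive_val _ _ _ _ _ _ _ H) -mulrA; congr (_ * _).
  exact: partialZ (smooth_q2 i j).
have ss n : smooth (fun x => \sum_(m < n) step (scale m x)).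
  by apply: smooth_sum => m; apply: smooth_step; exact: smooth_scale.
rewrite cutoffE (partialZ _ _ _ (ss k.+1)) -mulrA; congr (_ * _).
rewrite mulr_suml.
elim: k.+1 => [|n IH].
  rewrite big_ord0 /partial (_ : (fun _ => _) = cst 0) ?derive_cst//.
  by apply/funext => y; rewrite big_ord0.
rewrite big_ord_recr/= -IH -pm.
rewrite -partialD; [|exact: ss|by apply: smooth_step; exact: smooth_scale].
by congr (partial l _ x); apply/funext => y; rewrite big_ord_recr.
Qed.

(** The shells 1 < scale m < 4 are pairwise disjoint, hence the square of the
    sum of the gradients is the sum of the squares. *)
Lemma sqgrad_cutoff : exists2 M : R, 0 <= M & forall k r x, `|x| <= r ->
  sqgrad (cutoff k) x <=
  (k.+1%:R^-1) ^+ 2 * \sum_(m < k.+1) M * 4 ^+ m * \1_(scale_box r m) x.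
Proof.
have [g' dg [M M0 HM]] := @step_derive R.
have dg' (y : R) : is_derive y 1 (@step R) (g' y) by have [] := dg y.
have g0 y : y <= 1 \/ 4 <= y -> g' y = 0 by have [] := dg y.
exists (M ^+ 2 * 16); first by rewrite mulr_ge0 ?sqr_ge0.
move=> k r x xr; have q0 := q2_ge0 i j x.
rewrite /sqgrad; under eq_bigr do rewrite (partial_cutoff k _ x dg') exprMn.
rewrite -mulr_sumr sum_partial_q2// exprMn -mulrA ler_wpM2l ?sqr_ge0//.
rewrite sqr_sum_disjoint; last first.
  move=> l m lm; have [lt1|lt1] := ltP 1 (scale l x); last by rewrite g0 ?mul0r//; left.
  have [lt4|lt4] := leP 4 (scale l x); first by rewrite g0 ?mul0r//; right.
  have [mt1|mt1] := ltP 1 (scale m x); last by rewrite (g0 (scale m x)) ?mul0r ?mulr0//; left.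
  have [mt4|mt4] := leP 4 (scale m x); first by rewrite (g0 (scale m x)) ?mul0r ?mulr0//; right.
  exfalso.
  have aux (n1 n2 : nat) : (n1 < n2)%N -> 1 < scale n1 x -> scale n2 x < 4 -> False.
    move=> n12 h1 h2; have : scale n1 x * 4 <= scale n2 x.
      rewrite !scaleE mulrAC -exprSr ler_wpM2r//.
      by apply: ler_weXn2l => //; rewrite ler1n.
    by move: h1 h2; lra.
  have [lm'|ml'|e] := ltngtP l m; [exact: (aux l m)|exact: (aux m l)|].
  by move/eqP: lm; apply; exact: val_inj.
rewrite mulr_suml; apply: ler_sum => m _.
have [lt1|lt1] := ltP 1 (scale m x); last first.
  by rewrite g0 ?mul0r ?expr0n/= ?mul0r ?mulr_ge0 ?sqr_ge0 ?exprn_ge0//; left.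
have [lt4|lt4] := leP 4 (scale m x).
  by rewrite g0 ?mul0r ?expr0n/= ?mul0r ?mulr_ge0 ?sqr_ge0 ?exprn_ge0//; right.
have box : scale_box r m x.
  move=> l /=; rewrite in_itv/= -ler_norml.
  have c2 z : z * z <= q2 x -> `|z| <= 2 / 2 ^+ m.
    move=> zq; rewrite ler_pdivlMr ?exprn_gt0//.
    rewrite -(ler_pXn2r (ltn0Sn 1)) ?nnegrE ?mulr_ge0 ?exprn_ge0//.
    rewrite exprMn real_normK ?num_real// -exprM mulnC exprM.
    have -> : 2 ^+ 2 = 4 :> R by rewrite -natrX.
    apply: (@le_trans _ _ (scale m x)); last exact: ltW.
    by rewrite scaleE mulrC expr2 ler_wpM2l ?exprn_ge0.
  have [->|li] := eqVneq l i; first by apply: c2; rewrite q2E lerDl -expr2 sqr_ge0.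
  have [->|lj] := eqVneq l j; first by apply: c2; rewrite q2E lerDr -expr2 sqr_ge0.
  by rewrite /= (le_trans (coord_norm_le x l)).
rewrite indicE mem_set// mulr1 exprMn -exprM mulnC exprM.
have gM : g' (scale m x) ^+ 2 <= M ^+ 2.
  by rewrite -real_normK ?num_real// ler_pXn2r ?nnegrE.
have s4 : 4 ^+ m * q2 x <= 4 by exact: ltW.
rewrite (_ : g' (scale m x) ^+ 2 * (4 ^+ 2) ^+ m * (4 * q2 x) =
  g' (scale m x) ^+ 2 * 4 ^+ m * (4 * (4 ^+ m * q2 x))); last first.
  by rewrite -exprM mulnC exprM [(4 ^+ m) ^+ 2]expr2; ring.
have -> : M ^+ 2 * 16 * 4 ^+ m = M ^+ 2 * 4 ^+ m * (4 * 4) by ring.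
have h4 : 0 <= 4 ^+ m :> R by rewrite exprn_ge0.
apply: ler_pM.
- exact: mulr_ge0 (sqr_ge0 _) h4.
- by apply: mulr_ge0 => //; exact: mulr_ge0.
- by rewrite ler_wpM2r.
- by rewrite ler_wpM2l.
Qed.

(** Each scale contributes a bounded amount to the integral of the squared
    gradient of the cutoff, and the average brings the factor 1 / (k + 1)^2
    for k + 1 scales. The product rule is combined with Young's inequality, of
    parameter t, to keep the constant of the main term close to 1. *)
Lemma energy_cutoff u : test_function [set: V] u -> exists2 B : R, 0 <= B &
  forall (t : R) k, 0 < t ->
  (energy (fun x => (u x * cutoff k x)%R) <=
   (1 + t)%:E * energy u + (1 + t^-1)%:E * (B / k.+1%:R)%:E)%E.
Proof.
move=> tu; have su := test_smooth tu.
have [M M0 HM] := sqgrad_cutoff.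
have [r r0 hr] := test_support_bounded tu.
have [U U0 HU] := test_bounded tu.
pose P : R := \prod_(l < N | (l != i) && (l != j)) (2 * r).
have P0 : 0 <= P by apply: prodr_ge0 => l _; rewrite mulr_ge0// ltW.
exists (U ^+ 2 * (M * (16 * P))); first by rewrite !mulr_ge0 ?sqr_ge0.
move=> t k t0.
pose W x := U ^+ 2 * ((k.+1%:R^-1) ^+ 2 * \sum_(m < k.+1) M * 4 ^+ m * \1_(scale_box r m) x).
have sc := @smooth_cutoff R N i j k.
have pw x : sqgrad (fun x => u x * cutoff k x) x <= (1 + t) * sqgrad u x + (1 + t^-1) * W x.
  have pE l : (partial l (fun x => u x * cutoff k x) x) ^+ 2 <=
    (1 + t) * (partial l u x) ^+ 2 + (1 + t^-1) * (u x ^+ 2 * partial l (cutoff k) x ^+ 2).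
    rewrite partialM//; set A := partial l u x; set C := partial l (cutoff k) x.
    set e := cutoff k x.
    have e1 : e ^+ 2 * A ^+ 2 <= A ^+ 2.
      by rewrite ler_piMl ?sqr_ge0// expr_le1// ?cutoff_ge0 ?cutoff_le1.
    have -> : (u x * C + e * A) ^+ 2 = (1 + t) * (e ^+ 2 * A ^+ 2) +
        (1 + t^-1) * (u x ^+ 2 * C ^+ 2) - t * (e * A - t^-1 * (u x * C)) ^+ 2.
      by field; rewrite gt_eqF.
    rewrite lerBlDr; apply: (@le_trans _ _ ((1 + t) * A ^+ 2 + (1 + t^-1) * (u x ^+ 2 * C ^+ 2))).
      by rewrite lerD2r ler_wpM2l// addr_ge0// ltW.
    by rewrite lerDl mulr_ge0 ?sqr_ge0// ltW.
  rewrite /sqgrad; apply: (le_trans (ler_sum _ (fun l _ => pE l))).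
  rewrite big_split/= -!mulr_sumr lerD2l ler_wpM2l//.
    by rewrite addr_ge0// invr_ge0 ltW.
  have W0 : 0 <= (k.+1%:R^-1) ^+ 2 * \sum_(m < k.+1) M * 4 ^+ m * \1_(scale_box r m) x.
    rewrite mulr_ge0 ?sqr_ge0// sumr_ge0// => m _.
    by rewrite !mulr_ge0 ?exprn_ge0.
  have [->|nz] := eqVneq (u x) 0.
    by rewrite expr0n/= mul0r mulr_ge0 ?sqr_ge0.
  apply: ler_pM; rewrite ?sqr_ge0 ?sumr_ge0//.
  - by move=> l _; exact: sqr_ge0.
  - by rewrite -real_normK ?num_real// ler_pXn2r ?nnegrE.
  - exact: HM (hr _ nz).
have mW : measurable_fun setT W.
  apply: measurable_funM => //; apply: measurable_funM => //.
  apply: measurable_sum => m; apply: measurable_funM => //.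
  by apply: measurable_indic; exact: measurable_scale_box.
have W0 x : 0 <= W x.
  rewrite /W mulr_ge0 ?sqr_ge0// mulr_ge0 ?sqr_ge0// sumr_ge0// => m _.
  by rewrite !mulr_ge0 ?exprn_ge0.
have IW : (\int[leb]_x (W x)%:E = (U ^+ 2 * (M * (16 * P)) / k.+1%:R)%:E)%E.
  have K0 : 0 <= U ^+ 2 * (k.+1%:R^-1) ^+ 2 by rewrite mulr_ge0 ?sqr_ge0.
  transitivity (\int[leb]_x ((U ^+ 2 * (k.+1%:R^-1) ^+ 2)%:E *
      \sum_(m < k.+1) ((M * 4 ^+ m)%:E * (\1_(scale_box r m) x)%:E)))%E.
    apply: eq_integral => x _; rewrite /W mulrA EFinM; congr (_ * _)%E.
    by rewrite sumEFin.
  have mI m : measurable_fun setT (fun x => ((M * 4 ^+ m)%:E * (\1_(scale_box r m) x)%:E)%E).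
    apply: measurable_funeM; apply/measurable_EFinP.
    by apply: measurable_indic; exact: measurable_scale_box.
  have I0 m x : (0 <= (M * 4 ^+ m)%:E * (\1_(scale_box r m) x)%:E)%E.
    by rewrite -EFinM lee_fin !mulr_ge0 ?exprn_ge0.
  rewrite (ge0_integralZl_EFin _ measurableT _ _ K0); last 2 first.
  - by move=> x _; apply: sume_ge0 => m _; exact: I0.
  - by apply: emeasurable_sum => m; exact: mI.
  rewrite (ge0_integral_sum _ measurableT (fun m : 'I_k.+1 => mI m)
    (fun (m : 'I_k.+1) x _ => I0 m x)).
  have Im m : (\int[leb]_x ((M * 4 ^+ m)%:E * (\1_(scale_box r m) x)%:E) = (M * (16 * P))%:E)%E.
    have M40 : 0 <= M * 4 ^+ m by rewrite mulr_ge0 ?exprn_ge0.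
    rewrite (ge0_integralZl_EFin _ measurableT _ _ M40); last 2 first.
    - by move=> x _; rewrite lee_fin.
    - by apply/measurable_EFinP; by apply: measurable_indic; exact: measurable_scale_box.
    rewrite integral_indic//; last exact: measurable_scale_box.
    rewrite setIT [X in (_ * X)%E](lebesgue_scale_box m r0) -EFinM -/P; congr EFin.
    have : 4 ^+ m != 0 :> R by rewrite expf_neq0.
    by move: (4 ^+ m : R) => w w0; field.
  under eq_bigr do rewrite Im.
  rewrite sumEFin sumr_const card_ord -EFinM -[(M * _) *+ _]mulr_natr; congr EFin.
  have : k.+1%:R != 0 :> R by rewrite pnatr_eq0.
  by move: (k.+1%:R : R) => w w0; field.
have t1 : 0 <= 1 + t by rewrite addr_ge0// ltW.
have t2 : 0 <= 1 + t^-1 by rewrite addr_ge0// invr_ge0 ltW.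
have mE : measurable_fun setT (fun x => (sqgrad u x)%:E).
  by apply/measurable_EFinP; exact: measurable_sqgrad.
have mWE : measurable_fun setT (fun x => (W x)%:E) by exact/measurable_EFinP.
rewrite -IW /energy.
have WE0 x : (0 <= (W x)%:E)%E by rewrite lee_fin.
rewrite -(ge0_integralZl_EFin _ measurableT (fun x _ => WE0 x) mWE t2).
have E0 x : (0 <= (sqgrad u x)%:E)%E by rewrite lee_fin sqgrad_ge0.
rewrite -(ge0_integralZl_EFin _ measurableT (fun x _ => E0 x) mE t1).
have mE' := measurable_funeM (1 + t)%:E mE.
have mW' := measurable_funeM (1 + t^-1)%:E mWE.
have E0' x : (0 <= (1 + t)%:E * (sqgrad u x)%:E)%E.
  by rewrite -EFinM lee_fin mulr_ge0 ?sqgrad_ge0.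
have W0' x : (0 <= (1 + t^-1)%:E * (W x)%:E)%E by rewrite -EFinM lee_fin mulr_ge0.
rewrite -(ge0_integralD _ measurableT (fun x _ => E0' x) mE' (fun x _ => W0' x) mW').
apply: le_integralT.
- apply/measurable_EFinP; apply: measurable_sqgrad; exact: smoothM.
- by move=> x; rewrite lee_fin sqgrad_ge0.
- exact: emeasurable_funD.
- by move=> x; rewrite -!EFinM -EFinD lee_fin.
Qed.

End cutoff_energy.

(** * From circular cones to the whole space *)

Section rayleigh_of_cones.
Context {R : realType} {N : nat}.
Local Notation V := 'rV[R]_N.
Local Notation leb := (@lebesgue_rV R N).
Context (s kappa alpha beta lambda mu : R) (hN : (3 <= N)%N)
  (hs0 : 0 < s) (hs2 : s < 2) (hlambda : 0 < lambda) (hmu : 0 < mu)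
  (hkappa : 0 < kappa) (halpha : 1 < alpha) (hbeta : 1 < beta)
  (hab : alpha + beta = crit_exp N s).
Local Notation p := (crit_exp N s).
Local Notation den := (S_den [set: V] s kappa alpha beta lambda mu).
Local Notation dens := (@dens R N s kappa alpha beta lambda mu).
Local Notation rayleigh_ge := (@rayleigh_ge R N s kappa alpha beta lambda mu).
Implicit Types (u v : V -> R) (x : V).

Lemma ocone_mono (a : 'I_N) c c' : c <= c' -> ocone a c' `<=` (ocone a c : set V).
Proof.
by move=> cc x; apply: le_lt_trans; rewrite ler_wpM2r ?rad_ge0.
Qed.

Lemma cvg_dens (un vn : nat -> V -> R) u v x :
  un k x @[k --> \oo] --> u x -> vn k x @[k --> \oo] --> v x ->
  dens (un k) (vn k) x @[k --> \oo] --> dens u v x.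
Proof.
move=> cu cv.
have cp (wn : nat -> V -> R) w r : 0 < r -> wn k x @[k --> \oo] --> w x ->
    `|wn k x| `^ r @[k --> \oo] --> `|w x| `^ r.
  by move=> r0 cw; exact: (cvg_comp (fun k => wn k x) (fun y : R => `|y| `^ r) cw
    (@continuous_normr_powR R r r0 (w x))).
have p0 : 0 < p := crit_exp_gt0 halpha hbeta hab.
have cM (f : nat -> R) (b c : R) : f k @[k --> \oo] --> b ->
  f k * c @[k --> \oo] --> b * c by move=> fb; apply: cvgM fb _; exact: cvg_cst.
have cMl (f : nat -> R) (b c : R) : f k @[k --> \oo] --> b ->
  c * f k @[k --> \oo] --> c * b by move=> fb; apply: cvgM _ fb; exact: cvg_cst.
have c1 := cMl _ _ lambda (cM _ _ (enorm x `^ s)^-1 (cp _ _ p p0 cu)).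
have c2 := cMl _ _ mu (cM _ _ (enorm x `^ s)^-1 (cp _ _ p p0 cv)).
have cuv : `|un k x| `^ alpha * `|vn k x| `^ beta @[k --> \oo] -->
    `|u x| `^ alpha * `|v x| `^ beta.
  exact: cvgM (cp _ _ alpha (lt_trans ltr01 halpha) cu) (cp _ _ beta (lt_trans ltr01 hbeta) cv).
have c3 := cMl _ _ (p * kappa) (cM _ _ (enorm x `^ s)^-1 cuv).
exact: cvgD (cvgD c1 c2) c3.
Qed.

Lemma null_hyperplane (i : 'I_N) : leb [set x : V | x ord0 i = 0] = 0%E.
Proof.
pose A (l : 'I_N) : set R := if l == i then [set 0] else setT.
rewrite (_ : mkset _ = [set x : V | forall l, A l (x ord0 l)]); last first.
  apply/seteqP; split => x /=.
    by move=> x0 l; rewrite /A; case: eqP => // ->.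
  by move=> /(_ i); rewrite /A eqxx.
rewrite lebesgue_rV_box; last by move=> l; rewrite /A; case: eqP.
by rewrite (bigD1 i)//= /A eqxx lebesgue_measure_set1 mul0e.
Qed.

Lemma measurable_hyperplane (i : 'I_N) : measurable [set x : V | x ord0 i = 0].
Proof.
rewrite -[X in measurable X]setTI.
exact: (@measurable_coor R N i measurableT [set 0] (measurable_set1 _)).
Qed.

(** The cones exhaust the complement of a half-line as c tends to -oo, and
    this half-line lies in the subspace x_i = x_j = 0, which has codimension
    two and therefore capacity zero: a test function on the whole space is
    approximated by its products with the logarithmic cutoffs. *)
Lemma rayleigh_of_cones (a i j : 'I_N) L : i != a -> j != a -> i != j -> 0 <= L ->
  (forall c, rayleigh_ge (ocone a c) L) -> rayleigh_ge [set: V] L.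
Proof.
move=> ia ja ij L0 H u v tu tv.
have p0 : 0 < p := crit_exp_gt0 halpha hbeta hab.
have p20 : 0 < 2 / p by rewrite divr_gt0.
have [Bu Bu0 HBu] := energy_cutoff ij tu.
have [Bv Bv0 HBv] := energy_cutoff ij tv.
have [Eu Ev] := (energy_ge0 u, energy_ge0 v).
pose un k x := u x * cutoff i j k x; pose vn k x := v x * cutoff i j k x.
have d0 w1 w2 x : 0 <= dens w1 w2 x by exact: (dens_ge0 hlambda hmu hkappa halpha hbeta hab).
have mun k : measurable_fun setT (un k).
  exact: test_measurable (testM_r tu (smooth_cutoff i j k)).
have mvn k : measurable_fun setT (vn k).
  exact: test_measurable (testM_r tv (smooth_cutoff i j k)).
apply: (@rayleigh_limit _ L (2 / p) _ _ (fun k => den (un k) (vn k))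
  (fun k => ((Bu + Bv) * k.+1%:R^-1)%:E)) => //.
- exact: (S_den_ge0 hlambda hmu hkappa halpha hbeta hab).
- exact: adde_ge0 Eu Ev.
- by move=> k; exact: (S_den_ge0 hlambda hmu hkappa halpha hbeta hab).
- by move=> k; rewrite lee_fin mulr_ge0// addr_ge0.
- apply: cvg_EFin; first by apply: nearW.
  rewrite -[X in _ --> X](mulr0 (Bu + Bv)).
  by apply: cvgM; [exact: cvg_cst|exact: cvg_harmonic].
- rewrite S_denE; under [X in limn_einf X]funext => k do rewrite S_denE.
  apply: fatou_ae.
  + exact: measurableT.
  + by move=> k; apply/measurable_EFinP; exact: measurable_dens.
  + by move=> k x; rewrite lee_fin.
  + by apply/measurable_EFinP; apply: measurable_dens; exact: test_measurable tu || exact: test_measurable tv.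
  + by move=> x; rewrite lee_fin.
  exists [set x : V | x ord0 i = 0]; split.
  * exact: measurable_hyperplane.
  * exact: null_hyperplane.
  move=> x /= nc; apply: contrapT => xi; apply: nc => _.
  have q0 : q2 i j x != 0.
    rewrite gt_eqF// q2E ltr_pwDl// -expr2 ?sqr_ge0//.
    by rewrite lt0r sqr_ge0 andbT sqrf_eq0; exact/eqP.
  have cc := cvg_cutoff q0.
  apply: cvg_EFin; first by apply: nearW.
  apply: cvg_dens.
    by rewrite -[X in _ --> X]mulr1; apply: cvgM; [exact: cvg_cst|exact: cc].
  by rewrite -[X in _ --> X]mulr1; apply: cvgM; [exact: cvg_cst|exact: cc].
move=> t t0 k.
have [cu tu'] := test_cutoff ia ja ij k tu.
have [cv tv'] := test_cutoff ia ja ij k tv.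
have mu1 : Num.min cu cv <= cu by rewrite ge_min lexx.
have mv1 : Num.min cu cv <= cv by rewrite ge_min lexx orbT.
apply: (le_trans (H _ _ _ (test_mono (ocone_mono mu1) tu') (test_mono (ocone_mono mv1) tv'))).
apply: (le_trans (leeD (HBu t k t0) (HBv t k t0))).
have E2 : ((1 + t^-1)%:E * (Bu / k.+1%:R)%:E + (1 + t^-1)%:E * (Bv / k.+1%:R)%:E =
    (1 + t^-1)%:E * ((Bu + Bv) * k.+1%:R^-1)%:E)%E.
  by rewrite -!EFinM -EFinD -mulrDr -mulrDl.
by rewrite addeACA E2 -(ge0_muleDr _ Eu Ev) lexx.
Qed.

End rayleigh_of_cones.

(** * Almost everywhere convergence along a subsequence *)

Section ae_subsequence.
Context {R : realType} d (T : measurableType d) (mu : {measure set T -> \bar R}).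

(** Along a suitable subsequence the integrals are summable; then so are the
    functions, at almost every point, and their terms tend to 0. *)
Lemma ae_subsequence (D : set T) (g : nat -> T -> R) : measurable D ->
  (forall k, measurable_fun D (g k)) -> (forall k x, 0 <= g k x) ->
  (fun k => \int[mu]_(x in D) (g k x)%:E)%E @ \oo --> 0%E ->
  exists2 sigma : nat -> nat, (forall k, (k <= sigma k)%N) &
    {ae mu, forall x, D x -> g (sigma k) x @[k --> \oo] --> (0 : R)}.
Proof.
move=> mD mg g0 cg.
pose b k : R := 1 / (2 ^ (k + 1))%:R.
have Hk k : exists n, (k <= n)%N /\ (\int[mu]_(x in D) (g n x)%:E <= (b k)%:E)%E.
  have h0 : 0 < b k by rewrite divr_gt0// ltr0n expn_gt0.
  have [K _ HK] : \forall n \near \oo, (\int[mu]_(x in D) (g n x)%:E < (b k)%:E)%E.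
    apply: (cg [set y | (y < (b k)%:E)%E]).
    by apply: open_nbhs_nbhs; split; [exact: open_ereal_lt_ereal|rewrite /= lte_fin].
  exists (maxn k K); split; first exact: leq_maxl.
  by apply: ltW; apply: HK; exact: leq_maxr.
have [sigma Hs] := choice Hk; exists sigma; first by move=> k; have [] := Hs k.
pose S x := (\sum_(k <oo) (g (sigma k) x)%:E)%E.
have mgs k : measurable_fun D (fun x => (g (sigma k) x)%:E) by exact/measurable_EFinP.
have gs0 k x : (0 <= (g (sigma k) x)%:E)%E by rewrite lee_fin.
have mS : measurable_fun D S.
  by apply: ge0_emeasurable_sum => // k x Dx _; exact: gs0.
have S0 x : (0 <= S x)%E by exact: nneseries_ge0.
have IS : (\int[mu]_(x in D) S x < +oo)%E.
  rewrite /S integral_nneseries//.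
  apply: (@le_lt_trans _ _ (\sum_(k <oo) (b k)%:E)%E).
    apply: lee_nneseries => k _; last by have [] := Hs k.
    by move=> _; exact: integral_ge0.
  by rewrite (cvg_lim _ (@cvg_geometric_eseries_half _ (1 : R) 0))//= ltry.
have intS : mu.-integrable D S.
  by apply/integrableP; split => //; under eq_integral do rewrite gee0_abs//.
apply: filterS (integrable_ae mD intS) => x Sf Dx; have {}Sf := Sf Dx.
apply: (@cvg_series_cvg_0 _ _ (fun k => g (sigma k) x)).
apply: nondecreasing_is_cvgn.
  by apply: nondecreasing_series => k _ _; exact: g0.
exists (fine (S x)) => _ [n _ <-].
rewrite -lee_fin fineK// /series/= -sumEFin.
exact: nneseries_lim_ge.
Qed.

End ae_subsequence.

(** * Admissibility of test functions *)

Section reduction_to_test_functions.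
Context {R : realType} {N : nat}.
Local Notation V := 'rV[R]_N.
Local Notation leb := (@lebesgue_rV R N).
Context (s kappa alpha beta lambda mu : R) (hN : (3 <= N)%N)
  (hs0 : 0 < s) (hs2 : s < 2) (hlambda : 0 < lambda) (hmu : 0 < mu)
  (hkappa : 0 < kappa) (halpha : 1 < alpha) (hbeta : 1 < beta)
  (hab : alpha + beta = crit_exp N s).
Local Notation p := (crit_exp N s).
Local Notation Sden Omega := (@Defs.S_den R N Omega s kappa alpha beta lambda mu).
Local Notation dens := (@dens R N s kappa alpha beta lambda mu).
Local Notation rayleigh_ge := (@rayleigh_ge R N s kappa alpha beta lambda mu).
Local Notation S_cone := (@S_cone R N s kappa alpha beta lambda mu).
Implicit Types (u v : V -> R) (x : V) (Omega : set V) (G H : V -> V).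

Let p0 : 0 < p := crit_exp_gt0 halpha hbeta hab.
Let d0 u v x : 0 <= dens u v x := dens_ge0 hlambda hmu hkappa halpha hbeta hab u v x.

Lemma crit_exp0_gt0 : 0 < crit_exp N (0 : R).
Proof.
rewrite /crit_exp subr0 divr_gt0// ?mulr_gt0// ?ltr0n ?(leq_trans _ hN)//.
by rewrite subr_gt0 (ltr_nat R 2).
Qed.

Lemma enorm_grad u x : enorm (grad u x) ^+ 2 = sqgrad u x.
Proof. by rewrite enorm_sqr /sqgrad; apply: eq_bigr => i _; rewrite mxE. Qed.

Lemma enorm0_eq : enorm (0 : V) = 0.
Proof. by rewrite enormE big1 ?sqrtr0// => i _; rewrite mxE expr0n. Qed.

Lemma integral_supported Omega (f : V -> R) : (forall x, ~ Omega x -> f x = 0) ->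
  (\int[leb]_(x in Omega) (f x)%:E = \int[leb]_x (f x)%:E)%E.
Proof.
move=> f0; rewrite integral_mkcond; apply: eq_integral => x _.
by rewrite patchE; case: ifPn => // /negP xO; rewrite f0// => Ox; apply: xO; rewrite inE.
Qed.

Lemma sqgrad_supported Omega u x : test_function Omega u -> ~ Omega x -> sqgrad u x = 0.
Proof.
move=> tu nx; rewrite /sqgrad big1// => i _.
by rewrite (test_zero (test_partial i tu) nx) expr0n.
Qed.

Lemma dens_supported Omega u v x : test_function Omega u -> test_function Omega v ->
  ~ Omega x -> dens u v x = 0.
Proof.
move=> tu tv nx; rewrite densE (test_zero tu nx) (test_zero tv nx) normr0.
rewrite (powR0 (lt0r_neq0 p0)) (powR0 (lt0r_neq0 (lt_trans ltr01 halpha))).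
by rewrite !mul0r !mulr0 !addr0.
Qed.

Lemma energy_supported Omega u : test_function Omega u ->
  (\int[leb]_(x in Omega) (sqgrad u x)%:E = energy u)%E.
Proof. by move=> tu; apply: integral_supported => x; exact: sqgrad_supported. Qed.

Lemma S_den_supported Omega u v : test_function Omega u -> test_function Omega v ->
  Sden Omega u v = Sden setT u v.
Proof. by move=> tu tv; apply: integral_supported => x; exact: dens_supported. Qed.

Lemma S_num_supported Omega u v : measurable Omega ->
  test_function Omega u -> test_function Omega v ->
  S_num Omega (grad u) (grad v) = (energy u + energy v)%E.
Proof.
move=> mO tu tv; rewrite /S_num -(energy_supported tu) -(energy_supported tv).
have me w : test_function Omega w -> measurable_fun Omega (fun x => (sqgrad w x)%:E).
  move=> tw; apply/measurable_EFinP; apply: measurable_funTS.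
  exact: measurable_sqgrad (test_smooth tw).
have e0 w x : (0 <= (sqgrad w x)%:E)%E by rewrite lee_fin sqgrad_ge0.
rewrite -(ge0_integralD _ mO (fun x _ => e0 u x) (me _ tu) (fun x _ => e0 v x) (me _ tv)).
by apply: eq_integral => x _; rewrite !enorm_grad EFinD.
Qed.

Lemma test_D012 Omega u : test_function Omega u -> D012 Omega u (grad u).
Proof.
move=> tu; split.
- by apply: measurable_funTS; exact: test_measurable tu.
- move=> i; under eq_fun do rewrite mxE.
  by apply: measurable_funTS; exact: test_measurable (test_partial i tu).
exists (fun=> u); split => //.
  under eq_fun do under eq_integral do rewrite subrr enorm0_eq expr0n/=.
  by under eq_fun do rewrite integral0; exact: cvg_cst.
under eq_fun do under eq_integral do
  rewrite subrr normr0 (powR0 (lt0r_neq0 crit_exp0_gt0)).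
by under eq_fun do rewrite integral0; exact: cvg_cst.
Qed.

(** Almost every point lies off a hyperplane, where the weight is positive;
    the three terms of the density are nonnegative and must then all vanish. *)
Lemma S_den_eq0 Omega u v : measurable Omega -> measurable_fun Omega u ->
  measurable_fun Omega v ->
  Sden Omega u v = 0%E <-> {ae leb, forall x, Omega x -> u x = 0 /\ v x = 0}.
Proof.
move=> mO mu' mv.
have md : measurable_fun Omega (fun x => (dens u v x)%:E).
  by apply/measurable_EFinP; exact: measurable_dens.
have absE : (\int[leb]_(x in Omega) `|(dens u v x)%:E|)%E = Sden Omega u v.
  by rewrite S_denE; apply: eq_integral => x _; rewrite gee0_abs// lee_fin.
have := ae_eq_integral_abs leb mO md; rewrite absE => -[H1 H2]; split.
  move=> /H1 ae0.
  have [i _] : exists i : 'I_N, True by exists (Ordinal (leq_trans (isT : (0 < 3)%N) hN)).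
  have aex : {ae leb, forall x : V, x ord0 i != 0}.
    exists [set x : V | x ord0 i = 0]; split.
    - exact: measurable_hyperplane.
    - exact: null_hyperplane.
    - by move=> x /= /negP; rewrite negbK => /eqP.
  apply: filterS2 ae0 aex => x h xi Ox.
  have := h Ox => -[]; rewrite densE.
  have x0 : 0 < enorm x.
    by apply: lt_le_trans (enorm_coord x i); rewrite normr_gt0.
  have w0 : 0 < enorm x `^ s by rewrite powR_gt0.
  have [a1 a2] : 0 <= lambda * (`|u x| `^ p / enorm x `^ s) /\
     0 <= mu * (`|v x| `^ p / enorm x `^ s).
    by rewrite !mulr_ge0 ?powR_ge0 ?invr_ge0 ?powR_ge0 ?(ltW hlambda) ?(ltW hmu).
  have a3 : 0 <= p * kappa * (`|u x| `^ alpha * `|v x| `^ beta / enorm x `^ s).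
    apply: mulr_ge0; first exact: mulr_ge0 (ltW p0) (ltW hkappa).
    by apply: mulr_ge0; rewrite ?invr_ge0 ?powR_ge0// mulr_ge0// powR_ge0.
  move=> E; have z1 : lambda * (`|u x| `^ p / enorm x `^ s) = 0 by lra.
  have z2 : mu * (`|v x| `^ p / enorm x `^ s) = 0 by lra.
  have aux (c w : R) : 0 < c -> c * (`|w| `^ p / enorm x `^ s) = 0 -> w = 0.
    move=> c0 /eqP; rewrite mulf_eq0 (gt_eqF c0)/= mulf_eq0 invr_eq0 (gt_eqF w0) orbF.
    by rewrite powR_eq0 normr_eq0 => /andP[/eqP].
  by split; [exact: aux hlambda z1|exact: aux hmu z2].
move=> ae0; apply: H2; apply: filterS ae0 => x h Ox.
have [ux vx] := h Ox; rewrite densE ux vx normr0 (powR0 (lt0r_neq0 p0)).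
rewrite (powR0 (lt0r_neq0 (lt_trans ltr01 halpha))).
by rewrite !mul0r !mulr0 !addr0.
Qed.

(** Test functions, with their gradients, are admissible in the infimum. *)
Lemma rayleigh_of_S_cone Omega L : open Omega -> 0 <= L ->
  (L%:E <= S_cone Omega)%E -> rayleigh_ge Omega L.
Proof.
move=> oO L0 LS u v tu tv.
have mO := open_measurable_rV oO.
have [Eu Ev] := (energy_ge0 u, energy_ge0 v).
have E0 := adde_ge0 Eu Ev.
have r0 : 0 < 2 / p by rewrite divr_gt0.
have D0 : (0 <= Sden setT u v)%E by exact: (S_den_ge0 hlambda hmu hkappa halpha hbeta hab).
have [Dz|Dz] := eqVneq (Sden setT u v) 0%E.
  by rewrite Dz (poweR0r (lt0r_neq0 r0)) mule0.
have q : (L%:E <= (energy u + energy v) / Sden setT u v `^ (2 / p))%E.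
  apply: (le_trans LS); apply: ereal_inf_lbound.
  exists u, v, (grad u), (grad v); split.
  - exact: test_D012.
  - exact: test_D012.
  - have mu' : measurable_fun Omega u by apply: measurable_funTS; exact: test_measurable tu.
    have mv : measurable_fun Omega v by apply: measurable_funTS; exact: test_measurable tv.
    by move=> /(S_den_eq0 mO mu' mv); rewrite (S_den_supported tu tv); apply/eqP.
  - by rewrite (S_num_supported mO tu tv) (S_den_supported tu tv).
have Dp : (0 < Sden setT u v `^ (2 / p))%E by rewrite poweR_gt0// lt0e Dz.
move: q Dp; case: (Sden setT u v `^ (2 / p))%E => [y| |]//.
  rewrite lte_fin => q y0; move: q; rewrite inver gt_eqF// => q.
  rewrite -lee_pdivlMr//.
(* an infinite denominator makes the quotient equal to 0 and forces L = 0 *)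
rewrite invey mule0 lee_fin => Lle _.
by rewrite (le_anti (introT andP (conj Lle L0))) mul0e.
Qed.

End reduction_to_test_functions.

(** * From test functions to the completion *)

Section passage_to_the_completion.
Context {R : realType} {N : nat}.
Local Notation V := 'rV[R]_N.
Local Notation leb := (@lebesgue_rV R N).
Context (s kappa alpha beta lambda mu : R) (hN : (3 <= N)%N)
  (hs0 : 0 < s) (hs2 : s < 2) (hlambda : 0 < lambda) (hmu : 0 < mu)
  (hkappa : 0 < kappa) (halpha : 1 < alpha) (hbeta : 1 < beta)
  (hab : alpha + beta = crit_exp N s).
Local Notation p := (crit_exp N s).
Local Notation Sden Omega := (@Defs.S_den R N Omega s kappa alpha beta lambda mu).
Local Notation dens := (@dens R N s kappa alpha beta lambda mu).
Local Notation rayleigh_ge := (@rayleigh_ge R N s kappa alpha beta lambda mu).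
Local Notation S_cone := (@S_cone R N s kappa alpha beta lambda mu).
Implicit Types (u v : V -> R) (x : V) (Omega : set V) (G H F : V -> V).

Let p0 : 0 < p := crit_exp_gt0 halpha hbeta hab.
Let d0 u v x : 0 <= dens u v x := dens_ge0 hlambda hmu hkappa halpha hbeta hab u v x.

(** Young's inequality; the difference of the two sides is a square. *)
Lemma ler_sqr_split (t a b : R) : 0 < t ->
  a ^+ 2 <= (1 + t) * b ^+ 2 + (1 + t^-1) * (a - b) ^+ 2.
Proof.
move=> t0; have tn : t != 0 by rewrite gt_eqF.
rewrite -subr_ge0 (_ : _ - _ = t * (b - (a - b) / t) ^+ 2); last by field.
by rewrite mulr_ge0 ?sqr_ge0// ltW.
Qed.

Lemma enorm_sqr_split (t : R) (y z : V) : 0 < t ->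
  enorm y ^+ 2 <= (1 + t) * enorm z ^+ 2 + (1 + t^-1) * enorm (y - z) ^+ 2.
Proof.
move=> t0; rewrite !enorm_sqr !mulr_sumr -big_split/=; apply: ler_sum => i _.
by rewrite !mxE; exact: ler_sqr_split.
Qed.

Lemma enorm_distC (y z : V) : enorm (y - z) = enorm (z - y).
Proof. by rewrite !enormE; congr Num.sqrt; apply: eq_bigr => i _; rewrite !mxE -sqrrN opprB. Qed.

Lemma measurable_enorm_sqr Omega F :
  (forall i, measurable_fun Omega (fun x => F x ord0 i)) ->
  measurable_fun Omega (fun x => (enorm (F x) ^+ 2)%:E).
Proof.
move=> mF; apply/measurable_EFinP; under eq_fun do rewrite enorm_sqr.
by apply: measurable_sum => i; apply: measurable_funX; exact: mF.
Qed.

Lemma integral_enorm_sqr_split Omega F G (t : R) : measurable Omega -> 0 < t ->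
  (forall i, measurable_fun Omega (fun x => F x ord0 i)) ->
  (forall i, measurable_fun Omega (fun x => G x ord0 i)) ->
  (\int[leb]_(x in Omega) (enorm (F x) ^+ 2)%:E <=
   (1 + t)%:E * (\int[leb]_(x in Omega) (enorm (G x) ^+ 2)%:E) +
   (1 + t^-1)%:E * (\int[leb]_(x in Omega) (enorm (F x - G x) ^+ 2)%:E))%E.
Proof.
move=> mO t0 mF mG.
have mFG i : measurable_fun Omega (fun x => (F x - G x) ord0 i).
  by under eq_fun do rewrite !mxE; exact: measurable_funB.
have [mf mg mh] := And3 (measurable_enorm_sqr mF) (measurable_enorm_sqr mG)
  (measurable_enorm_sqr mFG).
have e0 K x : (0 <= (enorm (K x : V) ^+ 2)%:E)%E by rewrite lee_fin sqr_ge0.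
have t1 : 0 <= 1 + t by rewrite addr_ge0// ltW.
have t2 : 0 <= 1 + t^-1 by rewrite addr_ge0// invr_ge0 ltW.
rewrite -(ge0_integralZl_EFin _ mO (fun x _ => e0 G x) mg t1).
rewrite -(ge0_integralZl_EFin _ mO (fun x _ => e0 (fun x => F x - G x) x) mh t2).
have k0 (c : R) K x : 0 <= c -> (0 <= c%:E * (enorm (K x : V) ^+ 2)%:E)%E.
  by move=> c0; rewrite mule_ge0.
rewrite -(ge0_integralD _ mO (fun x _ => k0 _ G x t1) (measurable_funeM _ mg)
  (fun x _ => k0 _ (fun x => F x - G x) x t2) (measurable_funeM _ mh)).
apply: ge0_le_integral => //.
- by apply: emeasurable_funD; exact: measurable_funeM.
by move=> x _; rewrite -!EFinM -EFinD lee_fin; exact: enorm_sqr_split.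
Qed.

Lemma integral_grad_sqr Omega u : test_function Omega u ->
  (\int[leb]_(x in Omega) (enorm (grad u x) ^+ 2)%:E = energy u)%E.
Proof.
move=> tu; rewrite -(energy_supported tu); apply: eq_integral => x _.
by rewrite enorm_grad.
Qed.

Lemma measurable_grad Omega u i : test_function Omega u ->
  measurable_fun Omega (fun x => grad u x ord0 i).
Proof.
move=> tu; under eq_fun do rewrite mxE.
by apply: measurable_funTS; exact: test_measurable (test_partial i tu).
Qed.

(** The gradient is at a finite distance in L^2 from the gradient of a test
    function, whose energy is finite. *)
Lemma gradient_energy_fin Omega u G : measurable Omega -> D012 Omega u G ->
  (\int[leb]_(x in Omega) (enorm (G x) ^+ 2)%:E < +oo)%E.
Proof.
move=> mO [_ mG [phi [tphi cG _]]].
have [K _ HK] : \forall n \near \oo, (\int[leb]_(x in Omega)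
    (enorm (grad (phi n) x - G x) ^+ 2)%:E < 1%:E)%E.
  apply: (cG [set y | (y < 1%:E)%E]).
  by apply: open_nbhs_nbhs; split; [exact: open_ereal_lt_ereal|rewrite /= lte_fin].
have := HK K (leqnn _); rewrite /= => HK1.
apply: (le_lt_trans (integral_enorm_sqr_split mO ltr01 mG (fun i => measurable_grad i (tphi K)))).
rewrite integral_grad_sqr//.
have -> : (\int[leb]_(x in Omega) (enorm (G x - grad (phi K) x) ^+ 2)%:E =
    \int[leb]_(x in Omega) (enorm (grad (phi K) x - G x) ^+ 2)%:E)%E.
  by apply: eq_integral => x _; rewrite enorm_distC.
have := energy_fin (tphi K); case: (energy _) => // y _.
have : (0 <= \int[leb]_(x in Omega) (enorm (grad (phi K) x - G x) ^+ 2)%:E)%E.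
  by apply: integral_ge0 => x _; rewrite lee_fin sqr_ge0.
case: (\int[leb]_(x in Omega) _)%E HK1 => // z _ _.
by rewrite -!EFinM -EFinD ltry.
Qed.

Lemma powR_cvg0 (f : nat -> R) (r : R) : 0 < r ->
  `|f k| `^ r @[k --> \oo] --> (0 : R) -> f k @[k --> \oo] --> (0 : R).
Proof.
move=> r0 cf; apply/norm_cvg0P.
have ri0 : 0 < r^-1 by rewrite invr_gt0.
have c := (cvg_comp (fun k => `|f k| `^ r) (fun y : R => `|y| `^ r^-1) cf
    (@continuous_normr_powR R r^-1 ri0 0)).
move: c; rewrite /comp/= normr0 (powR0 (lt0r_neq0 ri0)).
under eq_fun => k do rewrite (ger0_norm (powR_ge0 _ _)) -powRrM mulfV ?gt_eqF// powRr1//.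
exact.
Qed.

Lemma cvgeD0 (a b : nat -> \bar R) : a @ \oo --> 0%E -> b @ \oo --> 0%E ->
  (fun k => a k + b k)%E @ \oo --> 0%E.
Proof.
by move=> ca cb; rewrite -[X in _ --> X](adde0 (0 : \bar R)); apply: cvgeD.
Qed.

(** Convergence in the Lebesgue space of the Sobolev exponent yields
    convergence almost everywhere along a subsequence; the sum of the two
    distances is used so that the subsequence is common to both components. *)
Lemma test_approximation Omega u v G H : measurable Omega ->
  D012 Omega u G -> D012 Omega v H ->
  exists phi psi : nat -> V -> R,
   [/\ forall k, test_function Omega (phi k), forall k, test_function Omega (psi k),
     {ae leb, forall x, Omega x -> phi k x @[k --> \oo] --> u x},
     {ae leb, forall x, Omega x -> psi k x @[k --> \oo] --> v x} &
     (fun k => \int[leb]_(x in Omega) (enorm (grad (phi k) x - G x) ^+ 2)%:E +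
       \int[leb]_(x in Omega) (enorm (grad (psi k) x - H x) ^+ 2)%:E)%E @ \oo --> 0%E].
Proof.
move=> mO [mu' mG [phi [tphi cG cu]]] [mv mH [psi [tpsi cH cv]]].
set q := crit_exp N 0 in cu cv.
have q0 : 0 < q by exact: crit_exp0_gt0.
pose f k x : R := `|phi k x - u x| `^ q; pose h k x : R := `|psi k x - v x| `^ q.
have mf (w : nat -> V -> R) (z : V -> R) k : test_function Omega (w k) -> measurable_fun Omega z ->
    measurable_fun Omega (fun x => `|w k x - z x| `^ q).
  move=> tw mz; apply: measurable_normr_powR; apply: measurable_funB => //.
  by apply: measurable_funTS; exact: test_measurable tw.
have cs : (fun k => \int[leb]_(x in Omega) (f k x + h k x)%:E)%E @ \oo --> 0%E.
  have E k : (\int[leb]_(x in Omega) (f k x + h k x)%:E =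
     \int[leb]_(x in Omega) (f k x)%:E + \int[leb]_(x in Omega) (h k x)%:E)%E.
    rewrite -(ge0_integralD _ mO).
    - by apply: eq_integral => x _; rewrite EFinD.
    - by move=> x _; rewrite lee_fin powR_ge0.
    - by apply/measurable_EFinP; exact: mf.
    - by move=> x _; rewrite lee_fin powR_ge0.
    - by apply/measurable_EFinP; exact: mf.
  rewrite (_ : (fun k => _) = (fun k => \int[leb]_(x in Omega) (f k x)%:E +
     \int[leb]_(x in Omega) (h k x)%:E)%E); last exact/funext.
  exact: (cvgeD0 cu cv).
have mfh k : measurable_fun Omega (fun x => f k x + h k x).
  by apply: measurable_funD; exact: mf.
have fh0 k x : 0 <= f k x + h k x by rewrite addr_ge0// powR_ge0.
have [sigma les aes] := ae_subsequence mO mfh fh0 cs.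
have cvs : sigma k @[k --> \oo] --> \oo.
  by move=> A [n _ nA]; exists n => // k nk; apply: nA; exact: leq_trans nk (les k).
exists (phi \o sigma), (psi \o sigma); split.
- by move=> k; exact: tphi.
- by move=> k; exact: tpsi.
- apply: filterS aes => x + Ox => /(_ Ox) c; apply/subr_cvg0/(powR_cvg0 q0).
  apply: (squeeze_cvgr _ (cvg_cst 0) c).
  by apply: nearW => k; rewrite powR_ge0/= lerDl powR_ge0.
- apply: filterS aes => x + Ox => /(_ Ox) c; apply/subr_cvg0/(powR_cvg0 q0).
  apply: (squeeze_cvgr _ (cvg_cst 0) c).
  by apply: nearW => k; rewrite powR_ge0/= lerDr powR_ge0.
- exact: (cvgeD0 (cvg_comp sigma _ cvs cG) (cvg_comp sigma _ cvs cH)).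
Qed.

Lemma S_numE Omega G H : measurable Omega ->
  (forall i, measurable_fun Omega (fun x => G x ord0 i)) ->
  (forall i, measurable_fun Omega (fun x => H x ord0 i)) ->
  (S_num Omega G H = \int[leb]_(x in Omega) (enorm (G x) ^+ 2)%:E +
     \int[leb]_(x in Omega) (enorm (H x) ^+ 2)%:E)%E.
Proof.
move=> mO mG mH; have e0 F x : (0 <= (enorm (F x) ^+ 2)%:E)%E by rewrite lee_fin sqr_ge0.
rewrite -(ge0_integralD _ mO (fun x _ => e0 G x) (measurable_enorm_sqr mG)
  (fun x _ => e0 H x) (measurable_enorm_sqr mH)).
by apply: eq_integral => x _; rewrite EFinD.
Qed.

(** The energies of the approximating test functions converge, and Fatou's
    lemma bounds the denominator of the limit. *)
Lemma rayleigh_completion Omega L u v G H : open Omega -> 0 <= L ->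
  rayleigh_ge Omega L -> D012 Omega u G -> D012 Omega v H ->
  (L%:E * Sden Omega u v `^ (2 / p) <= S_num Omega G H)%E.
Proof.
move=> oO L0 ray DG DH; have mO := open_measurable_rV oO.
have r0 : 0 < 2 / p by rewrite divr_gt0.
have [phi [psi [tphi tpsi cphi cpsi ceps]]] := test_approximation mO DG DH.
have [mu' mG _] := DG; have [mv mH _] := DH.
have I0 F : (0 <= \int[leb]_(x in Omega) (enorm (F x) ^+ 2)%:E)%E.
  by apply: integral_ge0 => x _; rewrite lee_fin sqr_ge0.
rewrite (S_numE mO mG mH).
apply: (@rayleigh_limit _ L (2 / p) _ _ (fun k => Sden setT (phi k) (psi k)) _
  L0 r0 (S_den_ge0 hlambda hmu hkappa halpha hbeta hab Omega u v)
  (adde_ge0 (I0 G) (I0 H))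
  (fun k => S_den_ge0 hlambda hmu hkappa halpha hbeta hab setT (phi k) (psi k))
  (fun k => adde_ge0 (I0 (fun x => grad (phi k) x - G x))
                     (I0 (fun x => grad (psi k) x - H x)))
  ceps).
- under [X in limn_einf X]funext => k do rewrite -(S_den_supported kappa lambda mu halpha hbeta hab (tphi k) (tpsi k)).
  rewrite S_denE; under [X in limn_einf X]funext => k do rewrite S_denE.
  apply: fatou_ae.
  + exact: mO.
  + move=> k; apply/measurable_EFinP; apply: measurable_dens; apply: measurable_funTS.
      exact: test_measurable (tphi k).
    exact: test_measurable (tpsi k).
  + by move=> k x; rewrite lee_fin.
  + by apply/measurable_EFinP; exact: measurable_dens.
  + by move=> x; rewrite lee_fin.
  apply: filterS2 cphi cpsi => x cu cv Ox.
  apply: cvg_EFin; first by apply: nearW.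
  exact: (cvg_dens halpha hbeta hab (cu Ox) (cv Ox)).
move=> t t0 k; apply: (le_trans (ray _ _ (tphi k) (tpsi k))).
rewrite -(integral_grad_sqr (tphi k)) -(integral_grad_sqr (tpsi k)).
have h1 := integral_enorm_sqr_split mO t0 (fun i => measurable_grad i (tphi k)) mG.
have h2 := integral_enorm_sqr_split mO t0 (fun i => measurable_grad i (tpsi k)) mH.
apply: (le_trans (leeD h1 h2)).
rewrite addeACA -(ge0_muleDr _ (I0 G) (I0 H)).
by rewrite -(ge0_muleDr _ (I0 (fun x => grad (phi k) x - G x)) (I0 (fun x => grad (psi k) x - H x))) lexx.
Qed.

(** Division by the denominator, which is positive since (u, v) is not zero
    almost everywhere. *)
Lemma S_cone_of_rayleigh Omega L : open Omega -> 0 <= L ->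
  rayleigh_ge Omega L -> (L%:E <= S_cone Omega)%E.
Proof.
move=> oO L0 ray; have mO := open_measurable_rV oO.
apply: le_ereal_inf_tmp => _ [u [v [G [H [DG DH nz ->]]]]].
have le := rayleigh_completion oO L0 ray DG DH.
have [mu' mG _] := DG; have [mv mH _] := DH.
have D0 : (0 <= Sden Omega u v)%E by exact: (S_den_ge0 hlambda hmu hkappa halpha hbeta hab).
have Dp : (0 < Sden Omega u v `^ (2 / p))%E.
  rewrite poweR_gt0// lt0e D0 andbT; apply/eqP => Dz; apply: nz.
  by apply/(S_den_eq0 hN hlambda hmu hkappa halpha hbeta hab mO mu' mv).
have Nf : (S_num Omega G H < +oo)%E.
  by rewrite (S_numE mO mG mH); apply: lte_add_pinfty;
    [exact: gradient_energy_fin DG|exact: gradient_energy_fin DH].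
have N0 : (0 <= S_num Omega G H)%E.
  by apply: integral_ge0 => x _; rewrite lee_fin addr_ge0// sqr_ge0.
move: le Dp Nf N0; case: (Sden Omega u v `^ (2 / p))%E => [y| |]//.
  rewrite lte_fin => + y0; rewrite inver gt_eqF// => h _ _.
  by rewrite lee_pdivlMr.
(* an infinite denominator is excluded by the finiteness of the energy when
   L > 0, and the quotient is 0 when L = 0 *)
have [L00|L00] := eqVneq L 0; first by rewrite L00 invey mule0.
have Lp : (0 < L%:E)%E by rewrite lte_fin lt0r L00 L0.
rewrite (gt0_muley Lp).
by rewrite leye_eq => /eqP ->.
Qed.

End passage_to_the_completion.

(** * Circular cones are admissible domains *)

Section admissible_cones.
Context {R : realType} {N : nat}.
Local Notation V := 'rV[R]_N.
Implicit Types (a : 'I_N) (x y z : V) (c : R) (A : set V).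
Local Notation e_ i := (delta_mx ord0 i : V).

Lemma rad_axis a t : rad a (t *: e_ a) = 0.
Proof.
rewrite /rad big1 ?sqrtr0// => j ja.
by rewrite !mxE eqxx (negbTE ja) mulr0 expr0n.
Qed.

Lemma rad_scale a (t : R) x : 0 <= t -> rad a (t *: x) = t * rad a x.
Proof.
move=> t0; rewrite /rad; under eq_bigr do rewrite mxE exprMn.
by rewrite -mulr_sumr sqrtrM ?sqr_ge0// sqrtr_sqr ger0_norm.
Qed.

(** Young's inequality with the optimal weight is the triangle inequality;
    adding e to both terms keeps this weight positive and finite. *)
Lemma rad_triangle a x y : rad a x <= rad a y + rad a (x - y).
Proof.
apply/ler_addgt0Pr => d d0; pose e := d / 2.
have e0 : 0 < e by rewrite divr_gt0.
pose b := rad a y + e; pose b' := rad a (x - y) + e.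
have b0 : 0 < b by rewrite ltr_wpDl// rad_ge0.
have b'0 : 0 < b' by rewrite ltr_wpDl// rad_ge0.
suff : rad a x <= b + b' by rewrite /b /b' /e; lra.
rewrite -(ler_pXn2r (ltn0Sn 1)) ?nnegrE ?rad_ge0 ?(ltW (addr_gt0 b0 b'0))//.
pose t := b' / b; have t0 : 0 < t by rewrite divr_gt0.
apply: (@le_trans _ _ ((1 + t) * rad a y ^+ 2 + (1 + t^-1) * rad a (x - y) ^+ 2)).
  rewrite !rad_sqr !mulr_sumr -big_split/=; apply: ler_sum => j _.
  by rewrite !mxE; exact: ler_sqr_split.
have -> : (b + b') ^+ 2 = (1 + t) * b ^+ 2 + (1 + t^-1) * b' ^+ 2.
  have [bn b'n] : b != 0 /\ b' != 0 by rewrite !gt_eqF.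
  by rewrite /t; field; rewrite bn b'n.
apply: lerD.
  apply: ler_wpM2l; first by rewrite addr_ge0// ltW.
  by rewrite ler_pXn2r ?nnegrE ?rad_ge0 ?(ltW b0)// lerDl ltW.
apply: ler_wpM2l; first by rewrite addr_ge0// invr_ge0 ltW.
by rewrite ler_pXn2r ?nnegrE ?rad_ge0 ?(ltW b'0)// lerDl ltW.
Qed.

Lemma rad_le_norm a x : rad a x <= N%:R * `|x|.
Proof.
have n0 : 0 <= N%:R * `|x| by rewrite mulr_ge0.
have N1 : 1 <= N%:R :> R by rewrite ler1n (leq_trans _ (ltn_ord a)).
rewrite -(ler_pXn2r (ltn0Sn 1)) ?nnegrE ?rad_ge0// rad_sqr.
apply: (@le_trans _ _ (\sum_(j < N) `|x| ^+ 2)).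
  rewrite [leRHS](bigID (fun j => j != a))/= -[leLHS]addr0; apply: lerD.
    apply: ler_sum => j _; rewrite -real_normK ?num_real//.
    by rewrite ler_pXn2r ?nnegrE// coord_norm_le.
  by apply: sumr_ge0 => j _; exact: sqr_ge0.
rewrite sumr_const card_ord exprMn -[leLHS]mulr_natl ler_wpM2r ?sqr_ge0//.
by rewrite expr2 ler_peMl.
Qed.

Lemma rad_lipschitz a x y : `|rad a x - rad a y| <= N%:R * `|x - y|.
Proof.
have h1 := le_trans (rad_triangle a x y) (lerD (lexx _) (rad_le_norm a (x - y))).
have h2 := le_trans (rad_triangle a y x) (lerD (lexx _) (rad_le_norm a (y - x))).
by rewrite [X in _ * X]distrC in h2; rewrite ler_norml; apply/andP; split; lra.
Qed.

Lemma lipschitz_rad a c : lipschitz (fun x => c * rad a x).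
Proof.
exists (`|c| * N%:R); split; first exact: num_real.
move=> M cM [x y] _ /=; rewrite -mulrBr normrM.
apply: le_trans (ler_wpM2r (normr_ge0 _) (ltW cM)).
by rewrite -mulrA ler_wpM2l// rad_lipschitz.
Qed.

Lemma continuous_rad a : continuous (rad a : V -> R).
Proof.
pose q x := \sum_(j < N | j != a) x ord0 j * x ord0 j.
have cq : continuous q.
  apply: smooth_continuous; apply: smooth_sum => j.
  by apply: smoothM; exact: smooth_coord.
move=> x; exact: (continuous_comp (cq x) (@sqrt_continuous R (q x))).
Qed.

Lemma open_ocone a c : open (ocone a c : set V).
Proof.
pose f x := x ord0 a - c * rad a x.
have cf : continuous f.
  move=> x; have c1 : (y : V) ord0 a @[y --> x] --> x ord0 a.
    exact: (smooth_continuous (@smooth_coord R N a)).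
  have c2 : c * rad a y @[y --> x] --> c * rad a x.
    have cr : rad a y @[y --> x] --> rad a x by exact: (@continuous_rad a x).
    exact: cvgM (cvg_cst c) cr.
  have c3 : (y : V) ord0 a - c * rad a y @[y --> x] --> x ord0 a - c * rad a x.
    exact: cvgB c1 c2.
  exact: c3.
rewrite (_ : ocone a c = f @^-1` [set t | 0 < t]).
  by apply: open_comp => [x _|]; [exact: cf|exact: open_gt].
by apply/seteqP; split => x; rewrite /ocone/f/= subr_gt0.
Qed.

Lemma starshaped_connected A z :
  (forall x (t : R), A x -> 0 <= t <= 1 -> A (z + t *: (x - z))) -> connected A.
Proof.
move=> star.
pose seg x : set V := (fun t : R => z + t *: (x - z)) @` `[0, 1].
have -> : A = \bigcup_(x in A) seg x.
  apply/seteqP; split => [x Ax|y [x Ax [t t01 <-]]].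
    exists x => //; exists 1; first by rewrite /= in_itv/= ler01 lexx.
    by rewrite scale1r addrC subrK.
  by apply: star => //; move: t01; rewrite /= in_itv.
apply: bigcup_connected.
  exists z => x _; exists 0; first by rewrite /= in_itv/= ler01 lexx.
  by rewrite scale0r addr0.
move=> x _; apply: connected_continuous_connected; first exact: segment_connected.
apply: continuous_subspaceT => t; apply: cvgD; first exact: cvg_cst.
by apply: cvgZr_tmp; exact: cvg_id.
Qed.

(** The cone is star-shaped with respect to e_a, and it is globally the strict
    epigraph of c rad over the hyperplane orthogonal to e_a. *)
Lemma is_cone_ocone a c : is_cone (ocone a c : set V).
Proof.
have ea : ocone a c (e_ a).
  by rewrite /ocone/= -[e_ a]scale1r rad_axis mulr0 !mxE !eqxx mulr1.
split.
- exact: open_ocone.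
- by exists (e_ a).
- apply: (@starshaped_connected _ (e_ a)) => x t cx /andP[t0 t1].
  have -> : e_ a + t *: (x - e_ a) = t *: x + (1 - t) *: e_ a.
    by rewrite scalerBl scale1r scalerBr addrC -addrA [- _ + _]addrC.
  rewrite /ocone/= rad_shear rad_scale// mulrCA add_coord eqxx mulr1 mxE.
  have [->|tn] := eqVneq t 0; first by rewrite !mul0r subr0 add0r ltr01.
  by rewrite ltr_wpDr ?subr_ge0// ltr_pM2l// lt0r tn.
- move=> y _; exists (e_ a), (fun x => c * rad a x), 1; split => //.
  + by rewrite enormE (bigD1 a)//= big1 ?addr0 ?mxE ?eqxx ?expr1n ?sqrtr1// => j ja;
      rewrite !mxE (negbTE ja) andbF expr0n.
  + exact: lipschitz_rad.
  + move=> x _; have -> : dotr x (e_ a) = x ord0 a.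
      rewrite /dotr (bigD1 a)//= big1 ?addr0 ?mxE ?eqxx ?mulr1// => j ja.
      by rewrite mxE (negbTE ja) andbF mulr0.
    by rewrite -scaleNr rad_shear.
- by move=> t x t0; rewrite /ocone/= rad_scale ?(ltW t0)// mulrCA mxE ltr_pM2l.
Qed.

Lemma is_cone_setT : is_cone [set: V].
Proof.
split.
- exact: openT.
- by exists 0.
- by apply: (@starshaped_connected _ 0).
- by move=> y [_]; rewrite interiorT => h; exfalso; exact: h.
- by [].
Qed.

Lemma ocone_proper a c : ocone a c `<` [set x : V | x != 0].
Proof.
split => [x cx|sub] /=; first by apply/eqP => x0; apply: (@ocone0 _ _ a c); rewrite -x0.
have /sub : [set x : V | x != 0] (- 1 *: e_ a).
  apply/eqP => /rowP/(_ a); rewrite !mxE !eqxx mulr1 => /eqP.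
  by rewrite oppr_eq0 oner_eq0.
by rewrite /ocone/= rad_axis mulr0 !mxE !eqxx mulr1 ltr0N1.
Qed.

End admissible_cones.

(** * The values of the infimum *)

Section attained_values.
Context {R : realType} {N : nat}.
Local Notation V := 'rV[R]_N.
Context (s kappa alpha beta lambda mu : R) (hN : (3 <= N)%N)
  (hs0 : 0 < s) (hs2 : s < 2) (hlambda : 0 < lambda) (hmu : 0 < mu)
  (hkappa : 0 < kappa) (halpha : 1 < alpha) (hbeta : 1 < beta)
  (hab : alpha + beta = crit_exp N s).
Local Notation S_cone := (@S_cone R N s kappa alpha beta lambda mu).
Local Notation S_low := (@S_low R N s kappa alpha beta lambda mu).
Local Notation rayleigh_ge := (@rayleigh_ge R N s kappa alpha beta lambda mu).
Implicit Types (Omega : set V) (a i j : 'I_N) (c : R) (L tau : R).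

(** The infimum over the completion is governed by test functions. *)
Lemma S_coneP Omega L : open Omega -> 0 <= L ->
  (L%:E <= S_cone Omega)%E <-> rayleigh_ge Omega L.
Proof.
move=> oO L0; split.
  move=> LS u v.
  exact: (rayleigh_of_S_cone hN hlambda hmu hkappa halpha hbeta hab oO L0 LS).
exact: (S_cone_of_rayleigh hN hlambda hmu hkappa halpha hbeta hab oO L0).
Qed.

Lemma S_cone_ge0 Omega : open Omega -> (0 <= S_cone Omega)%E.
Proof.
move=> oO; apply/(S_coneP oO (lexx 0)) => u v _ _.
by rewrite mul0e; exact: adde_ge0 (energy_ge0 u) (energy_ge0 v).
Qed.

Lemma le_ereal_reals (x y : \bar R) : (0 <= x)%E ->
  (forall L : R, 0 <= L -> (L%:E <= x -> L%:E <= y)%E) -> (x <= y)%E.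
Proof.
case: x => [x x0 H|_ H|//]; first by apply: H.
rewrite leye_eq; apply/eqP/eqyP => L L0.
by apply: H; [exact: ltW|exact: leey].
Qed.

Lemma S_cone_anti Omega Omega' : open Omega -> open Omega' -> Omega `<=` Omega' ->
  (S_cone Omega' <= S_cone Omega)%E.
Proof.
move=> oO oO' OO; apply: le_ereal_reals; first exact: S_cone_ge0.
move=> L L0 /(S_coneP oO' L0) H; apply/(S_coneP oO L0).
exact: rayleigh_mono OO H.
Qed.

Let lt0N : (0 < N)%N := leq_trans (isT : (0 < 3)%N) hN.
Let lt1N : (1 < N)%N := leq_trans (isT : (1 < 3)%N) hN.
Let a0 : 'I_N := Ordinal lt0N.
Let oc c : open (ocone a0 c : set V) := @open_ocone _ _ a0 c.

Lemma S_cone_setT_ge L : 0 <= L ->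
  (forall c, (L%:E <= S_cone (ocone a0 c))%E) -> (L%:E <= S_cone setT)%E.
Proof.
move=> L0 H; apply/(S_coneP openT L0).
apply: (@rayleigh_of_cones _ _ _ _ _ _ _ _ hlambda hmu hkappa halpha hbeta hab
   a0 (Ordinal lt1N) (Ordinal hN)) => // c.
exact: (iffLR (S_coneP (@oc c) L0) (H c)).
Qed.

(** S decreases when the domain grows, so the whole space gives a lower bound;
    the circular cones show that it is the greatest one. *)
Lemma S_low_setT : S_low = S_cone setT.
Proof.
apply/eqP; rewrite eq_le; apply/andP; split; last first.
  apply: le_ereal_inf_tmp => _ [D [[oO _ _ _ _] _] <-].
  exact: (S_cone_anti oO openT (@subsetT _ _)).
apply: le_ereal_reals.
  by apply: le_ereal_inf_tmp => _ [D [[oO _ _ _ _] _] <-]; exact: (S_cone_ge0 oO).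
move=> L L0 LS; apply: S_cone_setT_ge => // c; apply: (le_trans LS).
apply: ereal_inf_lbound; exists (ocone a0 c) => //; split.
  exact: is_cone_ocone.
exact: ocone_proper.
Qed.

Let K (eps : R) : R := ((1 + 2 * eps) * (1 + eps)) ^+ 2.

(** The constant 35 is an upper bound for (K eps - 1) / eps when eps <= 1. *)
Lemma shear_factor_lt (y z : R) : 0 <= y -> y < z ->
  exists2 eps, 0 < eps & K eps * y < z.
Proof.
move=> y0 yz; have z0 : 0 < z + 1 by rewrite addr_gt0// (le_lt_trans y0).
pose e := (z - y) / (35 * (z + 1)).
have e0 : 0 < e by rewrite divr_gt0 ?subr_gt0// mulr_gt0.
have ez : 35 * (z + 1) * e = z - y by rewrite /e mulrC divfK// gt_eqF// mulr_gt0.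
have e1 : e <= 1.
  by rewrite /e ler_pdivrMr ?mulr_gt0// mul1r; lra.
exists e => //.
have K1 : K e <= 1 + 35 * e.
  have h : (1 + 2 * e) * (1 + e) <= 1 + 5 * e by nra.
  have h0 : 0 <= (1 + 2 * e) * (1 + e) by nra.
  have h2 : K e <= (1 + 5 * e) ^+ 2 by rewrite /K; nra.
  by apply: (le_trans h2); nra.
apply: (le_lt_trans (ler_wpM2r y0 K1)).
have : e * y < e * (z + 1) by rewrite ltr_pM2l//; lra.
by move: ez; nra.
Qed.

Lemma S_cone_shear c eps L : 0 < eps -> 0 <= L ->
  (L%:E <= S_cone (ocone a0 (c + eps)) -> (L / K eps)%:E <= S_cone (ocone a0 c))%E.
Proof.
move=> e0 L0; have K0 : 0 < K eps.
  by rewrite exprn_gt0// mulr_gt0// addr_gt0// mulr_gt0.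
have LK : 0 <= L / K eps by rewrite divr_ge0// ltW.
move=> /(S_coneP (@oc _) L0) H; apply/(S_coneP (@oc _) LK).
apply: (rayleigh_shear hs0 hs2 hlambda hmu hkappa halpha hbeta hab e0 LK).
by rewrite -/(K eps) mulrC divfK// gt_eqF.
Qed.

Lemma S_ocone_mono c c' : c <= c' ->
  (S_cone (ocone a0 c) <= S_cone (ocone a0 c'))%E.
Proof.
by move=> cc; exact: (S_cone_anti (@oc c') (@oc c) (ocone_mono cc)).
Qed.

(** The intermediate value theorem for the nondecreasing function c |->
    S(ocone a0 c), at the supremum c of the set where its value is at most
    tau. This set is nonempty because the circular cones approach the whole
    space, and bounded above because S tends to +oo on thin cones; the shear
    excludes a jump on either side of c. *)
Lemma S_cone_onto tau : (S_cone setT < tau%:E)%E ->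
  exists2 Omega, is_cone Omega & S_cone Omega = tau%:E.
Proof.
move=> lt; have tau0 : 0 <= tau.
  by rewrite -lee_fin ltW//; apply: le_lt_trans lt; exact: S_cone_ge0 openT.
pose C := [set c | (S_cone (ocone a0 c) <= tau%:E)%E].
have C0 : C !=set0.
  apply: contrapT => /set0P/negP/negPn/eqP C0.
  have := @S_cone_setT_ge tau tau0; rewrite leNgt lt => /(_ _)/negP; apply => // c.
  by rewrite leNgt; apply/negP => /ltW cC; have : C c by []; rewrite C0.
have Cb : has_ubound C.
  have [c1 H] := thin_cone hN hs0 hs2 hlambda hmu hkappa halpha hbeta hab a0
    (addr_ge0 tau0 ler01).
  exists c1 => c cC; rewrite leNgt; apply/negP => c1c.
  move/(S_coneP (@oc c1) (addr_ge0 tau0 ler01)): H => H.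
  have := le_trans H (le_trans (S_ocone_mono (ltW c1c)) cC).
  by rewrite lee_fin; lra.
pose c := sup C; exists (ocone a0 c); first exact: is_cone_ocone.
apply/eqP; rewrite eq_le; apply/andP; split.
(* a value above tau at c would persist slightly to the left of c *)
- rewrite leNgt; apply/negP => ltS.
  have [L tL LS] : exists2 L, tau < L & (L%:E <= S_cone (ocone a0 c))%E.
    move: ltS; case: (S_cone _) => [y|_|//]; first by rewrite lte_fin; exists y.
    by exists (tau + 1); rewrite ?ltrDl ?leey.
  have [eps e0 KL] := shear_factor_lt tau0 tL.
  have L0 : 0 <= L by rewrite (le_trans tau0)// ltW.
  have := @S_cone_shear (c - eps) eps L e0 L0; rewrite subrK => /(_ LS) LK.
  have [c' cC' cc'] : exists2 c', C c' & c - eps < c'.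
    by apply: sup_gt => //; rewrite ltrBlDr ltrDl.
  have := le_trans LK (le_trans (S_ocone_mono (ltW cc')) cC').
  rewrite lee_fin ler_pdivrMr; last first.
    by rewrite exprn_gt0// mulr_gt0// addr_gt0// mulr_gt0.
  by rewrite mulrC leNgt KL.
(* a value below tau at c would persist slightly to the right of c *)
- rewrite leNgt; apply/negP => ltS.
  have := S_cone_ge0 (@oc c).
  move: ltS; case E : (S_cone (ocone a0 c)) => [y| |]//; rewrite lte_fin lee_fin => yt y0.
  have [eps e0 KL] := shear_factor_lt y0 yt.
  have : (tau%:E <= S_cone (ocone a0 (c + eps)))%E.
    rewrite leNgt; apply/negP => /ltW cC.
    by have := ub_le_sup Cb cC; rewrite -/c gerDl leNgt e0.
  move=> /(S_cone_shear e0 tau0); rewrite E lee_fin ler_pdivrMr; last first.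
    by rewrite exprn_gt0// mulr_gt0// addr_gt0// mulr_gt0.
  by rewrite mulrC leNgt KL.
Qed.

End attained_values.

Unset Implicit Arguments.

Theorem theorem6 (R : realType) (N : nat)
    (s lambda mu kappa alpha beta : R)
    (hN : (3 <= N)%N) (hs0 : 0 < s) (hs2 : s < 2)
    (hlambda : 0 < lambda) (hmu : 0 < mu) (hkappa : 0 < kappa)
    (halpha : 1 < alpha) (hbeta : 1 < beta)
    (hab : alpha + beta = crit_exp N s) :
  (forall tau : R, (S_low N s kappa alpha beta lambda mu <= tau%:E)%E ->
     exists Omega : set 'rV[R]_N,
       is_cone Omega /\ S_cone N s kappa alpha beta lambda mu Omega = tau%:E) /\
  ((4 <= N)%N ->
     S_low N s kappa alpha beta lambda mu =
     S_cone N s kappa alpha beta lambda mu [set: 'rV[R]_N]).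
Proof.
have E := S_low_setT hN hlambda hmu hkappa halpha hbeta hab.
split=> // tau; rewrite E le_eqVlt => /predU1P[ST|lt].
  by exists setT; split => //; exact: is_cone_setT.
have [D cD SD] := S_cone_onto hN hs0 hs2 hlambda hmu hkappa halpha hbeta hab lt.
by exists D.
Qed.
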